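(* Let $p\ge 3$ be an integer, let $(\beta,h)\in\Theta:=(0,\infty)\times\mathbb{R}$, and let $\epsilon\in(0,\tfrac12)$. Let $t_{\mathbf{mix}}(\epsilon)$ denote the mixing time of the Glauber dynamics for the $p$-spin Curie-Weiss model on $N$ nodes with parameters $(\beta,h)$. Then, as $N\to\infty$: 1. If $(\beta,h)\in\mathfrak{R}_p$, then $t_{\mathbf{mix}}(\epsilon)=\Theta_\epsilon(N\log N)$. 2. If $(\beta,h)\in\mathfrak{C}_p$, then $t_{\mathbf{mix}}(\epsilon)\ge e^{\Omega_\epsilon(N)}$. 3. If $(\beta,h)\in\mathfrak{S}_p$, then $t_{\mathbf{mix}}(\epsilon)=\Theta_\epsilon(N^{3/2})$.
   Context: Model: $\mathcal{C}_N:=\{-1,1\}^N$; for $\boldsymbol{x}\in\mathcal{C}_N$, $\bar x:=\frac1N\sum_{i=1}^N x_i$. The $p$-spin Curie-Weiss measure is the probability measure $\mathbb{P}_{\beta,h,p}$ on $\mathcal{C}_N$ with $\mathbb{P}_{\beta,h,p}(\boldsymbol{x})\propto\exp\{N(\beta\bar x^p+h\bar x)\}$. Glauber dynamics: the Markov chain $\boldsymbol{X}^t=(X^t_1,\dots,X^t_N)$ on $\mathcal{C}_N$ in which, at each step, an index $i$ is chosen uniformly from $\{1,\dots,N\}$, $X_i^{t+1}$ is drawn from the distribution on $\{-1,1\}$ with mean $\tanh(p\beta(\bar X^t)^{p-1}+h)$, and all other coordinates are unchanged. Mixing time: $t_{\mathbf{mix}}(\epsilon):=\min\{t:\max_{\boldsymbol{x}\in\mathcal{C}_N}d_{\mathrm{TV}}(\mathbb{P}_{\boldsymbol{x}}(\boldsymbol{X}^t\in\cdot),\mathbb{P}_{\beta,h,p})\le\epsilon\}$,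 where $\mathbb{P}_{\boldsymbol{x}}$ denotes the law of the chain with $\boldsymbol{X}^0=\boldsymbol{x}$ and $d_{\mathrm{TV}}$ is total variation distance (with $\min\emptyset=\infty$). Define $H_{\beta,h,p}:[-1,1]\to\mathbb{R}$ by $H_{\beta,h,p}(x)=\beta x^p+hx-I(x)$, where $I(x)=\frac12\{(1+x)\log(1+x)+(1-x)\log(1-x)\}$ (with $0\log 0=0$). A stationary point is a zero of $H'_{\beta,h,p}$. - $\mathfrak{R}_p$ ($p$-locally regular points): all $(\beta,h)\in\Theta$ such that $H_{\beta,h,p}$ has a local maximizer $m_*\in(-1,1)$ with $H''_{\beta,h,p}(m_* )<0$, and has no other stationary point. - $\mathfrak{C}_p$ ($p$-locally critical points): all $(\beta,h)\in\Theta$ such that $H_{\beta,h,p}$ has more than one local maximizer. - $\mathfrak{S}_p$ ($p$-special points): all $(\beta,h)\in\Theta$ such that $H_{\beta,h,p}$ has a unique local maximizer $m_*\in(-1,1)$, and $H''_{\beta,h,p}(m_* )=0$. The symbols $\Theta_\epsilon(\cdot)$, $\Omega_\epsilon(\cdot)$ refer to $N\to\infty$ with $\beta,h,p,\epsilon$ fixed: the implied positive constants may depend on $\epsilon,\beta,h,p$ but not on $N$, and the bounds hold for all sufficiently large $N$. *)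

(* Defs.v *)
From HB Require Import structures.
From mathcomp Require Import all_boot all_order all_algebra.
From mathcomp Require Import all_classical all_reals all_analysis.

Set Implicit Arguments.
Unset Strict Implicit.
Unset Printing Implicit Defensive.

Import Order.TTheory GRing.Theory Num.Theory.
Import numFieldNormedType.Exports.

Local Open Scope ring_scope.
Local Open Scope classical_set_scope.

(* {-1,1}^N, with true encoding the spin +1 and false the spin -1. *)
Definition cube (N : nat) : finType := {ffun 'I_N -> bool}.

Section CurieWeiss.
Variable R : realType.
Implicit Types (p N t : nat) (beta h eps : R).

Definition spin (b : bool) : R := if b then 1 else -1.

Definition mbar N (x : cube N) : R := N%:R^-1 * \sum_(i < N) spin (x i).

Definition gibbs_weight p beta h N (x : cube N) : R :=
  expR (N%:R * (beta * mbar x ^+ p + h * mbar x)).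

Definition gibbs p beta h N (x : cube N) : R :=
  gibbs_weight p beta h x / \sum_(y : cube N) gibbs_weight p beta h y.

Definition tanh (u : R) : R := (expR u - expR (- u)) / (expR u + expR (- u)).

(* The distribution on {-1,1} with mean mu gives mass (1 + mu * s) / 2
   to s. *)
Definition two_point (mu : R) (b : bool) : R := (1 + mu * spin b) / 2.

Definition set_spin N (x : cube N) (i : 'I_N) (b : bool) : cube N :=
  [ffun j => if j == i then b else x j].

Definition glauber p beta h N (x y : cube N) : R :=
  \sum_(i < N) N%:R^-1 *
    \sum_(b : bool)
      two_point (tanh (p%:R * beta * mbar x ^+ p.-1 + h)) b *
      (y == set_spin x i b)%:R.

(* Probability mass function of X^t when X^0 = x. *)
Fixpoint glauber_law p beta h N (x : cube N) t (y : cube N) : R :=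
  match t with
  | 0 => (y == x)%:R
  | t'.+1 => \sum_(z : cube N)
      glauber_law p beta h x t' z * glauber p beta h z y
  end.

Definition tv_dist N (mu nu : cube N -> R) : R :=
  \big[Num.max/0]_(A : {set cube N})
    `| \sum_(x in A) mu x - \sum_(x in A) nu x |.

Definition worst_tv p beta h N t : R :=
  \big[Num.max/0]_(x : cube N)
    tv_dist (glauber_law p beta h x t) (gibbs p beta h (N := N)).

(* The infimum of a nonempty set of naturals is attained, and the infimum of
   the empty set is +oo. The latter can occur: the conditional mean uses mbar
   of the whole configuration, so gibbs need not be stationary for glauber. *)
Definition tmix p beta h eps N : \bar R :=
  ereal_inf [set (t%:R)%:E | t in [set t | worst_tv p beta h N t <= eps]].

Definition entropyI (x : R) : R :=
  2^-1 * ((1 + x) * ln (1 + x) + (1 - x) * ln (1 - x)).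

(* Only the values on [-1, 1], and the derivatives on ]-1, 1[, are
   meaningful. *)
Definition Hfun p beta h (x : R) : R := beta * x ^+ p + h * x - entropyI x.

Definition local_maximizer p beta h (m : R) : Prop :=
  -1 <= m <= 1 /\
  \forall y \near m, -1 <= y <= 1 -> Hfun p beta h y <= Hfun p beta h m.

(* H' is infinite at -1 and 1, so stationary points are interior. *)
Definition stationary_point p beta h (m : R) : Prop :=
  -1 < m < 1 /\ (Hfun p beta h)^`() m = 0.

Definition param_space : set (R * R) := [set bh | 0 < bh.1].

Definition regular_points p : set (R * R) :=
  param_space `&` [set bh | exists m : R,
    [/\ -1 < m < 1, local_maximizer p bh.1 bh.2 m,
        (Hfun p bh.1 bh.2)^`(2) m < 0 &
        forall m', stationary_point p bh.1 bh.2 m' -> m' = m]].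

Definition critical_points p : set (R * R) :=
  param_space `&` [set bh | exists m1 m2 : R,
    [/\ m1 != m2, local_maximizer p bh.1 bh.2 m1 &
        local_maximizer p bh.1 bh.2 m2]].

Definition special_points p : set (R * R) :=
  param_space `&` [set bh | exists m : R,
    [/\ -1 < m < 1, local_maximizer p bh.1 bh.2 m,
        forall m', local_maximizer p bh.1 bh.2 m' -> m' = m &
        (Hfun p bh.1 bh.2)^`(2) m = 0]].

(* f = Theta(g) as N -> oo, for f with values in the extended reals; in
   particular f N is eventually finite. *)
Definition is_Theta (f : nat -> \bar R) (g : nat -> R) : Prop :=
  exists c C : R, [/\ 0 < c, 0 < C &
    \forall N \near \oo, ((c * g N)%:E <= f N <= (C * g N)%:E)%E].

(* f >= exp(Omega(N)) as N -> oo. *)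
Definition ge_exp_Omega (f : nat -> \bar R) : Prop :=
  exists c : R, 0 < c /\
    \forall N \near \oo, ((expR (c * N%:R))%:E <= f N)%E.

End CurieWeiss.

(* Main.v *)
Require Import Defs.
From mathcomp Require Import all_boot all_order all_algebra perm.
From mathcomp Require Import all_classical all_reals all_analysis.
From mathcomp Require Import ring lra.

Set Implicit Arguments.
Unset Strict Implicit.
Unset Printing Implicit Defensive.

Import Order.TTheory GRing.Theory Num.Theory.
Import numFieldNormedType.Exports.

Local Open Scope ring_scope.

(** Why the theorem holds. Write m for the magnetization and
    F(m) = tanh(p beta m^(p-1) + h) - m. The magnetization is a Markov chain with
    steps of size 2 / N, mean displacement F(m) / N and displacement variance of
    order 1 / N^2. On the open interval F has the sign of H', and
    F' = (1 - m^2) H'' + O(F), so the shape of H dictates that of F: at a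
    regular point F is a linear restoring force towards m0, at a special point a
    cubic one, and several local maximizers mean several wells.

    The upper bounds have two steps. For configurations of equal magnetization,
    the effect on P^t f of exchanging two opposite spins shrinks by 1 - 1/N at each
    step (step_swap_lipschitz), because the conditional law of a refreshed spin
    depends on the magnetization only; after order N log N steps P^t f is almost a
    function of the magnetization. Then two independent copies of the magnetization
    meet: coupling_bound reduces this to a Lyapunov function of the pair, built in
    level_mixing. Diffusion and drift balance at the scale 1 / sqrt S with S^r = N,
    where |F(m)| is of order |m - m0|^(2r-1); the corresponding time is N^2 / S, that
    is N for r = 1 and N^(3/2) for r = 2. For r = 1 the way down from macroscopic
    distance costs a further factor log N, for r = 2 it does not, because
    dx/dt = - x^3 comes down from infinity in finite time.

    The conditional mean uses the magnetization of the whole configuration, so the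
    Gibbs measure is not stationary. The dynamics is reversible for an explicit
    measure (detailed_balance), and a trapezoidal rule shows that the density of the
    Gibbs measure with respect to it is, within O(1/N), a smooth function of m. Both
    measures concentrate at m0, hence are close in total variation (stat_gibbs).

    For the lower bounds with a single well, start from all spins plus: the mean of
    1 / (1 + S (m - m0)^2) cannot grow fast, whereas the Gibbs measure puts most of
    its mass where this observable is bounded below (worst_tv_lower). For several
    wells, an exponential supermartingale on the layers where F points inwards keeps
    the chain in the well it started from for exponential time (well_confines), and
    one of two disjoint wells has Gibbs mass at most 1/2 (metastable_lower).

    The analytic input is that (1 - x^2) H''(x) is the polynomial
    K (x^n - x^(n+2)) - 1 with n = p - 2. Being nonzero, it prevents H from being flat,
    so that local maximizers are surrounded by layers with inward drift. At a special
    point it has a double root (double_root), which forces m0^2 = n / (n + 2) and makes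
    the polynomial nonpositive (curvature_le0): H is concave and F is exactly cubic. *)

(** * The transition operator and the magnetization chain *)

Section Tanh.
Variable R : realType.
Implicit Types u : R.

Lemma tanh_den_gt0 u : 0 < expR u + expR (- u).
Proof. by rewrite addr_gt0 ?expR_gt0. Qed.

Lemma two_point_tanh u (b : bool) :
  two_point (tanh u) b = expR (spin R b * u) / (expR u + expR (- u)).
Proof.
rewrite /two_point /tanh /spin; have := tanh_den_gt0 u.
by case: b; rewrite ?mulN1r ?mul1r => d0; field; apply: lt0r_neq0.
Qed.

Lemma two_point_gt0 u b : 0 < two_point (tanh u) b.
Proof. by rewrite two_point_tanh divr_gt0 ?expR_gt0 ?tanh_den_gt0. Qed.

Lemma sum_two_point mu : \sum_(b : bool) two_point mu b = 1 :> R.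
Proof. by rewrite big_bool /two_point /spin /=; field. Qed.

Lemma tanh_bound u : -1 < tanh u < 1.
Proof.
have := two_point_gt0 u true; have := two_point_gt0 u false.
by rewrite /two_point /spin => ? ?; apply/andP; split; lra.
Qed.
End Tanh.

Section Chain.
Variables (R : realType) (p : nat) (beta h : R).

Definition field_at (m : R) : R := p%:R * beta * m ^+ p.-1 + h.
(** The hyperbolic tangent of the field seen by a spin; the field uses the whole
    magnetization, including the spin that is refreshed. *)
Definition cond_mean (m : R) : R := tanh (field_at m).
(** N times the expected change of the magnetization in one step. *)
Definition drift (m : R) : R := cond_mean m - m.
Definition up_rate (m : R) : R := (1 - m) / 2 * two_point (cond_mean m) true.
Definition down_rate (m : R) : R := (1 + m) / 2 * two_point (cond_mean m) false.

Section FixedN.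
Variable N : nat.
Hypothesis N_gt0 : (0 < N)%N.
Implicit Types (x y : cube N) (f : cube N -> R).

Let Nne0 : N%:R != 0 :> R. Proof. by rewrite pnatr_eq0 -lt0n. Qed.
Let Ngt0 : 0 < N%:R :> R. Proof. by rewrite ltr0n. Qed.

(** The transition operator acting on observables. All probabilistic arguments
    are phrased with it instead of with laws or couplings. *)
Definition step f x : R := \sum_y glauber p beta h x y * f y.

Lemma stepE f x : step f x =
  N%:R^-1 * \sum_i \sum_(b : bool)
    two_point (cond_mean (mbar R x)) b * f (set_spin x i b).
Proof.
rewrite /step mulr_sumr; under eq_bigr do rewrite /glauber mulr_suml.
rewrite exchange_big /=; apply: eq_bigr => i _.
transitivity (\sum_y N%:R^-1 * \sum_(b : bool)
    two_point (cond_mean (mbar R x)) b * (y == set_spin x i b)%:R * f y).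
  by apply: eq_bigr => y _; rewrite -(mulrA N%:R^-1) mulr_suml.
rewrite -mulr_sumr exchange_big /=; congr (_ * _); apply: eq_bigr => b _.
rewrite (bigD1 (set_spin x i b)) //= eqxx mulr1 big1 ?addr0 // => y ny.
by rewrite (negPf ny) mulr0 mul0r.
Qed.

(** Duality between laws and observables: expectations under the law of X^t are
    values of the t-th iterate of the transition operator. *)
Lemma glauber_law_step x t f :
  \sum_y glauber_law p beta h x t y * f y = iter t step f x.
Proof.
elim: t f => [|t IH] f /=.
  rewrite (bigD1 x) //= eqxx mul1r big1 ?addr0 // => y ny.
  by rewrite (negPf ny) mul0r.
rewrite -iterS iterSr -IH; under eq_bigr do rewrite mulr_suml.
rewrite exchange_big /=; apply: eq_bigr => z _.
by rewrite /step mulr_sumr; apply: eq_bigr => y _; rewrite mulrA.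
Qed.

Lemma ler_step f g x : (forall y, f y <= g y) -> step f x <= step g x.
Proof.
move=> fg; rewrite !stepE ler_pM2l ?invr_gt0 //.
apply: ler_sum => i _; apply: ler_sum => b _.
by rewrite ler_pM2l ?two_point_gt0.
Qed.

Lemma stepD f g x : step (fun y => f y + g y) x = step f x + step g x.
Proof.
by rewrite /step -big_split; apply: eq_bigr => y _; rewrite mulrDr.
Qed.

Lemma stepZ a f x : step (fun y => a * f y) x = a * step f x.
Proof.
by rewrite /step mulr_sumr; apply: eq_bigr => y _; rewrite mulrCA.
Qed.

Lemma step_cst a x : step (fun=> a) x = a.
Proof.
rewrite stepE; under eq_bigr do rewrite -mulr_suml sum_two_point mul1r.
by rewrite sumr_const card_ord -(mulr_natl a) mulrA mulVf // mul1r.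
Qed.

Lemma eq_step f g x : f =1 g -> step f x = step g x.
Proof. by move=> fg; rewrite /step; apply: eq_bigr => y _; rewrite fg. Qed.

Lemma ler_norm_step f x : `|step f x| <= step (fun y => `|f y|) x.
Proof.
rewrite !stepE normrM gtr0_norm ?invr_gt0 // ler_pM2l ?invr_gt0 //.
apply: le_trans (ler_norm_sum _ _ _) _; apply: ler_sum => i _.
apply: le_trans (ler_norm_sum _ _ _) _; apply: ler_sum => b _.
by rewrite normrM gtr0_norm ?two_point_gt0.
Qed.

Lemma sum_spin x : \sum_i spin R (x i) = N%:R * mbar R x.
Proof. by rewrite /mbar mulrA mulfV // mul1r. Qed.

Lemma mbar_bound x : -1 <= mbar R x <= 1.
Proof.
have sb (b : bool) : -1 <= spin R b <= 1 by case: b; rewrite /spin; lra.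
have E c : \sum_(i < N) c = N%:R * c :> R.
  by rewrite sumr_const card_ord mulr_natl.
apply/andP; split; rewrite -(ler_pM2l Ngt0) -sum_spin -E;
  by apply: ler_sum => i _; case/andP: (sb (x i)).
Qed.

Lemma mbar_set_spin x i b :
  mbar R (set_spin x i b) = mbar R x + N%:R^-1 * (spin R b - spin R (x i)).
Proof.
rewrite /mbar -mulrDr; congr (_ * _); rewrite (bigD1 i) //= [in RHS](bigD1 i) //=.
rewrite /set_spin ffunE eqxx addrAC; set s := \sum_(j < N | _) _.
set s' := \sum_(j < N | _) _; suff -> : s = s' by lra.
by apply: eq_bigr => j /negPf nj; rewrite ffunE nj.
Qed.

(** The transition operator of the magnetization, which is itself a Markov chain
    with steps of size 2 / N. *)
Definition lstep (phi : R -> R) (m : R) : R :=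
  up_rate m * phi (m + 2 / N%:R) + down_rate m * phi (m - 2 / N%:R)
  + (1 - up_rate m - down_rate m) * phi m.

(** A refreshed site carries a plus with probability (1 + m) / 2, and this is the
    only feature of the configuration that the new magnetization depends on. *)
Lemma step_mbar (phi : R -> R) x :
  step (fun y => phi (mbar R y)) x = lstep phi (mbar R x).
Proof.
rewrite stepE; set m := mbar R x; set q := two_point (cond_mean m).
have q1 : q true + q false = 1 by rewrite -(sum_two_point (cond_mean m)) big_bool.
pose A := q true * phi m + q false * phi (m - 2 / N%:R).
pose B := q true * phi (m + 2 / N%:R) + q false * phi m.
transitivity (N%:R^-1 * \sum_(i < N) ((A + B) / 2 + spin R (x i) * ((A - B) / 2))).
  congr (_ * _); apply: eq_bigr => i _; rewrite big_bool /= !mbar_set_spin -/m /A /B.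
  rewrite /spin; case: (x i); rewrite ?subrr ?mulr0 ?addr0.
    by rewrite (_ : m + N%:R^-1 * (-1 - 1) = m - 2 / N%:R); [field|field].
  by rewrite (_ : m + N%:R^-1 * (1 - -1) = m + 2 / N%:R); [field|field].
rewrite big_split /= sumr_const card_ord -(mulr_natl _ N) -mulr_suml sum_spin -/m.
rewrite /lstep /up_rate /down_rate -/q /A /B.
have -> : q false = 1 - q true by lra.
by field.
Qed.

Lemma up_rate_ge0 m : m <= 1 -> 0 <= up_rate m.
Proof.
by move=> m1; rewrite mulr_ge0 // ?(ltW (two_point_gt0 _ _)) //; lra.
Qed.

Lemma down_rate_ge0 m : -1 <= m -> 0 <= down_rate m.
Proof.
by move=> m1; rewrite mulr_ge0 // ?(ltW (two_point_gt0 _ _)) //; lra.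
Qed.

Lemma rates_drift m : up_rate m - down_rate m = drift m / 2.
Proof. by rewrite /up_rate /down_rate /drift /two_point /spin; field. Qed.

Lemma rates_le1 m : -1 <= m <= 1 -> up_rate m + down_rate m <= 1.
Proof.
move=> mb; rewrite /up_rate /down_rate /two_point /spin.
by have := tanh_bound (field_at m); rewrite -/(cond_mean m) => tb; nra.
Qed.

End FixedN.
End Chain.

(** * Contraction at fixed magnetization *)

Section Swap.
Variables (R : realType) (p : nat) (beta h : R) (N : nat).
Hypothesis N_gt0 : (0 < N)%N.
Implicit Types (x y : cube N) (f : cube N -> R).
Local Notation step := (step p beta h (N := N)).

Let Ngt0 : 0 < N%:R :> R. Proof. by rewrite ltr0n. Qed.

Definition swap x (i j : 'I_N) : cube N := [ffun k => x (tperm i j k)].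

Definition swap_lipschitz f (L : R) : Prop :=
  forall x i j, `|f x - f (swap x i j)| <= L.

Lemma mbar_swap x i j : mbar R (swap x i j) = mbar R x.
Proof.
rewrite /mbar; congr (_ * _); rewrite [RHS](reindex_inj (@perm_inj _ (tperm i j))).
by apply: eq_bigr => k _; rewrite ffunE.
Qed.

Lemma set_spin_swap x i j k b :
  set_spin (swap x i j) (tperm i j k) b = swap (set_spin x k b) i j.
Proof.
apply/ffunP => l; rewrite !ffunE; congr (if _ then _ else _).
by rewrite -(inj_eq (@perm_inj _ (tperm i j))) tpermK.
Qed.

Lemma swap_id x i j : x i = x j -> swap x i j = x.
Proof.
by move=> xij; apply/ffunP => k; rewrite ffunE; case: tpermP => // ->.
Qed.

(** Path coupling for configurations of equal magnetization. Refresh site k of x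
    and the site that corresponds to k under the transposition in the swapped
    configuration, with the same new spin. The two results are again swaps of each
    other, and they coincide when k is one of the two swapped sites and receives
    the spin of the other one; this happens with total probability 1 / N since
    both conditional laws are equal and the two spins are opposite. *)
Lemma step_swap_lipschitz f L : swap_lipschitz f L ->
  swap_lipschitz (step f) ((1 - N%:R^-1) * L).
Proof.
move=> fL x i j; have L0 : 0 <= L by apply: le_trans (fL x i j).
have N1 : N%:R^-1 <= 1 :> R by rewrite invf_le1 ?ler1n.
have [xij|xij] := eqVneq (x i) (x j).
  by rewrite swap_id // subrr normr0 mulr_ge0 // subr_ge0.
have xjE : x j = ~~ x i by move: xij; case: (x i); case: (x j).
have ij : (i == j) = false by apply/eqP => eij; rewrite eij eqxx in xij.
rewrite !stepE mbar_swap; set q := two_point _.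
have q0 b : 0 <= q b by rewrite ltW ?two_point_gt0.
have q1 : q true + q false = 1 by rewrite -(sum_two_point (cond_mean p beta h (mbar R x))) big_bool.
rewrite [X in _ - _ * X](reindex_inj (@perm_inj _ (tperm i j))) /=.
rewrite -mulrBr -sumrB normrM gtr0_norm ?invr_gt0 //.
pose c (k : 'I_N) (b : bool) : R := 1 - ((k == i) && (b == x j))%:R - ((k == j) && (b == x i))%:R.
apply: (@le_trans _ _ (N%:R^-1 * \sum_k \sum_(b : bool) q b * (L * c k b))).
  rewrite ler_pM2l ?invr_gt0 //; apply: le_trans (ler_norm_sum _ _ _) _.
  apply: ler_sum => k _; rewrite -sumrB; apply: le_trans (ler_norm_sum _ _ _) _.
  apply: ler_sum => b _; rewrite -mulrBr normrM (ger0_norm (q0 b)) ler_wpM2l //.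
  rewrite set_spin_swap /c.
  have [/andP[/eqP -> /eqP ->]|_] := boolP ((k == i) && _).
    rewrite swap_id; last by rewrite !ffunE eqxx eq_sym ij.
    by rewrite subrr normr0 ij /= subrr subr0 mulr0.
  have [/andP[/eqP -> /eqP ->]|_] := boolP ((k == j) && _).
    rewrite swap_id; last by rewrite !ffunE eqxx ij.
    by rewrite subrr normr0 subr0 subrr mulr0.
  by rewrite !subr0 mulr1 fL.
rewrite le_eqVlt; apply/orP; left; apply/eqP.
transitivity (N%:R^-1 * \sum_k (L - (k == i)%:R * (L * q (x j)) - (k == j)%:R * (L * q (x i)))).
  congr (_ * _); apply: eq_bigr => k _; rewrite big_bool /= /c xjE.
  have E : q true = 1 - q false by lra.
  by case: (x i); case: (k == i); case: (k == j) => /=; rewrite E; ring.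
have S l a : \sum_(k < N) (k == l)%:R * a = a :> R.
  by rewrite (bigD1 l) //= eqxx mul1r big1 ?addr0 // => k /negPf ->; rewrite mul0r.
rewrite !big_split /= !sumrN !S sumr_const card_ord -(mulr_natl _ N).
have E : q (x j) = 1 - q (x i) by rewrite xjE; case: (x i) => /=; lra.
by rewrite E; field; apply: lt0r_neq0.
Qed.

Lemma iter_swap_lipschitz f L t : swap_lipschitz f L ->
  swap_lipschitz (iter t step f) ((1 - N%:R^-1) ^+ t * L).
Proof.
move=> fL; elim: t => [|t IH]; first by rewrite mul1r.
by rewrite iterS exprS -mulrA; apply: step_swap_lipschitz.
Qed.

(** Configurations of equal magnetization are joined by at most N swaps. *)
Lemma swap_lipschitz_level f L x y : swap_lipschitz f L ->
  mbar R x = mbar R y -> `|f x - f y| <= N%:R * L.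
Proof.
move=> fL; have i0 := Ordinal N_gt0.
have L0 : 0 <= L by exact: le_trans (fL x i0 i0).
suff: mbar R x = mbar R y -> `|f x - f y| <= #|[set i | x i && ~~ y i]|%:R * L.
  move=> H /H /le_trans; apply; rewrite ler_wpM2r ?ler_nat //.
  by rewrite -[X in (_ <= X)%N]card_ord max_card.
(* each swap of a + site of x with a - site of y against the opposite pattern
   removes one site of the set of disagreements of this kind *)
have [m] := ubnP #|[set i | x i && ~~ y i]|.
elim: m x => // m IH x; rewrite ltnS => cm xy.
have s0 : \sum_i (spin R (x i) - spin R (y i)) = 0.
  by rewrite sumrB !sum_spin // xy subrr.
have [/existsP[i /andP[xi yi]]|/existsPn nx] := boolP [exists i, x i && ~~ y i].
  have [/existsP[j /andP[xj yj]]|/existsPn nx] := boolP [exists j, ~~ x j && y j].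
    have xij : x i != x j by rewrite xi (negPf xj).
    have ij : i != j by apply: contra xij => /eqP ->.
    have D : [set k | swap x i j k && ~~ y k] = [set k | x k && ~~ y k] :\ i.
      apply/setP => k; rewrite !inE ffunE; case: tpermP => [->|->|/eqP ki /eqP kj].
      - by rewrite eqxx (negPf xj).
      - by rewrite yj !andbF.
      - by rewrite ki.
    have cD : #|[set k | x k && ~~ y k]| = #|[set k | swap x i j k && ~~ y k]|.+1.
      by rewrite D (cardsD1 i) inE xi yi.
    rewrite cD -natr1 mulrDl mul1r -(subrK (f (swap x i j)) (f x)) -addrA.
    rewrite [leRHS]addrC; apply: le_trans (ler_normD _ _) _; apply: lerD; first exact: fL.
    by apply: IH; rewrite ?mbar_swap // -ltnS -cD.
  have t0 k : 0 <= spin R (x k) - spin R (y k).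
    by have := nx k; rewrite /spin; case: (x k); case: (y k) => //= _; lra.
  have /eqP := s0; rewrite psumr_eq0 // => /allP /(_ i (mem_index_enum _)) /=.
  by rewrite xi (negPf yi) /spin => /eqP; lra.
suff -> : x = y by rewrite subrr normr0 mulr_ge0.
have t0 k : 0 <= spin R (y k) - spin R (x k).
  by have := nx k; rewrite /spin; case: (x k); case: (y k) => //= _; lra.
have /eqP : \sum_i (spin R (y i) - spin R (x i)) = 0.
  by rewrite sumrB !sum_spin // xy subrr.
rewrite psumr_eq0 // => /allP H; apply/ffunP => k.
have := H k (mem_index_enum _); rewrite /= /spin.
by case: (x k); case: (y k) => //= /eqP; lra.
Qed.
End Swap.

(** * Coupling through a Lyapunov function of pairs *)

Section Level.
Variables (R : realType) (N : nat).
Hypothesis N_gt0 : (0 < N)%N.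
Implicit Types (x y : cube N).

Definition level x : nat := \sum_i x i.

Lemma mbar_level x : mbar R x = (2 * (level x)%:R - N%:R) / N%:R.
Proof.
rewrite /mbar mulrC; congr (_ / _); rewrite /level natr_sum mulr_sumr.
transitivity (\sum_(i < N) (2 * (x i)%:R - 1) : R).
  by apply: eq_bigr => i _; rewrite /spin; case: (x i) => /=; ring.
by rewrite big_split /= sumrN sumr_const card_ord.
Qed.

(** Magnetizations live on a grid of step 2 / N. *)
Lemma mbar_gap x y : mbar R x < mbar R y ->
  mbar R y - mbar R x = 2 / N%:R \/ 2 * (2 / N%:R) <= mbar R y - mbar R x.
Proof.
have N0 : 0 < N%:R :> R by rewrite ltr0n.
rewrite !mbar_level ltr_pM2r ?invr_gt0 // ltrD2r ltr_pM2l // ltr_nat => xy.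
rewrite -mulrBl mulrA ler_pM2r ?invr_gt0 //.
move: xy; rewrite leq_eqVlt => /orP[/eqP <-|xy].
  by left; congr (_ / _); rewrite -natr1; ring.
by right; move: xy; rewrite -(ler_nat R) -!natr1; lra.
Qed.
End Level.

Section Coupling.
Variables (R : realType) (p : nat) (beta h : R) (N : nat).
Hypothesis N_gt0 : (0 < N)%N.
Implicit Types (x y : cube N) (f : cube N -> R).
Local Notation step := (step p beta h (N := N)).

(** Run two copies independently and let Psi be a Lyapunov function of the pair
    that loses at least kap per step while the magnetizations differ. The number of
    steps before they meet has expectation at most Psi / kap, so by Markov's
    inequality the copies have not met after n steps with probability at most
    Psi / (kap n). The induction keeps this bound without mentioning the meeting
    time: oscillations of P^n f are at most 1, are at most rho on the diagonal, and
    are averaged by the pair chain. *)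
Lemma coupling_bound (Psi : cube N -> cube N -> R) (kap rho : R) f n x y :
  0 <= kap -> 0 <= rho ->
  (forall x y, 0 <= Psi x y) -> (forall x y, Psi x y = Psi y x) ->
  (forall x y, mbar R x < mbar R y ->
     step (fun x' => step (fun y' => Psi x' y') y) x + kap <= Psi x y) ->
  (forall t x y, `|iter t step f x - iter t step f y| <= 1) ->
  (forall t x y, mbar R x = mbar R y ->
     `|iter t step f x - iter t step f y| <= rho) ->
  kap * n%:R * (`|iter n step f x - iter n step f y| - rho) <= Psi x y.
Proof.
move=> k0 r0 Psi0 Psis PsiD osc1 oscr; elim: n x y => [|n IH] x y.
  by rewrite mulr0 mul0r.
wlog xy : x y / mbar R x <= mbar R y => [W|].
  have [/W//|/ltW/W] := leP (mbar R x) (mbar R y).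
  by rewrite distrC Psis.
move: xy; rewrite le_eqVlt => /orP[/eqP xy|xy].
  apply: le_trans (Psi0 x y); apply: mulr_ge0_le0; first by rewrite mulr_ge0.
  by rewrite subr_le0 oscr.
have u1 := osc1 n.+1 x y.
suff H : kap * n%:R * (`|iter n.+1 step f x - iter n.+1 step f y| - rho) <=
    step (fun x' => step (fun y' => Psi x' y') y) x.
  have := PsiD x y xy; move: H; set u := `|_ - _| in u1 *.
  rewrite -natr1 => H1 H2; have : kap * (u - rho) <= kap * 1 by rewrite ler_wpM2l //; lra.
  lra.
rewrite !iterS.
have E1 : step (iter n step f) x - step (iter n step f) y =
  step (fun x' => step (fun y' => iter n step f x' - iter n step f y') y) x.
  under [RHS]eq_step => x'.
    rewrite (stepD _ _ _ (fun=> _) (fun y' => - iter n step f y')) step_cst //.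
    over.
  rewrite (stepD _ _ _ _ (fun=> _)) step_cst //; congr (_ + _).
  by rewrite -mulN1r -stepZ; apply: eq_step => y'; rewrite mulN1r.
rewrite {}E1.
set g := fun x' y' => iter n step f x' - iter n step f y'.
apply: (@le_trans _ _ (step (fun x' => step (fun y' => kap * n%:R * (`|g x' y'| - rho)) y) x)).
  have affine F z : step (fun y' => kap * n%:R * (F y' - rho)) z =
      kap * n%:R * (step F z - rho).
    by rewrite (stepZ _ _ _ _ (fun y' => F y' - rho)) (stepD _ _ _ _ (fun=> - rho)) step_cst.
  have E2 x' : step (fun y' => kap * n%:R * (`|g x' y'| - rho)) y =
      kap * n%:R * (step (fun y' => `|g x' y'|) y - rho) by rewrite affine.
  rewrite (eq_step _ _ _ _ E2) affine ler_wpM2l ?mulr_ge0 // lerD2r.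
  apply: (le_trans (ler_norm_step _ _ _ N_gt0 _ _)).
  by apply: ler_step => // x'; apply: ler_norm_step.
by do 2 (apply: ler_step => // ?); exact: IH.
Qed.
End Coupling.

(** * One step drift estimates *)

Section LevelStep.
Variables (R : realType) (p : nat) (beta h : R) (N : nat).
Hypothesis N_gt0 : (0 < N)%N.
Local Notation lstep := (lstep p beta h N).
Local Notation up := (up_rate p beta h).
Local Notation down := (down_rate p beta h).
Local Notation drift := (drift p beta h).
Implicit Types (phi : R -> R) (m : R).

Let Ngt0 : 0 < N%:R :> R. Proof. by rewrite ltr0n. Qed.

Lemma lstep_le phi m v1 v2 v3 : -1 <= m <= 1 ->
  phi (m + 2 / N%:R) <= v1 -> phi (m - 2 / N%:R) <= v2 -> phi m <= v3 ->
  lstep phi m <= up m * v1 + down m * v2 + (1 - up m - down m) * v3.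
Proof.
move=> mb h1 h2 h3; have /andP[m1 m2] := mb.
have := rates_le1 p beta h mb.
have := up_rate_ge0 p beta h m2; have := down_rate_ge0 p beta h m1.
by move=> d0 u0 s1; rewrite /lstep !lerD // ler_wpM2l //; lra.
Qed.

(** The exact generator of the squared distance to m0: a drift term of order 1 / N
    and a noise term of order 1 / N^2. *)
Lemma lstep_sqdist m0 m : lstep (fun m' => (m' - m0) ^+ 2) m =
  (m - m0) ^+ 2 + 2 / N%:R * ((m - m0) * drift m) + 4 / N%:R ^+ 2 * (up m + down m).
Proof.
have -> : drift m = 2 * (up m - down m) by rewrite rates_drift; field.
by rewrite /lstep; field; apply: lt0r_neq0.
Qed.

Lemma lstep_sqdist_le m0 c r m : -1 <= m <= 1 ->
  (m - m0) * drift m <= - c * (m - m0) ^+ (2 * r) ->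
  lstep (fun m' => (m' - m0) ^+ 2) m <=
  (m - m0) ^+ 2 - 2 * c / N%:R * (m - m0) ^+ (2 * r) + 4 / N%:R ^+ 2.
Proof.
move=> mb H; rewrite lstep_sqdist -!addrA lerD2l; apply: lerD.
  have -> : - (2 * c / N%:R * (m - m0) ^+ (2 * r)) =
    2 / N%:R * (- c * (m - m0) ^+ (2 * r)) by field; apply: lt0r_neq0.
  by rewrite ler_wpM2l // divr_ge0 // ltW.
rewrite -[leRHS]mulr1 ler_wpM2l ?rates_le1 // divr_ge0 // exprn_ge0 //.
Qed.

(** A concave function of w = S (m - m0)^2 lies below its tangent, so its expected
    change is at most its derivative times the expected change of w. With S^r = N
    the drift and the noise of w both have size S / N^2. *)
Lemma lstep_concave (phi : R -> R) A r m0 c S m :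
  0 < A -> 0 <= S -> S ^+ r = N%:R -> -1 <= m <= 1 ->
  (forall w w', 0 <= w -> 0 <= w' -> phi w' <= phi w + (w' - w) / (A + w) ^+ r) ->
  (m - m0) * drift m <= - c * (m - m0) ^+ (2 * r) ->
  lstep (fun m' => phi (S * (m' - m0) ^+ 2)) m <=
  phi (S * (m - m0) ^+ 2) + S / N%:R ^+ 2 *
    ((4 - 2 * c * (S * (m - m0) ^+ 2) ^+ r) / (A + S * (m - m0) ^+ 2) ^+ r).
Proof.
move=> A0 S0 SN mb phic H; set w := S * _.
have w0 m' : 0 <= S * (m' - m0) ^+ 2 by rewrite mulr_ge0 // sqr_ge0.
set D := (A + w) ^+ r; have D0 : 0 < D by rewrite exprn_gt0 // ltr_pwDl // w0.
apply: le_trans (lstep_le mb (phic _ _ (w0 m) (w0 _)) (phic _ _ (w0 m) (w0 _)) (phic _ _ (w0 m) (w0 m))) _.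
rewrite -/w -/D.
have -> : up m * (phi w + (S * (m + 2 / N%:R - m0) ^+ 2 - w) / D) +
  down m * (phi w + (S * (m - 2 / N%:R - m0) ^+ 2 - w) / D) +
  (1 - up m - down m) * (phi w + (w - w) / D) =
  phi w + S / D * (lstep (fun m' => (m' - m0) ^+ 2) m - (m - m0) ^+ 2).
  by rewrite /lstep /w; field; rewrite !lt0r_neq0.
rewrite lerD2l.
have -> : S / N%:R ^+ 2 * ((4 - 2 * c * w ^+ r) / D) =
   S / D * ((4 - 2 * c * w ^+ r) / N%:R ^+ 2) by field; rewrite !lt0r_neq0.
rewrite ler_wpM2l ?divr_ge0 ?(ltW D0) // lerBlDl.
apply: le_trans (lstep_sqdist_le mb H) _.
rewrite exprMn SN -exprM; rewrite le_eqVlt; apply/orP; left; apply/eqP.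
by field; apply: lt0r_neq0.
Qed.

Lemma expR_ge_sqr (x : R) : -2 <= x -> (1 + x / 2) ^+ 2 <= expR x.
Proof.
move=> x2; rewrite [X in expR X](_ : x = x / 2 + x / 2); last by field.
have e1 := expR_ge1Dx (x / 2); have x0 : 0 <= 1 + x / 2 by lra.
by rewrite expRD expr2 ler_pM.
Qed.

(** Bounded concave cost of the gap between two magnetizations, up to the jump J on
    the diagonal. The jump pays for the pairs of neighbours that exchange their
    places instead of meeting. *)
Definition gap_cost (s J a b : R) : R :=
  1 - expR (- (s / 2 * `|b - a|)) + J * (a != b)%:R.

Lemma gap_cost_sym s J a b : gap_cost s J a b = gap_cost s J b a.
Proof. by rewrite /gap_cost distrC eq_sym. Qed.

Lemma gap_cost_bound s J a b : 0 <= s -> 0 <= J -> 0 <= gap_cost s J a b <= 1 + J.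
Proof.
move=> s0 J0; rewrite /gap_cost.
have : expR (- (s / 2 * `|b - a|)) <= 1 by rewrite expR_le1 oppr_le0 mulr_ge0 // divr_ge0.
have := expR_gt0 (- (s / 2 * `|b - a|)).
by case: (a != b); rewrite /= ?mulr1 ?mulr0; lra.
Qed.

(** Evolution of the gap under two independent moves. The first order term is the
    difference of the drifts; concavity turns the noise, whose variance is bounded
    below through c0, into a gain of order (s / N)^2. Neighbours may jump over each
    other, but they then also meet with probability at least c0^2 in the same step,
    and the jump J compensates for the former. *)
Lemma lstep_gap_cost s J c0 a b :
  -1 <= a <= 1 -> -1 <= b <= 1 -> a < b ->
  b - a = 2 / N%:R \/ 2 * (2 / N%:R) <= b - a ->
  0 <= s -> s <= N%:R -> 0 < c0 -> c0 <= 2^-1 -> 4 / c0 ^+ 2 <= J ->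
  (forall m t, -1 <= m <= 1 -> c0 <= two_point (cond_mean p beta h m) t) ->
  lstep (fun a' => lstep (gap_cost s J a') b) a <=
  gap_cost s J a b + expR (- (s / 2 * (b - a))) *
   (s / N%:R * (drift b - drift a) / 2 - (s / N%:R) ^+ 2 * c0 / 4).
Proof.
move=> ab bb aLb gap s0 sN c0_gt0 c0_le J_ge tp.
have rates x : -1 <= x <= 1 -> c0 <= up x + down x <= 1 - c0.
  move=> xb; have ut := tp x true xb; have uf := tp x false xb.
  have s1 : two_point (cond_mean p beta h x) true + two_point (cond_mean p beta h x) false = 1.
    by rewrite -(sum_two_point (cond_mean p beta h x)) big_bool.
  by rewrite /up_rate /down_rate; apply/andP; split; nra.
have driftE x : drift x = 2 * (up x - down x) by rewrite rates_drift; field.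
have var x : -1 <= x <= 1 -> c0 / 2 <= (up x + down x) - (up x - down x) ^+ 2.
  move=> xb; have /andP[sl su] := rates x xb; have /andP[x1 x2] := xb.
  have := up_rate_ge0 p beta h x2; have := down_rate_ge0 p beta h x1.
  nra.
have /andP[a1 a2] := ab; have /andP[b1 b2] := bb.
have J0 : 0 <= J by apply: le_trans J_ge; rewrite divr_ge0 // sqr_ge0.
set hh := s / N%:R; have hh0 : 0 <= hh by rewrite divr_ge0 // ltW.
have hh1 : hh <= 1 by rewrite ler_pdivrMr // mul1r.
set e := 2 / N%:R in gap; have e0 : 0 < e by rewrite divr_gt0.
set E := expR _; have E0 : 0 < E by exact: expR_gt0.
have E1 : E <= 1 by rewrite expR_le1 oppr_le0 mulr_ge0 // ?divr_ge0 // ltW // subr_gt0.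
have ua0 := up_rate_ge0 p beta h a2; have da0 := down_rate_ge0 p beta h a1.
have ub0 := up_rate_ge0 p beta h b2; have db0 := down_rate_ge0 p beta h b1.
have sa1 := rates_le1 p beta h ab; have sb1 := rates_le1 p beta h bb.
(* value of the extended cost when the gap changes by eta steps *)
pose q eta : R := 1 - E * (1 - hh * eta / 2) ^+ 2.
have qP a' b' eta k : -2 <= eta <= 2 -> b' - a' = b - a + e * eta -> a' <= b' ->
    (a' != b')%:R <= k :> R -> gap_cost s J a' b' <= q eta + J * k.
  move=> etab ba a'b' k1; rewrite /gap_cost /q lerD ?ler_wpM2l //.
  rewrite lerD2l lerN2 ger0_norm ?subr_ge0 // ba mulrDr opprD expRD -/E ler_wpM2l ?(ltW E0) //.
  have -> : s / 2 * (e * eta) = hh * eta by rewrite /e /hh; field; apply: lt0r_neq0.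
  rewrite [X in X ^+ 2](_ : _ = 1 + - (hh * eta) / 2); last by rewrite mulNr.
  by apply: expR_ge_sqr; nra.
have k01 (x : bool) : x%:R <= 1 :> R by case: x.
have abE : gap_cost s J a b = 1 - E + J.
  by rewrite /gap_cost ger0_norm ?subr_ge0 ?ltW // lt_eqF //= mulr1.
have va := var a ab; have vb := var b bb.
(* average over the nine joint moves: the two moves that close a unit gap are
   charged k1 and k2 times J, and l accounts for neighbours exchanging places *)
have sum9 (k1 k2 l : R) :
  4 * l * (up a * down b) <= J * ((1 - k1) * (up a * (1 - up b - down b)) + (1 - k2) * ((1 - up a - down a) * down b)) ->
  up a * (up b * (q 0 + J * 1) + down b * (q (-2) + J * 1 + 4 * l) + (1 - up b - down b) * (q (-1) + J * k1)) +
  down a * (up b * (q 2 + J * 1) + down b * (q 0 + J * 1) + (1 - up b - down b) * (q 1 + J * 1)) +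
  (1 - up a - down a) * (up b * (q 1 + J * 1) + down b * (q (-1) + J * k2) + (1 - up b - down b) * (q 0 + J * 1)) <=
  gap_cost s J a b + E * (hh * (drift b - drift a) / 2 - hh ^+ 2 * c0 / 4).
  move=> HJ; rewrite abE !driftE.
  have V : c0 <= (up a + down a) + (up b + down b) - 2 * (up a - down a) * (up b - down b).
    have := sqr_ge0 ((up a - down a) - (up b - down b)); nra.
  have HV : E * (hh ^+ 2 / 4) * c0 <= E * (hh ^+ 2 / 4) * ((up a + down a) + (up b + down b) - 2 * (up a - down a) * (up b - down b)).
    by rewrite ler_wpM2l // mulr_ge0 ?(ltW E0) // divr_ge0 // sqr_ge0.
  by rewrite /q; clear -HV HJ E0 hh0 ua0; lra.
case: gap => gap.
  have J' : 4 * 1 * (up a * down b) <= J * ((1 - 0) * (up a * (1 - up b - down b)) + (1 - 0) * ((1 - up a - down a) * down b)).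
    have ut := tp a true ab; have uf := tp b false bb.
    have ha : c0 <= 1 - up a - down a by have /andP[_] := rates a ab; lra.
    have hb : c0 <= 1 - up b - down b by have /andP[_] := rates b bb; lra.
    have ud : c0 <= up a + down b by rewrite /up_rate /down_rate; nra.
    apply: (@le_trans _ _ 4); first by nra.
    apply: (@le_trans _ _ (J * c0 ^+ 2)); first by rewrite -ler_pdivrMr ?exprn_gt0.
    rewrite ler_wpM2l //; nra.
  apply: le_trans (sum9 _ _ _ J').
  have qS a' b' eta : b' - a' = b - a + e * eta -> -2 <= eta <= 2 -> -1 <= eta ->
      gap_cost s J a' b' <= q eta + J * 1.
    move=> H1 H2 H3; apply: qP (H2) (H1) _ _; last exact: k01.
    by clear -H1 H3 e0 gap; nra.
  have qZ a' b' eta : b' - a' = b - a + e * eta -> eta = -1 ->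
      gap_cost s J a' b' <= q eta + J * 0.
    move=> H1 H2; have E3 : a' = b' by clear -H1 H2 gap; move: H1; rewrite H2; lra.
    by apply: qP => //; rewrite ?H2 ?E3 ?eqxx //; lra.
  apply: lstep_le => //; apply: lstep_le => //.
  - by apply: qS; [rewrite /e; ring|clear -gap e0 E0; lra|clear -gap e0 E0; lra].
  - apply: (@le_trans _ _ (1 + J)).
      by have /andP[] := gap_cost_bound (a + e) (b - e) s0 J0.
    by rewrite /q; clear -E0 E1 hh0 hh1; nra.
  - apply: qZ; [by rewrite /e; ring|by []].
  - by apply: qS; [rewrite /e; ring|clear -gap e0 E0; lra|clear -gap e0 E0; lra].
  - by apply: qS; [rewrite /e; ring|clear -gap e0 E0; lra|clear -gap e0 E0; lra].
  - by apply: qS; [rewrite /e; ring|clear -gap e0 E0; lra|clear -gap e0 E0; lra].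
  - by apply: qS; [rewrite /e; ring|clear -gap e0 E0; lra|clear -gap e0 E0; lra].
  - apply: qZ; [by rewrite /e; ring|by []].
  - by apply: qS; [rewrite /e; ring|clear -gap e0 E0; lra|clear -gap e0 E0; lra].
have qS a' b' eta : b' - a' = b - a + e * eta -> -2 <= eta <= 2 ->
    gap_cost s J a' b' <= q eta + J * 1.
  move=> H1 H2; apply: qP (H2) (H1) _ _; last exact: k01.
  by clear -H1 H2 e0 gap; nra.
apply: le_trans (sum9 1 1 0 _); last by rewrite mulr0 mul0r subrr !mul0r addr0 mulr0.
by rewrite mulr0 addr0; apply: lstep_le => //; apply: lstep_le => //; (apply: qS; [by rewrite /e; ring|clear -gap e0 E0; lra]).
Qed.

End LevelStep.

(** * Merging of the magnetizations *)

Section Lyapunov.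
Variables (R : realType) (p : nat) (beta h : R).
Local Notation drift := (drift p beta h).

Lemma mul_expRN_le1 (z : R) : 0 <= z -> z * expR (- z) <= 1.
Proof.
move=> z0; rewrite expRN ler_pdivrMr ?expR_gt0 // mul1r.
by apply: le_trans (expR_ge1Dx z); lra.
Qed.

(** Close to the equilibrium the concave potential gains at most the noise. *)
Lemma concave_drift_le (A c w : R) r : 0 < A -> 0 <= c -> 0 <= w ->
  (4 - 2 * c * w ^+ r) / (A + w) ^+ r <= 4 / A ^+ r.
Proof.
move=> A0 c0 w0; have D0 : 0 < (A + w) ^+ r by rewrite exprn_gt0 // ltr_pwDl.
apply: (@le_trans _ _ (4 / (A + w) ^+ r)).
  rewrite ler_pM2r ?invr_gt0 // gerBl mulr_ge0 ?exprn_ge0 // mulr_ge0 //.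
rewrite ler_pM2l // lef_pV2 ?posrE ?(exprn_gt0 _ A0) ?D0 //.
by apply: lerXn2r; rewrite ?nnegrE; lra.
Qed.

(** Away from the equilibrium the restoring force dominates and the concave
    potential decreases at a uniform rate. *)
Lemma concave_drift_far (A c w : R) r : 0 < A -> 0 <= c -> A <= w ->
  (4 - 2 * c * w ^+ r) / (A + w) ^+ r <= 4 / A ^+ r - 2 * (c / 2 ^+ r).
Proof.
move=> A0 c0 w0; have D0 : 0 < (A + w) ^+ r by rewrite exprn_gt0 //; lra.
rewrite mulrBl; apply: lerB.
  rewrite ler_pM2l // lef_pV2 ?posrE ?(exprn_gt0 _ A0) ?D0 //.
  by apply: lerXn2r; rewrite ?nnegrE; lra.
rewrite -!mulrA ler_pM2l // ler_wpM2l // ler_pdivlMr // mulrC ler_pdivrMr ?exprn_gt0 //.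
by rewrite -exprMn; apply: lerXn2r; rewrite ?nnegrE; lra.
Qed.

Section Constants.
Variables (r : nat) (m0 c c0 LF delta : R) (phi : R -> R).
Hypotheses (m0b : -1 <= m0 <= 1) (c_gt0 : 0 < c) (c0_gt0 : 0 < c0) (c0_le : c0 <= 2^-1).
Hypotheses (LF_ge0 : 0 <= LF) (delta_gt0 : 0 < delta) (r_gt0 : (0 < r)%N).
Hypothesis two_point_ge :
  forall m t, -1 <= m <= 1 -> c0 <= two_point (cond_mean p beta h m) t.
Hypothesis drift_restoring : forall m, -1 <= m <= 1 ->
  (m - m0) * drift m <= - c * (m - m0) ^+ (2 * r).
Hypothesis drift_lip : forall a b, -1 <= a <= 1 -> -1 <= b <= 1 -> a <= b ->
  drift b - drift a <= LF * (b - a).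
Hypothesis drift_decr : forall a b, -1 <= a <= 1 -> -1 <= b <= 1 ->
  `|a - m0| <= delta -> `|b - m0| <= delta -> a <= b -> drift b <= drift a.
Let A := 8 * 2 ^+ r / c + 1.
Hypothesis phi_tangent : forall w w', 0 <= w -> 0 <= w' ->
  phi w' <= phi w + (w' - w) / (A + w) ^+ r.
Hypothesis phi_ge0 : forall w, 0 <= w -> 0 <= phi w.
Hypothesis phi_mono : forall w w', 0 <= w -> w <= w' -> phi w <= phi w'.

Let A1 : 1 <= A.
Proof. by rewrite /A lerDr divr_ge0 ?mulr_ge0 ?exprn_ge0 // ltW. Qed.
Let A0 : 0 < A. Proof. exact: lt_le_trans A1. Qed.
Let kap1 := c / 2 ^+ r.
Let kap1_gt0 : 0 < kap1. Proof. by rewrite divr_gt0 ?exprn_gt0. Qed.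
Let AK : 8 / A ^+ r <= kap1.
Proof.
rewrite ler_pdivrMr ?exprn_gt0 //; apply: (@le_trans _ _ (kap1 * A)).
  rewrite /kap1 /A mulrDr mulr1.
  have -> : c / 2 ^+ r * (8 * 2 ^+ r / c) = 8.
    by field; rewrite lt0r_neq0 //= expf_neq0.
  by rewrite lerDl ltW.
rewrite ler_pM2l // -[leLHS]expr1; exact: ler_weXn2l.
Qed.
Let E0 := expR (- A).
Let J := 4 / c0 ^+ 2.
Let K := (8 + kap1) * 4 / (E0 * c0).
Let K_gt0 : 0 < K.
Proof. by rewrite divr_gt0 ?mulr_gt0 ?expR_gt0 // addr_gt0. Qed.
Let Lam := K * LF / (2 * c * delta ^+ (2 * r)).
Let Lam_ge0 : 0 <= Lam.
Proof.
have K0 := ltW K_gt0; have cge0 := ltW c_gt0; have dge0 := ltW delta_gt0.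
exact: divr_ge0 (mulr_ge0 K0 LF_ge0) (mulr_ge0 (mulr_ge0 (ler0n _ 2) cge0) (exprn_ge0 _ dge0)).
Qed.
Let S0t1 : 0 <= A ^+ 2 / delta ^+ 2. Proof. by rewrite divr_ge0 ?sqr_ge0. Qed.
Let S0t2 : 0 <= 16 * Lam / kap1.
Proof. exact: divr_ge0 (mulr_ge0 (ler0n _ 16) Lam_ge0) (ltW kap1_gt0). Qed.
Let S0 := 1 + A ^+ 2 / delta ^+ 2 + 16 * Lam / kap1.

Section FixN.
Variables (N : nat) (S : R).
Hypotheses (N_gt0 : (0 < N)%N) (S_ge : S0 <= S) (SN : S ^+ r = N%:R) (S_le : S <= N%:R ^+ 2).
Let Ngt0 : 0 < N%:R :> R. Proof. by rewrite ltr0n. Qed.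
Let S_parts : [/\ 1 <= S, A ^+ 2 <= S * delta ^+ 2 & 16 * Lam <= S * kap1].
Proof.
have t1 := S0t1; have t2 := S0t2; move: S_ge; rewrite /S0 => H; split; first lra.
  by rewrite -ler_pdivrMr ?exprn_gt0 //; lra.
by rewrite -ler_pdivrMr //; lra.
Qed.
Let S_gt0 : 0 < S. Proof. by case: S_parts; lra. Qed.
Let s := Num.sqrt S.
Let hh := s / N%:R.
Let s2 : s ^+ 2 = S. Proof. by rewrite sqr_sqrtr // ltW. Qed.
Let s_gt0 : 0 < s. Proof. by rewrite sqrtr_gt0. Qed.
Let s_le : s <= N%:R.
Proof. by rewrite -(@ler_pXn2r _ 2) ?nnegrE ?s2 ?(ltW s_gt0) ?(ltW Ngt0). Qed.
Let hh2 : hh ^+ 2 = S / N%:R ^+ 2. Proof. by rewrite expr_div_n s2. Qed.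

Let single (m : R) : R := phi (S * (m - m0) ^+ 2) + Lam * (m - m0) ^+ 2.
Let Psi (a b : R) : R := K * gap_cost s J a b + (single a + single b).

Let w_ (m : R) := S * (m - m0) ^+ 2.
Let w_ge0 m : 0 <= w_ m. Proof. by rewrite mulr_ge0 ?sqr_ge0 // ltW. Qed.
Let V (m : R) := (4 - 2 * c * w_ m ^+ r) / (A + w_ m) ^+ r.
Let quad (m : R) := 4 / N%:R ^+ 2 - 2 * c / N%:R * (m - m0) ^+ (2 * r).

Let lstep_single m : -1 <= m <= 1 ->
  lstep p beta h N single m <= single m + hh ^+ 2 * V m + Lam * quad m.
Proof.
move=> mb.
have -> : lstep p beta h N single m =
  lstep p beta h N (fun m' => phi (S * (m' - m0) ^+ 2)) m +
  Lam * lstep p beta h N (fun m' => (m' - m0) ^+ 2) m.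
  by rewrite /lstep /single; ring.
have H1 := lstep_concave N_gt0 A0 (ltW S_gt0) SN mb phi_tangent (drift_restoring mb).
have H2 := lstep_sqdist_le N_gt0 mb (drift_restoring mb).
have H3 : Lam * lstep p beta h N (fun m' => (m' - m0) ^+ 2) m <=
  Lam * ((m - m0) ^+ 2 + quad m).
  by rewrite ler_wpM2l //; apply: le_trans H2 _; rewrite /quad; lra.
apply: le_trans (lerD H1 H3) _.
by rewrite /single /V /w_ hh2; lra.
Qed.

Let w_zone m : w_ m <= A -> `|m - m0| <= delta.
Proof.
case: S_parts => S1 SA _ wA.
rewrite -(@ler_pXn2r _ 2) ?nnegrE ?(ltW delta_gt0) // real_normK ?num_real //.
rewrite -(ler_pM2l S_gt0); apply: le_trans SA; apply: le_trans wA _.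
by rewrite expr2 ler_peMr // ltW.
Qed.

Let w_abs m : w_ m <= A -> `|s * (m - m0)| <= A.
Proof.
move=> wA; rewrite -(@ler_pXn2r _ 2) ?nnegrE ?(ltW A0) // real_normK ?num_real //.
rewrite exprMn s2; apply: le_trans wA _.
by rewrite expr2 ler_peMr // ltW.
Qed.

Let quad_le m : quad m <= 4 / N%:R ^+ 2.
Proof.
rewrite /quad gerBl mulr_ge0 ?divr_ge0 ?mulr_ge0 ?(ltW c_gt0) ?(ltW Ngt0) //.
by rewrite exprM exprn_ge0 // sqr_ge0.
Qed.

Let quad_far m : delta < `|m - m0| ->
  quad m <= 4 / N%:R ^+ 2 - 2 * c * delta ^+ (2 * r) / N%:R.
Proof.
move=> far; rewrite /quad lerD2l lerN2 mulrAC ler_wpM2l ?divr_ge0 ?mulr_ge0 ?(ltW c_gt0) ?(ltW Ngt0) //.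
rewrite !exprM lerXn2r ?nnegrE ?sqr_ge0 // -(real_normK (num_real (m - m0))).
by rewrite lerXn2r ?nnegrE ?(ltW delta_gt0) // ltW.
Qed.

Let Psi_drift a b : -1 <= a <= 1 -> -1 <= b <= 1 -> a < b ->
  b - a = 2 / N%:R \/ 2 * (2 / N%:R) <= b - a ->
  lstep p beta h N (fun a' => lstep p beta h N (Psi a') b) a +
    kap1 / 2 * hh ^+ 2 <= Psi a b.
Proof.
move=> ab bb aLb gap.
have lin : lstep p beta h N (fun a' => lstep p beta h N (Psi a') b) a =
  K * lstep p beta h N (fun a' => lstep p beta h N (gap_cost s J a') b) a +
  (lstep p beta h N single a + lstep p beta h N single b).
  by rewrite /lstep /Psi; ring.
rewrite lin /Psi.
have H1 := lstep_gap_cost N_gt0 ab bb aLb gap (ltW s_gt0) s_le c0_gt0 c0_le (lexx J) two_point_ge.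
have H2 := lstep_single ab; have H3 := lstep_single bb.
move: H1; set G := lstep p beta h N (fun a' => _) a => H1.
set z := s / 2 * (b - a) in H1; set E := expR (- z) in H1.
have z0 : 0 <= z by rewrite mulr_ge0 ?divr_ge0 ?(ltW s_gt0) // subr_ge0 ltW.
have E_gt0 : 0 < E by exact: expR_gt0.
rewrite -/hh in H1.
have H1' := ler_wpM2l (ltW K_gt0) H1.
suff key : K * (E * (hh * (drift b - drift a) / 2 - hh ^+ 2 * c0 / 4)) +
   (hh ^+ 2 * V a + hh ^+ 2 * V b) + (Lam * quad a + Lam * quad b) +
   kap1 / 2 * hh ^+ 2 <= 0.
  by lra.
have Lq m : Lam * quad m <= Lam * (4 / N%:R ^+ 2) by rewrite ler_wpM2l.
have small : Lam * (4 / N%:R ^+ 2) + Lam * (4 / N%:R ^+ 2) <= kap1 / 2 * hh ^+ 2.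
  case: S_parts => _ _ S3.
  have -> : kap1 / 2 * hh ^+ 2 = (S * kap1) / (2 * N%:R ^+ 2).
    by rewrite hh2; field; apply: lt0r_neq0.
  have -> : Lam * (4 / N%:R ^+ 2) + Lam * (4 / N%:R ^+ 2) = (16 * Lam) / (2 * N%:R ^+ 2).
    by field; apply: lt0r_neq0.
  by rewrite ler_pM2r ?invr_gt0 // mulr_gt0 // exprn_gt0.
have h20 : 0 <= hh ^+ 2 by rewrite sqr_ge0.
have hhge0 : 0 <= hh by rewrite divr_ge0 // ltW.
have Ac : 0 <= 4 / A ^+ r <= 4.
  rewrite divr_ge0 ?exprn_ge0 ?(ltW A0) //= ler_pdivrMr ?exprn_gt0 //.
  by rewrite ler_peMr // exprn_ege1.
have Vle m : hh ^+ 2 * V m <= hh ^+ 2 * (4 / A ^+ r).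
  by rewrite ler_wpM2l // concave_drift_le ?(ltW c_gt0).
have AK' : 4 / A ^+ r + 4 / A ^+ r <= kap1 by apply: le_trans AK; lra.
have noise : 0 <= E * (hh ^+ 2 * c0 / 4).
  by rewrite mulr_ge0 ?(ltW E_gt0) // divr_ge0 // mulr_ge0 // ltW.
have zone_le : `|a - m0| <= delta -> `|b - m0| <= delta ->
    E * (hh * (drift b - drift a) / 2) <= 0.
  move=> za zb; have dd := drift_decr ab bb za zb (ltW aLb).
  rewrite mulr_ge0_le0 ?(ltW E_gt0) // pmulr_lle0 // mulr_ge0_le0 // subr_le0.
  exact: dd.
have VF m : A < w_ m -> hh ^+ 2 * V m <= hh ^+ 2 * (4 / A ^+ r - 2 * kap1).
  by move=> /ltW wA; rewrite ler_wpM2l // concave_drift_far ?(ltW c_gt0).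
have K8 : hh ^+ 2 * (4 / A ^+ r) + hh ^+ 2 * (4 / A ^+ r) <= hh ^+ 2 * kap1.
  by rewrite -mulrDr ler_wpM2l.
have Vfar : (A < w_ a) || (A < w_ b) -> hh ^+ 2 * V a + hh ^+ 2 * V b <= - (kap1 * hh ^+ 2).
  move/orP => [/VF Vm|/VF Vm]; first by have := Vle b; lra.
  by have := Vle a; lra.
have [/andP[wa wb]|] := boolP ((w_ a <= A) && (w_ b <= A)).
  have zE : z <= A.
    have := w_abs wa; have := w_abs wb; rewrite !ler_norml /z => /andP[_ ?] /andP[? _].
    lra.
  have EE : E0 <= E by rewrite ler_expR lerN2.
  have KE : (8 + kap1) * hh ^+ 2 <= K * (E * (hh ^+ 2 * c0 / 4)).
    have -> : (8 + kap1) * hh ^+ 2 = K * (E0 * (hh ^+ 2 * c0 / 4)).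
      by rewrite /K; field; rewrite !lt0r_neq0 ?expR_gt0.
    by rewrite ler_pM2l // ler_wpM2r // divr_ge0 // mulr_ge0 // ltW.
  have Z := zone_le (w_zone wa) (w_zone wb).
  have KZ : K * (E * (hh * (drift b - drift a) / 2)) <= 0.
    by rewrite mulr_ge0_le0 // ltW.
  have h4 : hh ^+ 2 * (4 / A ^+ r) <= hh ^+ 2 * 4 by rewrite ler_wpM2l //; case/andP: Ac.
  have := Lq a; have := Lq b; have := Vle a; have := Vle b.
  lra.
rewrite negb_and -!ltNge => /Vfar {}Vfar.
have [/andP[za zb]|] := boolP ((`|a - m0| <= delta) && (`|b - m0| <= delta)).
  have KZ : K * (E * (hh * (drift b - drift a) / 2)) <= 0.
    by rewrite mulr_ge0_le0 ?(ltW K_gt0) // zone_le.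
  have KN : 0 <= K * (E * (hh ^+ 2 * c0 / 4)) by rewrite mulr_ge0 // ltW.
  have := Lq a; have := Lq b; lra.
rewrite negb_and -!ltNge.
have KZ : K * (E * (hh * (drift b - drift a) / 2)) <= K * LF / N%:R.
  rewrite -(mulrA K LF) ler_pM2l //.
  apply: (@le_trans _ _ (E * (hh * (LF * (b - a)) / 2))).
    by rewrite ler_pM2l // ler_pM2r ?invr_gt0 // ler_wpM2l // drift_lip // ltW.
  have -> : E * (hh * (LF * (b - a)) / 2) = z * E * (LF / N%:R).
    by rewrite /z /hh; field; apply: lt0r_neq0.
  by rewrite ler_piMl ?mul_expRN_le1 // divr_ge0 // ltW.
have KN : 0 <= K * (E * (hh ^+ 2 * c0 / 4)) by rewrite mulr_ge0 // ltW.
have LamK : Lam * (2 * c * delta ^+ (2 * r) / N%:R) = K * LF / N%:R.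
  by rewrite /Lam; field; rewrite !lt0r_neq0 ?exprn_gt0.
have QF m : delta < `|m - m0| -> Lam * quad m <= Lam * (4 / N%:R ^+ 2) - K * LF / N%:R.
  by move=> /quad_far H; rewrite -LamK -mulrBr ler_wpM2l.
move/orP => [/QF Qm|/QF Qm]; first by have := Lq b; lra.
by have := Lq a; lra.
Qed.

Lemma level_mixing_fixed f rho n (x y : cube N) : 0 <= rho ->
  (forall t x y, `|iter t (@step R p beta h N) f x - iter t (@step R p beta h N) f y| <= 1) ->
  (forall t x y, mbar R x = mbar R y ->
     `|iter t (@step R p beta h N) f x - iter t (@step R p beta h N) f y| <= rho) ->
  kap1 / 2 * (S / N%:R ^+ 2) * n%:R *
    (`|iter n (@step R p beta h N) f x - iter n (@step R p beta h N) f y| - rho) <=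
  K * (1 + J) + 2 * phi (4 * S) + 8 * Lam.
Proof.
move=> rho0 osc1 oscr.
have J0 : 0 <= J by rewrite divr_ge0 // sqr_ge0.
have single_ge0 m : 0 <= single m.
  by apply: addr_ge0; [apply: phi_ge0; apply: w_ge0|apply: mulr_ge0; rewrite ?sqr_ge0].
have sq4 m : -1 <= m <= 1 -> (m - m0) ^+ 2 <= 4.
  have m0b' := m0b; move=> mb; have d1 : 0 <= 2 - (m - m0) by lra.
  have d2 : 0 <= 2 + (m - m0) by lra.
  by have := mulr_ge0 d1 d2; lra.
have single_le m : -1 <= m <= 1 -> single m <= phi (4 * S) + 4 * Lam.
  move=> mb; have mm := sq4 m mb; rewrite lerD //.
    by apply: phi_mono; [apply: w_ge0|rewrite mulrC ler_pM2r].
  by rewrite mulrC ler_wpM2r.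
rewrite -hh2.
apply: (@le_trans _ _ (Psi (mbar R x) (mbar R y))).
  apply: (@coupling_bound R p beta h N N_gt0 (fun x y => Psi (mbar R x) (mbar R y))) => //.
  - by rewrite mulr_ge0 ?sqr_ge0 // divr_ge0 // ltW.
  - move=> x' y'; apply: addr_ge0; last by apply: addr_ge0; apply: single_ge0.
    apply: mulr_ge0; first exact: ltW.
    by have /andP[] := gap_cost_bound (mbar R x') (mbar R y') (ltW s_gt0) J0.
  - by move=> x' y'; rewrite /Psi gap_cost_sym [single _ + _]addrC.
  move=> x' y' xy'.
  have E1 : step p beta h (fun u => step p beta h (fun v => Psi (mbar R u) (mbar R v)) y') x' =
     lstep p beta h N (fun a' => lstep p beta h N (Psi a') (mbar R y')) (mbar R x').
    rewrite -(step_mbar _ _ _ N_gt0); apply: eq_step => u.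
    by rewrite -(step_mbar _ _ _ N_gt0).
  rewrite E1; apply: Psi_drift; rewrite ?mbar_bound //.
  exact: mbar_gap.
have /andP[_ g1] := gap_cost_bound (mbar R x) (mbar R y) (ltW s_gt0) J0.
have := single_le _ (mbar_bound R N_gt0 x); have := single_le _ (mbar_bound R N_gt0 y).
have := ler_wpM2l (ltW K_gt0) g1; rewrite /Psi; lra.
Qed.
End FixN.

(** The Lyapunov function of the pair is the sum of three terms, measured in the
    time unit N^2 / S with S^r = N:
    - K times the gap cost, which decreases when both copies are within distance
      of order 1 / sqrt S of m0, because of the noise and of the monotone drift;
    - the concave potential phi of S (m - m0)^2 for each copy, which decreases when
      one of the copies is far from m0 at that scale;
    - Lam times (m - m0)^2 for each copy, which decreases at rate 1 / N at
      macroscopic distance from m0, where the drifts may separate the copies.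
    The constant A makes the gain of phi far away beat the loss near m0, then K is
    chosen against this loss, and Lam against K. *)
Lemma level_mixing : exists C1 S1 : R, [/\ 0 < C1, 1 <= S1 &
  forall N S f rho n (x y : cube N), (0 < N)%N -> S1 <= S -> S ^+ r = N%:R -> S <= N%:R ^+ 2 ->
  0 <= rho ->
  (forall t x y, `|iter t (@step R p beta h N) f x - iter t (@step R p beta h N) f y| <= 1) ->
  (forall t x y, mbar R x = mbar R y ->
     `|iter t (@step R p beta h N) f x - iter t (@step R p beta h N) f y| <= rho) ->
  S / N%:R ^+ 2 * n%:R *
    (`|iter n (@step R p beta h N) f x - iter n (@step R p beta h N) f y| - rho) <=
  C1 * (1 + phi (4 * S))].
Proof.
have J0 : 0 <= J by rewrite divr_ge0 // sqr_ge0.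
have KJ : 0 <= K * (1 + J) by rewrite mulr_ge0 ?(ltW K_gt0) // addr_ge0.
exists (2 / kap1 * (K * (1 + J) + 2 + 8 * Lam)), S0; split.
- by have L0 := Lam_ge0; rewrite mulr_gt0 ?divr_gt0 //; lra.
- by have t1 := S0t1; have t2 := S0t2; rewrite /S0; lra.
move=> N S f rho n x y N0 S1 SN S2 rho0 o1 o2.
have := level_mixing_fixed N0 S1 SN S2 n x y rho0 o1 o2.
have S_gt0 : 0 < S.
  by apply: lt_le_trans S1; have t1 := S0t1; have t2 := S0t2; rewrite /S0; lra.
have p0 : 0 <= phi (4 * S) by rewrite phi_ge0 // mulr_ge0 // ltW.
set u := _ - rho; set T := S / _; move=> H.
have -> : T * n%:R * u = 2 / kap1 * (kap1 / 2 * T * n%:R * u) by field; apply: lt0r_neq0.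
rewrite -[leRHS]mulrA ler_pM2l ?divr_gt0 //; apply: le_trans H _.
by have L0 := Lam_ge0; have := mulr_ge0 KJ p0; have := mulr_ge0 L0 p0; lra.
Qed.
End Constants.
End Lyapunov.

(** * The reversible measure *)

Section Powers.
Variable R : realType.
Implicit Types a b : R.

Lemma powers_lipschitz n a b : `|a| <= 1 -> `|b| <= 1 ->
  `|b ^+ n - a ^+ n| <= n%:R * `|b - a|.
Proof.
move=> a1 b1; rewrite subrXX normrM mulrC ler_wpM2r //.
apply: le_trans (ler_norm_sum _ _ _) _.
apply: (@le_trans _ _ (\sum_(i < n) 1)); last by rewrite sumr_const card_ord.
apply: ler_sum => i _; rewrite normrM !normrX mulr_ile1 ?exprn_ge0 ?normr_ge0 //.
  by rewrite exprn_ile1.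
by rewrite exprn_ile1.
Qed.

(** The error of the trapezoidal rule for x^(n+1): by the factorization of
    b^(n+1) - a^(n+1) it is a sum of products of two differences of powers. *)
Lemma trapezoid_power n a b : `|a| <= 1 -> `|b| <= 1 ->
  `|2 * (b ^+ n.+1 - a ^+ n.+1) - n.+1%:R * (b - a) * (a ^+ n + b ^+ n)|
    <= n.+1%:R ^+ 3 * `|b - a| ^+ 3.
Proof.
move=> a1 b1.
have -> : 2 * (b ^+ n.+1 - a ^+ n.+1) - n.+1%:R * (b - a) * (a ^+ n + b ^+ n) =
  - (b - a) * \sum_(i < n.+1) (b ^+ (n - i) - a ^+ (n - i)) * (b ^+ i - a ^+ i).
  have E1 : b ^+ n.+1 - a ^+ n.+1 = (b - a) * \sum_(i < n.+1) b ^+ (n - i) * a ^+ i.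
    by rewrite subrXX.
  have E2 : b ^+ n.+1 - a ^+ n.+1 = (b - a) * \sum_(i < n.+1) b ^+ i * a ^+ (n - i).
    rewrite -[LHS]opprB subrXX -mulNr opprB; congr (_ * _).
    by apply: eq_bigr => i _; rewrite mulrC.
  have E3 : n.+1%:R * (b - a) * (a ^+ n + b ^+ n) =
     (b - a) * \sum_(i < n.+1) (a ^+ n + b ^+ n).
    by rewrite sumr_const card_ord -(mulr_natl _ n.+1); ring.
  have -> (x : R) : 2 * x = x + x by ring.
  rewrite {1}E1 E2 E3 -mulrDr -big_split /= -mulrBr -sumrB mulNr -mulrN -sumrN.
  congr (_ * _); apply: eq_bigr => i _.
  have ni : (n = (n - i) + i)%N by rewrite subnK // -ltnS.
  have aE : a ^+ n = a ^+ (n - i) * a ^+ i by rewrite -exprD -ni.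
  have bE : b ^+ n = b ^+ (n - i) * b ^+ i by rewrite -exprD -ni.
  by rewrite aE bE; ring.
rewrite normrM normrN.
have -> : n.+1%:R ^+ 3 * `|b - a| ^+ 3 =
  `|b - a| * \sum_(i < n.+1) (n.+1%:R * `|b - a|) * (n.+1%:R * `|b - a|).
  by rewrite sumr_const card_ord -(mulr_natl _ n.+1); ring.
rewrite ler_wpM2l //; apply: le_trans (ler_norm_sum _ _ _) _.
apply: ler_sum => i _; rewrite normrM.
have pw k : (k <= n.+1)%N -> `|b ^+ k - a ^+ k| <= n.+1%:R * `|b - a|.
  move=> kn; apply: le_trans (powers_lipschitz k a1 b1) _.
  by rewrite ler_wpM2r // ler_nat.
rewrite ler_pM ?pw //; first by rewrite (leq_trans (leq_subr _ _)).
exact: ltnW.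
Qed.

Lemma expR_lipschitz (M u v : R) : u <= M -> v <= M ->
  `|expR u - expR v| <= expR M * `|u - v|.
Proof.
wlog uv : u v / u <= v => [W|].
  have [uv|/ltW uv] := leP u v; first exact: W.
  by move=> ? ?; rewrite distrC [`|u - v|]distrC; apply: W.
move=> uM vM; rewrite distrC [`|u - v|]distrC !ger0_norm ?subr_ge0 ?ler_expR //.
have -> : expR u = expR v * expR (u - v) by rewrite -expRD; congr expR; ring.
have := expR_ge1Dx (u - v); have : expR v <= expR M by rewrite ler_expR.
have := expR_gt0 v; nra.
Qed.

(** A weak form of Jensen's inequality: smallness of the 2r-th moment gives
    smallness of the first absolute moment. *)
Lemma norm_le_power (eta x : R) r : 0 < eta -> (0 < r)%N ->
  `|x| <= eta + x ^+ (2 * r) / eta ^+ (2 * r).-1.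
Proof.
move=> e0; case: r => // r _; rewrite mulnS /=.
have D0 : 0 < eta ^+ (2 * r).+1 by rewrite exprn_gt0.
have -> : x ^+ (2 * r).+2 = `|x| * `|x| ^+ (2 * r).+1.
  rewrite -exprS -addn2 exprD !exprM [in RHS]exprD exprM real_normK ?num_real //.
have [xe|ex] := leP `|x| eta.
  by rewrite ler_wpDr // divr_ge0 ?(ltW D0) // mulr_ge0 // exprn_ge0.
rewrite ler_wpDl ?(ltW e0) // -mulrA ler_peMr // ler_pdivlMr // mul1r.
by rewrite lerXn2r ?nnegrE ?(ltW e0) ?(ltW ex).
Qed.
End Powers.

Section Stationary.
Variables (R : realType) (p : nat) (beta h : R).
Hypotheses (p_gt0 : (0 < p)%N) (beta_ge0 : 0 <= beta).
Local Notation field_at := (field_at p beta h).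

Let M := p%:R * beta + `|h|.
Let M_ge0 : 0 <= M. Proof. by rewrite addr_ge0 ?mulr_ge0. Qed.

Lemma field_bound m : -1 <= m <= 1 -> `|field_at m| <= M.
Proof.
move=> mb; have m1 : `|m| <= 1 by rewrite ler_norml.
apply: le_trans (ler_normD _ _) _; rewrite lerD2r !normrM normrX.
rewrite (ger0_norm beta_ge0) normr_nat ler_piMr ?mulr_ge0 //.
by rewrite exprn_ile1.
Qed.

Lemma field_lipschitz a b : -1 <= a <= 1 -> -1 <= b <= 1 ->
  `|field_at b - field_at a| <= p%:R ^+ 2 * beta * `|b - a|.
Proof.
move=> ab bb; have a1 : `|a| <= 1 by rewrite ler_norml.
have b1 : `|b| <= 1 by rewrite ler_norml.
have -> : field_at b - field_at a = p%:R * beta * (b ^+ p.-1 - a ^+ p.-1).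
  by rewrite /field_at; ring.
rewrite normrM ger0_norm ?mulr_ge0 //.
have -> : p%:R ^+ 2 * beta * `|b - a| = p%:R * beta * (p%:R * `|b - a|) by ring.
rewrite ler_wpM2l ?mulr_ge0 //; apply: le_trans (powers_lipschitz _ a1 b1) _.
by rewrite ler_wpM2r // ler_nat leq_pred.
Qed.

Definition partition_at (m : R) : R := expR (field_at m) + expR (- field_at m).

Lemma partition_bounds m : -1 <= m <= 1 -> 1 <= partition_at m <= 2 * expR M.
Proof.
move=> /field_bound; rewrite ler_norml => /andP[f1 f2]; rewrite /partition_at.
have e1 : expR (field_at m) <= expR M by rewrite ler_expR.
have e2 : expR (- field_at m) <= expR M by rewrite ler_expR; lra.
have := expR_gt0 (field_at m); have := expR_gt0 (- field_at m).
have := expR_ge1Dx (field_at m); have := expR_ge1Dx (- field_at m); lra.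
Qed.

Lemma two_point_lower m b : -1 <= m <= 1 ->
  (2 * expR M)^-1 * expR (- M) <= two_point (cond_mean p beta h m) b.
Proof.
move=> mb; rewrite /cond_mean two_point_tanh.
have /andP[d1 d2] := partition_bounds mb.
have := field_bound mb; rewrite ler_norml => /andP[f1 f2].
rewrite mulrC ler_pM ?expR_ge0 ?invr_ge0 ?mulr_ge0 ?expR_ge0 //.
  by rewrite ler_expR /spin; case: b; lra.
rewrite lef_pV2 ?posrE //; last exact: lt_le_trans d1.
by rewrite mulr_gt0 ?expR_gt0.
Qed.

Definition level_field N k : R := field_at ((2 * k%:R - N%:R) / N%:R).

(** Weight of the reversible measure of the dynamics. It differs from the Gibbs
    weight by the hyperbolic cosine of the field and by replacing an integral of
    the field by its trapezoidal sum. *)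
Definition stat_weight N (x : cube N) : R :=
  partition_at (mbar R x) *
  expR (\sum_(j < level x) (level_field N j + level_field N j.+1)).

Section FixN.
Variable N : nat.
Hypothesis N_gt0 : (0 < N)%N.
Implicit Types (x y : cube N) (f : cube N -> R).
Let Ngt0 : 0 < N%:R :> R. Proof. by rewrite ltr0n. Qed.
Local Notation step := (step p beta h (N := N)).

Lemma stat_weight_gt0 x : 0 < stat_weight x.
Proof. by rewrite mulr_gt0 ?expR_gt0 // addr_gt0 ?expR_gt0. Qed.

Definition flip (i : 'I_N) x : cube N := set_spin x i (~~ x i).

Lemma flipK i : involutive (flip i).
Proof.
move=> x; apply/ffunP => j; rewrite !ffunE eqxx negbK.
by case: eqP => // ->.
Qed.

Lemma level_set_true i x : x i = false -> level (set_spin x i true) = (level x).+1.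
Proof.
move=> xi; rewrite /level (bigD1 i) //= [in RHS](bigD1 i) //= xi ffunE eqxx add1n add0n.
by congr S; apply: eq_bigr => j /negPf nj; rewrite ffunE nj.
Qed.

Lemma field_mbar x : field_at (mbar R x) = level_field N (level x).
Proof. by rewrite mbar_level. Qed.

Let rate i x := stat_weight x * two_point (cond_mean p beta h (mbar R x)) (~~ x i).

(** Flipping a minus spin adds one term to the sum of fields, and this term is
    exactly the sum of the fields before and after the flip. *)
Lemma detailed_balance i x : rate i (flip i x) = rate i x.
Proof.
wlog xi : x / x i = false => [W|].
  have [xi|/negbTE] := boolP (x i); last exact: W.
  have fi : flip i x i = false by rewrite /flip ffunE eqxx xi.
  by have := W _ fi; rewrite flipK.
rewrite /rate /flip ffunE eqxx negbK xi /= /stat_weight /cond_mean !two_point_tanh.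
have pne z : partition_at z != 0 by rewrite lt0r_neq0 // tanh_den_gt0.
have E z (S t : R) : partition_at z * expR S * (expR t / (expR (field_at z) + expR (- field_at z))) = expR (S + t).
  by rewrite expRD -/(partition_at z); field.
rewrite !E !field_mbar level_set_true // big_ord_recr /= /spin; congr expR.
by ring.
Qed.

Lemma stationary_step f :
  \sum_x stat_weight x * step f x = \sum_x stat_weight x * f x.
Proof.
have gen x : step f x - f x = N%:R^-1 * \sum_i
    two_point (cond_mean p beta h (mbar R x)) (~~ x i) * (f (flip i x) - f x).
  have fE : f x = N%:R^-1 * \sum_(i < N) f x.
    by rewrite sumr_const card_ord -(mulr_natl (f x)) mulrA mulVf ?mul1r // lt0r_neq0.
  transitivity (N%:R^-1 * \sum_i (\sum_(b : bool)
    two_point (cond_mean p beta h (mbar R x)) b * f (set_spin x i b) - f x)).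
    by rewrite stepE sumrB mulrBr -fE.
  congr (_ * _); apply: eq_bigr => i _; rewrite big_bool /= /flip.
  have q1 := sum_two_point (cond_mean p beta h (mbar R x)); rewrite big_bool /= in q1.
  have xE : set_spin x i (x i) = x by apply/ffunP => j; rewrite ffunE; case: eqP => // ->.
  move: q1 xE; case: (x i) => /= q1 ->; rewrite -[X in _ - X = _]mul1r -q1; ring.
apply/eqP; rewrite -subr_eq0 -sumrB; apply/eqP.
under eq_bigr do rewrite -mulrBr gen mulrCA mulr_sumr.
rewrite -mulr_sumr exchange_big /= big1 ?mulr0 // => i _.
under eq_bigr do rewrite mulrA -/(rate i _) mulrBr.
rewrite sumrB (reindex_inj (inv_inj (flipK i))) /=.
under eq_bigr do rewrite flipK detailed_balance.
by rewrite subrr.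
Qed.
End FixN.
End Stationary.

(** * Comparison with the Gibbs measure *)

Section GibbsClose.
Variables (R : realType) (p : nat) (beta h : R).
Hypotheses (p_gt0 : (0 < p)%N) (beta_ge0 : 0 <= beta).
Local Notation field_at := (field_at p beta h).
Local Notation partition_at := (partition_at p beta h).
Let M := p%:R * beta + `|h|.

Definition potential (m : R) : R := beta * m ^+ p + h * m.

(** The magnetization moves by 2 / N, so one step of the trapezoidal rule commits an
    error of order N^-3, multiplied by N in the exponent. *)
Lemma trapezoid_field N k : (k < N)%N ->
  `|N%:R * (potential ((2 * k.+1%:R - N%:R) / N%:R) - potential ((2 * k%:R - N%:R) / N%:R))
    - (level_field p beta h N k + level_field p beta h N k.+1)|
  <= 4 * beta * p%:R ^+ 3 / N%:R ^+ 2.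
Proof.
move=> kN; have N0 : 0 < N%:R :> R by rewrite ltr0n; case: N kN.
rewrite /level_field; set a := (2 * k%:R - N%:R) / N%:R.
set b := (2 * k.+1%:R - N%:R) / N%:R.
have ba : b - a = 2 / N%:R.
  by rewrite /a /b -natr1; field; apply: lt0r_neq0.
have kN1 : k.+1%:R <= N%:R :> R by rewrite ler_nat.
have b1 : `|b| <= 1.
  by rewrite ler_norml /b ler_pdivlMr // ler_pdivrMr // -natr1; move: kN1; rewrite -natr1 => kN1; have := ler0n R k; lra.
have a1 : `|a| <= 1.
  by rewrite ler_norml /a ler_pdivlMr // ler_pdivrMr //; move: kN1; rewrite -natr1 => kN1; have := ler0n R k; lra.
have := trapezoid_power p.-1 a1 b1; rewrite prednK // => T.
have -> : N%:R * (potential b - potential a) - (field_at a + field_at b) =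
  beta * N%:R / 2 * (2 * (b ^+ p - a ^+ p) - p%:R * (b - a) * (a ^+ p.-1 + b ^+ p.-1)).
  have hE : h * (b - a) * N%:R = 2 * h by rewrite ba; field; apply: lt0r_neq0.
  have gE : p%:R * (b - a) * (a ^+ p.-1 + b ^+ p.-1) = 2 / N%:R * (p%:R * (a ^+ p.-1 + b ^+ p.-1)).
    by rewrite ba; ring.
  rewrite gE /potential /field_at.
  transitivity (N%:R * beta * (b ^+ p - a ^+ p) + h * (b - a) * N%:R
     - (p%:R * beta * (a ^+ p.-1 + b ^+ p.-1) + 2 * h)); first by ring.
  by rewrite hE; field; apply: lt0r_neq0.
rewrite normrM ger0_norm; last by rewrite divr_ge0 // mulr_ge0 // ltW.
have -> : 4 * beta * p%:R ^+ 3 / N%:R ^+ 2 = beta * N%:R / 2 * (p%:R ^+ 3 * (2 / N%:R) ^+ 3).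
  by field; apply: lt0r_neq0.
rewrite ler_wpM2l //; first by rewrite divr_ge0 // mulr_ge0 // ltW.
by apply: le_trans T _; rewrite ba ger0_norm // divr_ge0 // ltW.
Qed.

Section FixN.
Variable N : nat.
Hypothesis N_gt0 : (0 < N)%N.
Implicit Types (x y : cube N) (f : cube N -> R).
Let Ngt0 : 0 < N%:R :> R. Proof. by rewrite ltr0n. Qed.
Local Notation wt := (stat_weight p beta h (N := N)).
Local Notation gw := (gibbs_weight p beta h (N := N)).

Lemma level_le x : (level x <= N)%N.
Proof.
rewrite -[X in (_ <= X)%N]card_ord -sum1_card; apply: leq_sum => i _; exact: leq_b1.
Qed.

Definition density_err x : R := N%:R * (potential (mbar R x) - potential (-1))
   - \sum_(j < level x) (level_field p beta h N j + level_field p beta h N j.+1).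

(** The Gibbs measure relative to the reversible one, up to a constant: within
    O(1 / N) it is a smooth function of the magnetization. *)
Definition density x : R := expR (density_err x) / partition_at (mbar R x).

Lemma gibbs_weightE x : gw x = expR (N%:R * potential (-1)) * (wt x * density x).
Proof.
rewrite /density /stat_weight; set S := \sum_(j < _) _.
have d0 : partition_at (mbar R x) != 0 by rewrite lt0r_neq0 // tanh_den_gt0.
have -> : partition_at (mbar R x) * expR S * (expR (density_err x) / partition_at (mbar R x)) =
  expR (S + density_err x) by rewrite (expRD S); field.
rewrite -expRD /gibbs_weight; congr expR; rewrite /density_err -/S /potential; ring.
Qed.

Lemma density_err_le x : `|density_err x| <= 4 * beta * p%:R ^+ 3 / N%:R.
Proof.
have lx := level_le x.
pose mk k : R := (2 * k%:R - N%:R) / N%:R.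
have tele k : N%:R * (potential (mk k) - potential (-1)) =
   \sum_(j < k) N%:R * (potential (mk j.+1) - potential (mk j)).
  elim: k => [|k IH].
    by rewrite big_ord0 /mk mulr0 sub0r mulNr divff ?lt0r_neq0 // subrr mulr0.
  by rewrite big_ord_recr /= -IH; ring.
rewrite /density_err mbar_level // -/(mk _) tele -sumrB.
apply: le_trans (ler_norm_sum _ _ _) _.
apply: (@le_trans _ _ (\sum_(j < level x) 4 * beta * p%:R ^+ 3 / N%:R ^+ 2)).
  by apply: ler_sum => j _; apply: trapezoid_field; apply: leq_trans lx.
rewrite sumr_const card_ord -(mulr_natl _ (level x)).
have -> : 4 * beta * p%:R ^+ 3 / N%:R = N%:R * (4 * beta * p%:R ^+ 3 / N%:R ^+ 2).
  by field; apply: lt0r_neq0.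
rewrite ler_wpM2r ?ler_nat // divr_ge0 ?exprn_ge0 ?mulr_ge0 ?exprn_ge0 //.
Qed.

Let D := 4 * beta * p%:R ^+ 3.
Let D_ge0 : 0 <= D. Proof. by rewrite mulr_ge0 ?exprn_ge0 ?mulr_ge0. Qed.

Lemma density_err_le_cst x : `|density_err x| <= D.
Proof.
apply: le_trans (density_err_le x) _; rewrite -/D ler_pdivrMr // ler_peMr //.
by rewrite ler1n.
Qed.

Lemma density_bounds x :
  expR (- D) / (2 * expR M) <= density x <= expR D.
Proof.
have := density_err_le_cst x; rewrite ler_norml => /andP[e1 e2].
have /andP[d1 d2] := partition_bounds p h beta_ge0 (mbar_bound R N_gt0 x).
have d0 : 0 < partition_at (mbar R x) by exact: lt_le_trans d1.
apply/andP; split; rewrite /density.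
  rewrite ler_pM ?expR_ge0 ?invr_ge0 ?mulr_ge0 ?expR_ge0 ?ler_expR //.
  by rewrite lef_pV2 ?posrE // mulr_gt0 ?expR_gt0.
rewrite ler_pdivrMr //; apply: (@le_trans _ _ (expR D)); first by rewrite ler_expR.
by rewrite ler_peMr ?expR_ge0.
Qed.

Lemma density_close m0 x : -1 <= m0 <= 1 ->
  `|density x - (partition_at m0)^-1| <=
  expR D * D / N%:R + 2 * expR M * (p%:R ^+ 2 * beta) * `|mbar R x - m0|.
Proof.
move=> m0b; have mb := mbar_bound R N_gt0 x; set m := mbar R x in mb *.
have /andP[d1 _] := partition_bounds p h beta_ge0 mb.
have /andP[e1 _] := partition_bounds p h beta_ge0 m0b.
have d0 : 0 < partition_at m by exact: lt_le_trans d1.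
have e0 : 0 < partition_at m0 by exact: lt_le_trans e1.
have -> : density x - (partition_at m0)^-1 =
  (expR (density_err x) - expR 0) / partition_at m +
  (partition_at m0 - partition_at m) / (partition_at m * partition_at m0).
  by rewrite /density -/m expR0; field; rewrite !lt0r_neq0.
apply: le_trans (ler_normD _ _) _; apply: lerD.
  rewrite normrM [X in _ * X]gtr0_norm ?invr_gt0 // ler_pdivrMr //.
  apply: (@le_trans _ _ (expR D * D / N%:R)); last first.
    by rewrite ler_peMr // divr_ge0 // mulr_ge0 ?expR_ge0.
  have := density_err_le_cst x; rewrite ler_norml => /andP[_ e2].
  apply: le_trans (expR_lipschitz e2 D_ge0) _.
  by rewrite subr0 -mulrA ler_wpM2l ?expR_ge0 // density_err_le.
rewrite normrM [X in _ * X]gtr0_norm ?invr_gt0 ?mulr_gt0 // ler_pdivrMr ?mulr_gt0 //.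
apply: (@le_trans _ _ (2 * expR M * (p%:R ^+ 2 * beta) * `|m - m0|)); last first.
  rewrite ler_peMr //; last by nra.
  by rewrite mulr_ge0 // mulr_ge0 // mulr_ge0 ?expR_ge0 ?exprn_ge0.
have F1 := field_bound p h beta_ge0 mb; have F2 := field_bound p h beta_ge0 m0b.
rewrite ler_norml -/M in F1; rewrite ler_norml -/M in F2.
case/andP: F1 => f1 f2; case/andP: F2 => g1 g2.
rewrite /partition_at.
have -> : expR (field_at m0) + expR (- field_at m0) - (expR (field_at m) + expR (- field_at m)) =
  (expR (field_at m0) - expR (field_at m)) + (expR (- field_at m0) - expR (- field_at m)) by ring.
apply: le_trans (ler_normD _ _) _.
have L := field_lipschitz p h beta_ge0 m0b mb.
have H1 := expR_lipschitz g2 f2.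
have H2 : `|expR (- field_at m0) - expR (- field_at m)| <= expR M * `|- field_at m0 - - field_at m|.
  by apply: expR_lipschitz; lra.
have E1 : `|field_at m0 - field_at m| = `|field_at m - field_at m0| by rewrite distrC.
have E2 : `|- field_at m0 - - field_at m| = `|field_at m - field_at m0|.
  by congr (`| _ |); ring.
rewrite E1 in H1; rewrite E2 in H2.
have := ler_wpM2l (expR_ge0 M) L; lra.
Qed.

(** Stationarity makes the expected change of (m - m0)^2 vanish, so the mean of the
    restoring term, of order 1 / N times (m - m0)^(2r), equals the mean of the noise,
    of order 1 / N^2. *)
Lemma stat_concentration m0 c r : 0 < c ->
  (forall m, -1 <= m <= 1 -> (m - m0) * drift p beta h m <= - c * (m - m0) ^+ (2 * r)) ->
  \sum_x wt x * (mbar R x - m0) ^+ (2 * r) <= 2 / (c * N%:R) * \sum_x wt x.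
Proof.
move=> c0 restoring.
have E := stationary_step p beta h N_gt0 (fun x => (mbar R x - m0) ^+ 2).
have H : \sum_x wt x * step p beta h (fun y => (mbar R y - m0) ^+ 2) x <=
   \sum_x wt x * ((mbar R x - m0) ^+ 2 - 2 * c / N%:R * (mbar R x - m0) ^+ (2 * r) + 4 / N%:R ^+ 2).
  apply: ler_sum => x _; rewrite ler_pM2l ?stat_weight_gt0 //.
  rewrite (step_mbar _ _ _ N_gt0 (fun m => (m - m0) ^+ 2)).
  by apply: lstep_sqdist_le; rewrite ?mbar_bound ?restoring ?mbar_bound.
rewrite {}E in H; move: H.
have -> : \sum_x wt x * ((mbar R x - m0) ^+ 2 - 2 * c / N%:R * (mbar R x - m0) ^+ (2 * r) + 4 / N%:R ^+ 2) =
  \sum_x wt x * (mbar R x - m0) ^+ 2 - 2 * c / N%:R * (\sum_x wt x * (mbar R x - m0) ^+ (2 * r))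
  + 4 / N%:R ^+ 2 * \sum_x wt x.
  by rewrite !mulr_sumr -sumrB -big_split /=; apply: eq_bigr => x _; ring.
set S := \sum_x wt x * _ ^+ (2 * r); set W := \sum_x wt x.
move=> H; have H1 : 2 * c / N%:R * S <= 4 / N%:R ^+ 2 * W by lra.
have P : 0 < 2 * c / N%:R by rewrite divr_gt0 ?mulr_gt0.
rewrite -(ler_pM2l P); apply: le_trans H1 _.
by rewrite le_eqVlt; apply/orP; left; apply/eqP; field; rewrite !lt0r_neq0.
Qed.

Let W := \sum_x wt x.
Let W_gt0 : 0 < W.
Proof.
rewrite /W (bigD1 [ffun=> true]) //= ltr_wpDr ?stat_weight_gt0 //.
by apply: sumr_ge0 => x _; rewrite ltW ?stat_weight_gt0.
Qed.

(** The reversible measure, normalized. *)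
Definition stat x : R := wt x / W.

Lemma stat_gt0 x : 0 < stat x.
Proof. by rewrite divr_gt0 ?stat_weight_gt0. Qed.

Lemma sum_stat : \sum_x stat x = 1.
Proof. by rewrite -mulr_suml divff // lt0r_neq0. Qed.

Lemma stat_step f : \sum_x stat x * step p beta h f x = \sum_x stat x * f x.
Proof.
have E g : \sum_x stat x * g x = W^-1 * \sum_x wt x * g x.
  by rewrite mulr_sumr; apply: eq_bigr => x _; rewrite /stat; ring.
by rewrite !E stationary_step.
Qed.

Let Z := \sum_x wt x * density x.
Let vmin := expR (- D) / (2 * expR M).
Let vmin_gt0 : 0 < vmin.
Proof. by rewrite divr_gt0 ?mulr_gt0 ?expR_gt0. Qed.
Let Z_ge : vmin * W <= Z.
Proof.
rewrite mulr_sumr; apply: ler_sum => x _; rewrite mulrC ler_pM2l ?stat_weight_gt0 //.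
by have /andP[] := density_bounds x.
Qed.
Let Z_gt0 : 0 < Z. Proof. by apply: lt_le_trans Z_ge; rewrite mulr_gt0. Qed.

Lemma gibbsE x : gibbs p beta h x = wt x * density x / Z.
Proof.
rewrite /gibbs; under eq_bigr do rewrite gibbs_weightE.
rewrite -mulr_sumr gibbs_weightE -/Z; field.
by rewrite lt0r_neq0 ?lt0r_neq0 ?expR_gt0.
Qed.

Lemma gibbs_gt0 x : 0 < gibbs p beta h x.
Proof.
rewrite gibbsE divr_gt0 // mulr_gt0 ?stat_weight_gt0 //.
by apply: lt_le_trans vmin_gt0 _; have /andP[] := density_bounds x.
Qed.

Lemma sum_gibbs : \sum_(x : cube N) gibbs p beta h x = 1 :> R.
Proof.
under eq_bigr do rewrite gibbsE.
by rewrite -mulr_suml divff // lt0r_neq0.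
Qed.

Lemma gibbs_concentration m0 c r : 0 < c ->
  (forall m, -1 <= m <= 1 -> (m - m0) * drift p beta h m <= - c * (m - m0) ^+ (2 * r)) ->
  \sum_(x : cube N) gibbs p beta h x * (mbar R x - m0) ^+ (2 * r) <=
  expR D / (expR (- D) / (2 * expR M)) * (2 / c) / N%:R.
Proof.
move=> c0 restoring; have C := stat_concentration c0 restoring.
have ev x : 0 <= (mbar R x - m0) ^+ (2 * r) by rewrite exprM exprn_ge0 // sqr_ge0.
apply: (@le_trans _ _ (expR D / Z * \sum_x wt x * (mbar R x - m0) ^+ (2 * r))).
  rewrite mulr_sumr; apply: ler_sum => x _; rewrite gibbsE.
  have -> : wt x * density x / Z * (mbar R x - m0) ^+ (2 * r) =
    density x * (wt x * (mbar R x - m0) ^+ (2 * r) / Z) by ring.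
  have -> : expR D / Z * (wt x * (mbar R x - m0) ^+ (2 * r)) =
    expR D * (wt x * (mbar R x - m0) ^+ (2 * r) / Z) by ring.
  apply: ler_wpM2r; last by have /andP[] := density_bounds x.
  apply: divr_ge0 (ltW Z_gt0); apply: mulr_ge0 => //.
  by rewrite ltW ?stat_weight_gt0.
apply: le_trans (ler_wpM2l _ C) _; first by rewrite divr_ge0 ?expR_ge0 // ltW.
rewrite -/W -/vmin.
have -> : expR D / Z * (2 / (c * N%:R) * W) = expR D * (2 / c) / N%:R * (W / Z).
  by field; rewrite !lt0r_neq0.
have -> : expR D / vmin * (2 / c) / N%:R = expR D * (2 / c) / N%:R * vmin^-1.
  by field; rewrite !lt0r_neq0.
apply: ler_wpM2l; last by rewrite ler_pdivrMr // mulrC ler_pdivlMr // mulrC.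
by rewrite !(mulr_ge0, invr_ge0) ?expR_ge0 // ltW.
Qed.

(** The density of the Gibbs measure is nearly constant near m0, where the
    reversible measure concentrates; hence the two measures are close in total
    variation although they differ. *)
Lemma stat_gibbs m0 c r eta (A : {set cube N}) : -1 <= m0 <= 1 -> 0 < c -> (0 < r)%N -> 0 < eta ->
  (forall m, -1 <= m <= 1 -> (m - m0) * drift p beta h m <= - c * (m - m0) ^+ (2 * r)) ->
  `|\sum_(x in A) gibbs p beta h x - \sum_(x in A) stat x| <=
  2 / (expR (- D) / (2 * expR M)) * (expR D * D / N%:R + 2 * expR M * (p%:R ^+ 2 * beta) *
     (eta + 2 / (c * N%:R) / eta ^+ (2 * r).-1)).
Proof.
move=> m0b c0 r0 eta0 restoring; have C := stat_concentration c0 restoring.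
set v0 := (partition_at m0)^-1.
set B1 := expR D * D / N%:R; set B2 := 2 * expR M * (p%:R ^+ 2 * beta).
have B20 : 0 <= B2 by rewrite mulr_ge0 // ?mulr_ge0 ?expR_ge0 ?exprn_ge0.
set T := \sum_x wt x * `|density x - v0|.
have T_le : T <= W * (B1 + B2 * (eta + 2 / (c * N%:R) / eta ^+ (2 * r).-1)).
  have e0 : 0 < eta ^+ (2 * r).-1 by rewrite exprn_gt0.
  apply: (@le_trans _ _ (\sum_x wt x * (B1 + B2 * (eta + (mbar R x - m0) ^+ (2 * r) / eta ^+ (2 * r).-1)))).
    apply: ler_sum => x _; rewrite ler_pM2l ?stat_weight_gt0 //.
    apply: le_trans (density_close x m0b) _; rewrite -/B1 -/B2 lerD2l ler_wpM2l //.
    exact: norm_le_power.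
  have -> : \sum_x wt x * (B1 + B2 * (eta + (mbar R x - m0) ^+ (2 * r) / eta ^+ (2 * r).-1)) =
    W * (B1 + B2 * eta) + B2 / eta ^+ (2 * r).-1 * \sum_x wt x * (mbar R x - m0) ^+ (2 * r).
    by rewrite mulr_suml mulr_sumr -big_split /=; apply: eq_bigr => x _; ring.
  have := ler_wpM2l (divr_ge0 B20 (ltW e0)) C; rewrite -/W.
  have -> : W * (B1 + B2 * (eta + 2 / (c * N%:R) / eta ^+ (2 * r).-1)) =
    W * (B1 + B2 * eta) + B2 / eta ^+ (2 * r).-1 * (2 / (c * N%:R) * W) by ring.
  by rewrite lerD2l.
set G := \sum_(x in A) wt x * density x; set SA := \sum_(x in A) wt x.
have -> : \sum_(x in A) gibbs p beta h x = G / Z.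
  by rewrite /G mulr_suml; apply: eq_bigr => x _; rewrite gibbsE.
have -> : \sum_(x in A) stat x = SA / W by rewrite /SA mulr_suml.
have T0 : 0 <= T by apply: sumr_ge0 => x _; rewrite mulr_ge0 // ltW ?stat_weight_gt0.
have SA0 : 0 <= SA by apply: sumr_ge0 => x _; rewrite ltW ?stat_weight_gt0.
have SAW : SA <= W.
  rewrite /W (bigID (mem A)) /= -/SA lerDl; apply: sumr_ge0 => x _.
  by rewrite ltW ?stat_weight_gt0.
have G1 : `|G - v0 * SA| <= T.
  rewrite /G mulr_sumr -sumrB; apply: le_trans (ler_norm_sum _ _ _) _.
  rewrite /T [leRHS](bigID (mem A)) /= -[leLHS]addr0; apply: lerD.
    apply: ler_sum => x _; rewrite mulrC -mulrBl normrM mulrC gtr0_norm ?stat_weight_gt0 //.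
  by apply: sumr_ge0 => x _; rewrite mulr_ge0 // ltW ?stat_weight_gt0.
have Z1 : `|Z - v0 * W| <= T.
  rewrite /Z mulr_sumr -sumrB; apply: le_trans (ler_norm_sum _ _ _) _.
  by apply: ler_sum => x _; rewrite mulrC -mulrBl normrM mulrC gtr0_norm ?stat_weight_gt0.
have -> : G / Z - SA / W = ((G - v0 * SA) * W - SA * (Z - v0 * W)) / (Z * W).
  by field; rewrite !lt0r_neq0.
rewrite normrM [X in _ * X]gtr0_norm ?invr_gt0 ?mulr_gt0 // ler_pdivrMr ?mulr_gt0 //.
apply: (@le_trans _ _ (T * W + W * T)).
  apply: le_trans (ler_normB _ _) _; rewrite !normrM (gtr0_norm W_gt0) (ger0_norm SA0).
  apply: lerD; first by rewrite ler_pM2r.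
  by rewrite ler_pM.
rewrite -/vmin; set Q := B1 + _ in T_le *.
have Q0 : 0 <= Q by rewrite -(pmulr_rge0 _ W_gt0) (le_trans T0).
have -> : T * W + W * T = 2 * W * T by ring.
apply: (@le_trans _ _ (2 * W * (W * Q))); first by rewrite ler_wpM2l // mulr_ge0 // ltW.
have -> : 2 / vmin * Q * (Z * W) = 2 * W * (Q * (Z / vmin)) by field; rewrite lt0r_neq0.
rewrite ler_wpM2l ?mulr_ge0 ?(ltW W_gt0) // mulrC ler_wpM2l //.
by rewrite ler_pdivlMr // mulrC.
Qed.
End FixN.
End GibbsClose.

(** * Total variation and mixing time *)

Section Mixing.
Variables (R : realType) (p : nat) (beta h : R).
Local Notation drift := (drift p beta h).

Lemma tv_ge N (mu nu : cube N -> R) (A : {set cube N}) :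
  `|\sum_(x in A) mu x - \sum_(x in A) nu x| <= tv_dist mu nu.
Proof. by rewrite /tv_dist; apply: (le_bigmax _ _ A). Qed.

Lemma worst_tv_ge N t (x : cube N) (A : {set cube N}) :
  `|\sum_(y in A) glauber_law p beta h x t y - \sum_(y in A) gibbs p beta h y|
  <= worst_tv p beta h N t.
Proof.
apply: le_trans (tv_ge _ _ A) _.
exact: (le_bigmax _ (fun x => tv_dist (glauber_law p beta h x t) _) x).
Qed.

Lemma worst_tv_le N t eps : 0 <= eps ->
  (forall (x : cube N) (A : {set cube N}),
   `|\sum_(y in A) glauber_law p beta h x t y - \sum_(y in A) gibbs p beta h y| <= eps) ->
  worst_tv p beta h N t <= eps.
Proof.
move=> e0 H; apply/bigmax_leP; split => // x _.
by apply/bigmax_leP; split => // A _.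
Qed.

Lemma tmix_le eps N t : worst_tv p beta h N t <= eps ->
  (tmix p beta h eps N <= (t%:R)%:E)%E.
Proof. by move=> H; apply: ereal_inf_lbound; exists t. Qed.

(** The time t ranges over all times before T because the total variation distance
    to a measure that is not stationary has no reason to be monotone. *)
Lemma tmix_ge eps N T : (forall t : nat, t%:R < T -> eps < worst_tv p beta h N t) ->
  (T%:E <= tmix p beta h eps N)%E.
Proof.
move=> H; apply: le_ereal_inf_tmp => _ [t /= ht <-]; rewrite lee_fin leNgt.
by apply/negP => /H; rewrite ltNge ht.
Qed.

Section FixN.
Variable N : nat.
Hypothesis N_gt0 : (0 < N)%N.
Let Ngt0 : 0 < N%:R :> R. Proof. by rewrite ltr0n. Qed.
Local Notation step := (step p beta h (N := N)).
Implicit Types (x y : cube N) (f : cube N -> R) (A : {set cube N}).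

Definition set_ind (A : {set cube N}) x : R := (x \in A)%:R.

Lemma sum_indic (mu : cube N -> R) (A : {set cube N}) :
  \sum_(y in A) mu y = \sum_y mu y * set_ind A y.
Proof.
rewrite big_mkcond; apply: eq_bigr => y _; rewrite /set_ind.
by case: (y \in A); rewrite ?mulr1 ?mulr0.
Qed.

Lemma law_indic x t (A : {set cube N}) :
  \sum_(y in A) glauber_law p beta h x t y = iter t step (set_ind A) x.
Proof. by rewrite sum_indic glauber_law_step. Qed.

Lemma iter_step_bound t f a b : (forall x, a <= f x <= b) ->
  forall x, a <= iter t step f x <= b.
Proof.
move=> ab; elim: t => // t IH x; rewrite iterS.
have Ea := step_cst p beta h N_gt0 a x; have Eb := step_cst p beta h N_gt0 b x.
by apply/andP; split; [rewrite -Ea|rewrite -Eb]; apply: ler_step => // y; case/andP: (IH y).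
Qed.

Lemma le_iter_step t f g : (forall x, f x <= g x) ->
  forall x, iter t step f x <= iter t step g x.
Proof. by move=> fg; elim: t => // t IH x; rewrite !iterS; apply: ler_step. Qed.

(** Additive drift bound, used for observables that stay small on average. *)
Lemma iter_step_add f a t : 0 <= a -> (forall x, step f x <= f x + a) ->
  forall x, iter t step f x <= f x + t%:R * a.
Proof.
move=> a0 H; elim: t => [|t IH] x; first by rewrite mul0r addr0.
rewrite iterS; apply: (@le_trans _ _ (step (fun y => f y + t%:R * a) x)).
  exact: ler_step.
rewrite (stepD _ _ _ f (fun=> t%:R * a)) step_cst // -natr1 mulrDl mul1r addrA [leRHS]addrAC lerD2r.
exact: H.
Qed.

Lemma iter_step_scale f a t : 0 <= a -> (forall x, step f x <= a * f x) ->
  forall x, iter t step f x <= a ^+ t * f x.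
Proof.
move=> a0 H; elim: t => [|t IH] x; first by rewrite mul1r.
rewrite iterS; apply: (@le_trans _ _ (step (fun y => a ^+ t * f y) x)).
  exact: ler_step.
by rewrite stepZ exprSr -mulrA ler_wpM2l ?exprn_ge0.
Qed.

Lemma stat_iter f t : \sum_x stat p beta h x * iter t step f x =
  \sum_x stat p beta h x * f x.
Proof. by elim: t => // t IH; rewrite iterS stat_step. Qed.

(** The reversible measure is invariant, so the distance to it is at most the
    oscillation of the iterated observable. *)
Lemma mixing_bound (A : {set cube N}) t a x :
  (forall y, `|iter t step (set_ind A) x - iter t step (set_ind A) y| <= a) ->
  `|\sum_(y in A) glauber_law p beta h x t y - \sum_(y in A) stat p beta h y| <= a.
Proof.
move=> H; rewrite law_indic sum_indic -(stat_iter _ t).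
have {1}-> : iter t step (set_ind A) x = \sum_(y : cube N) stat p beta h y * iter t step (set_ind A) x.
  by rewrite -mulr_suml sum_stat ?mul1r.
rewrite -sumrB; apply: le_trans (ler_norm_sum _ _ _) _.
rewrite -[leRHS]mul1r -(sum_stat p beta h N) mulr_suml.
apply: ler_sum => y _; rewrite -mulrBr normrM gtr0_norm ?stat_gt0 //.
by rewrite ler_pM2l ?stat_gt0.
Qed.

Lemma indic_swap_lipschitz A : swap_lipschitz (set_ind A) 1.
Proof.
move=> x i j; rewrite /set_ind; case: (x \in A); case: (_ \in A) => /=;
  rewrite ?subrr ?subr0 ?sub0r ?normrN ?normr0 ?normr1 //.
Qed.

Lemma osc_indic (A : {set cube N}) t1 t x y :
  `|iter t step (iter t1 step (set_ind A)) x - iter t step (iter t1 step (set_ind A)) y| <= 1.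
Proof.
rewrite -!iterD.
have b z : 0 <= set_ind A z <= 1 by rewrite /set_ind; case: (z \in A); rewrite /= lexx ler01.
have := iter_step_bound (t + t1) b x; have := iter_step_bound (t + t1) b y.
by rewrite ler_norml => ? ?; apply/andP; split; lra.
Qed.

(** Swapping is contracted at rate 1 / N per step, and at most N swaps are needed. *)
Lemma osc_level (A : {set cube N}) t1 t x y : mbar R x = mbar R y ->
  `|iter t step (iter t1 step (set_ind A)) x - iter t step (iter t1 step (set_ind A)) y|
  <= N%:R * (1 - N%:R^-1) ^+ t1.
Proof.
move=> xy; rewrite -!iterD.
have N1 : 0 <= 1 - (N%:R : R)^-1 <= 1.
  by rewrite subr_ge0 invf_le1 ?ler1n // N_gt0 /= gerBl invr_ge0 ltW.
case/andP: N1 => N0 N1.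
apply: (@le_trans _ _ (N%:R * (1 - N%:R^-1) ^+ (t + t1))).
  by apply: swap_lipschitz_level => //; rewrite -[X in swap_lipschitz _ X]mulr1; apply: iter_swap_lipschitz => //; exact: indic_swap_lipschitz.
by rewrite ler_pM2l // exprD ler_piMl ?exprn_ge0 ?exprn_ile1.
Qed.
End FixN.
End Mixing.

(** * Upper bounds *)

Section Upper.
Variables (R : realType) (p : nat) (beta h : R).
Local Notation drift := (drift p beta h).
Hypotheses (p_gt0 : (0 < p)%N) (beta_ge0 : 0 <= beta).

(** The drift vanishes exactly to order 2r - 1 at m0, points towards m0 everywhere,
    is Lipschitz, and is nonincreasing near m0. Regular points give r = 1 and special
    points r = 2. *)
Definition restoring_drift (r : nat) (m0 : R) : Prop :=
  [/\ -1 < m0 < 1,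
      exists2 c, 0 < c & forall m, -1 <= m <= 1 ->
        (m - m0) * drift m <= - c * (m - m0) ^+ (2 * r),
      exists2 C, 0 <= C & forall m, -1 <= m <= 1 ->
        - ((m - m0) * drift m) <= C * (m - m0) ^+ (2 * r),
      exists2 L, 0 <= L & forall a b, -1 <= a <= 1 -> -1 <= b <= 1 -> a <= b ->
        drift b - drift a <= L * (b - a) &
      exists2 delta, 0 < delta & forall a b, -1 <= a <= 1 -> -1 <= b <= 1 ->
        `|a - m0| <= delta -> `|b - m0| <= delta -> a <= b -> drift b <= drift a].

Lemma nat_above (x : R) : 0 <= x -> exists n : nat, x <= n%:R <= x + 1.
Proof.
move=> x0; exists (Num.truncn x).+1.
have /andP[t1 t2] := truncn_itv x0.
by rewrite (ltW t2) -natr1 lerD2r.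
Qed.

Lemma eventually_ge (x : R) : exists N0 : nat, forall N, (N0 <= N)%N -> x <= N%:R.
Proof.
have [n /andP[xn _]] := nat_above (normr_ge0 x); exists n => N nN.
by apply: le_trans (ler_norm x) _; apply: le_trans xn _; rewrite ler_nat.
Qed.

Lemma ln_tangent (A w w' : R) : 0 < A -> 0 <= w -> 0 <= w' ->
  ln (A + w') <= ln (A + w) + (w' - w) / (A + w).
Proof.
move=> A0 w0 w0'; have D0 : 0 < A + w by rewrite ltr_wpDr.
have D0' : 0 < A + w' by rewrite ltr_wpDr.
have E : A + w' = (A + w) * (1 + (w' - w) / (A + w)) by field; apply: lt0r_neq0.
have P : 0 < 1 + (w' - w) / (A + w) by rewrite -(pmulr_rgt0 _ D0) -E.
rewrite {1}E lnM ?posrE // lerD2l le_ln1Dx //; lra.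
Qed.

Lemma inv_tangent (A w w' : R) : 0 < A -> 0 <= w -> 0 <= w' ->
  A^-1 - (A + w')^-1 <= A^-1 - (A + w)^-1 + (w' - w) / (A + w) ^+ 2.
Proof.
move=> A0 w0 w0'; have D0 : 0 < A + w by rewrite ltr_wpDr.
have D0' : 0 < A + w' by rewrite ltr_wpDr.
rewrite -subr_ge0.
have -> : A^-1 - (A + w)^-1 + (w' - w) / (A + w) ^+ 2 - (A^-1 - (A + w')^-1) =
  (w' - w) ^+ 2 / ((A + w) ^+ 2 * (A + w')).
  by field; rewrite !lt0r_neq0.
by rewrite divr_ge0 ?sqr_ge0 // mulr_ge0 ?sqr_ge0 // ltW.
Qed.

(** A primitive of (A + w)^-r for r = 1 and r = 2. It is logarithmic for r = 1 and bounded for r = 2, which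
    is why the first regime has an extra logarithm. *)
Definition concave_scale (r : nat) (A w : R) : R :=
  if r == 1%N then ln (A + w) else A^-1 - (A + w)^-1.

(** Here eta is taken of order e, then N large enough for the remaining terms. *)
Lemma gibbs_close r m0 e : restoring_drift r m0 -> (0 < r)%N -> 0 < e ->
  exists N0 : nat, forall N (A : {set cube N}), (N0 <= N)%N -> (0 < N)%N ->
    `|\sum_(x in A) gibbs p beta h x - \sum_(x in A) stat p beta h x| <= e.
Proof.
move=> [/andP[m1 m2] [c c0 restoring] _ _ _] r0 e0.
have m0b : -1 <= m0 <= 1 by rewrite !ltW.
pose M := p%:R * beta + `|h|; pose D := 4 * beta * p%:R ^+ 3.
pose K1 : R := 2 / (expR (- D) / (2 * expR M)).
pose K3 := 2 * expR M * (p%:R ^+ 2 * beta).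
have K1_gt0 : 0 < K1 by rewrite divr_gt0 // divr_gt0 ?mulr_gt0 ?expR_gt0.
have K3_ge0 : 0 <= K3 by do ![apply: mulr_ge0 | apply: expR_ge0 | apply: exprn_ge0] => //.
pose eta := e / (2 * K1 * (K3 + 1)).
have K31 : 0 < K3 + 1 by rewrite ltr_wpDl.
have eta0 : 0 < eta.
  by apply: divr_gt0 => //; apply: mulr_gt0 => //; apply: mulr_gt0.
pose K4 := expR D * D + K3 * (2 / c / eta ^+ (2 * r).-1).
have [N0 HN0] := eventually_ge (2 * K1 * K4 / e).
exists N0 => N A NN N_gt0; have Ngt0 : 0 < N%:R :> R by rewrite ltr0n.
apply: le_trans (stat_gibbs p_gt0 beta_ge0 N_gt0 A m0b c0 r0 eta0 restoring) _.
rewrite -/D -/M -/K1 -/K3.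
have et0 : 0 < eta ^+ (2 * r).-1 by rewrite exprn_gt0.
have -> : K1 * (expR D * D / N%:R + K3 * (eta + 2 / (c * N%:R) / eta ^+ (2 * r).-1)) =
  K1 * K3 * eta + K1 * K4 / N%:R.
  by rewrite /K4; field; rewrite !lt0r_neq0.
have H1 : K1 * K3 * eta <= e / 2.
  have -> : K1 * K3 * eta = e / 2 * (K3 / (K3 + 1)) by rewrite /eta; field; rewrite !lt0r_neq0.
  by rewrite ler_piMr ?divr_ge0 ?(ltW e0) // ler_pdivrMr // mul1r lerDl.
have H2 : K1 * K4 / N%:R <= e / 2.
  rewrite ler_pdivrMr //; have := HN0 N NN; rewrite ler_pdivrMr //; lra.
lra.
Qed.

Lemma expR_pow_le (N t : nat) : (0 < N)%N ->
  (1 - N%:R^-1) ^+ t <= expR (- (t%:R / N%:R)) :> R.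
Proof.
move=> N0; have -> : - (t%:R / N%:R) = t%:R * (- N%:R^-1) :> R by rewrite mulrN.
rewrite expRM_natl; apply: lerXn2r; rewrite ?nnegrE ?expR_ge0 ?expR_ge1Dx //.
by rewrite subr_ge0 invf_le1 ?ltr0n // ler1n.
Qed.

(** The first t1 steps, of order N log N, make the observable almost constant at fixed
    magnetization; the next n steps merge the magnetizations. *)
Lemma tmix_upper r m0 eps : restoring_drift r m0 -> (r == 1)%N || (r == 2)%N ->
  0 < eps -> eps < 2^-1 ->
  exists A C : R, exists N0 : nat, [/\ 1 <= A, 0 < C & forall N S, (N0 <= N)%N ->
    0 < S -> S ^+ r = N%:R ->
    (tmix p beta h eps N <=
      (C * (N%:R * ln N%:R + (1 + concave_scale r A (4 * S)) * (N%:R ^+ 2 / S)))%:E)%E].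
Proof.
move=> rd r12 eps0 eps1; have r_gt0 : (0 < r)%N by case/orP: r12 => /eqP ->.
have [NG HNG] := gibbs_close rd r_gt0 (divr_gt0 eps0 (ltr0Sn R 1)).
case: rd => /andP[m1 m2] [c c_gt0 restoring] _ [LF LF0 lip] [delta delta0 decr].
have m0b : -1 <= m0 <= 1 by rewrite !ltW.
pose M := p%:R * beta + `|h|.
have M0 : 0 <= M by rewrite addr_ge0 ?mulr_ge0.
have M1 : 1 <= expR M by rewrite -(expR0 R) ler_expR.
pose c0 : R := (2 * expR M)^-1 * expR (- M).
have c0_gt0 : 0 < c0 by rewrite mulr_gt0 ?invr_gt0 ?mulr_gt0 ?expR_gt0.
have c0_le : c0 <= 2^-1.
  have i1 : (expR M)^-1 <= 1 by rewrite invf_le1 ?expR_gt0.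
  have i0 : 0 <= (expR M)^-1 by rewrite invr_ge0 expR_ge0.
  rewrite /c0 expRN invfM -mulrA ler_piMr // -expr2 expr_le1 //.
pose A := 8 * 2 ^+ r / c + 1.
have A1 : 1 <= A by rewrite lerDr divr_ge0 ?mulr_ge0 ?exprn_ge0 // ltW.
have A0 : 0 < A by exact: lt_le_trans A1.
pose phi := concave_scale r A.
have phi_tan w w' : 0 <= w -> 0 <= w' -> phi w' <= phi w + (w' - w) / (A + w) ^+ r.
  move=> w0 w0'; rewrite /phi /concave_scale.
  by case/orP: r12 => /eqP -> /=; [exact: ln_tangent|exact: inv_tangent].
have phi_mono w w' : 0 <= w -> w <= w' -> phi w <= phi w'.
  move=> w0 ww; have D0 : 0 < A + w by rewrite ltr_wpDr.
  have D0' : 0 < A + w' by rewrite ltr_wpDr // (le_trans w0).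
  rewrite /phi /concave_scale; case: eqP => _.
    by rewrite ler_ln ?posrE // lerD2l.
  by rewrite lerD2l lerN2 lef_pV2 ?posrE // lerD2l.
have phi0 w : 0 <= w -> 0 <= phi w.
  move=> w0; apply: le_trans (phi_mono 0 w (lexx 0) w0).
  rewrite /phi /concave_scale addr0; case: eqP => _; first exact: ln_ge0.
  by rewrite subrr.
have [C1 [S1 [C1_gt0 S1_ge1 LM]]] := level_mixing m0b c_gt0 c0_gt0 c0_le LF0 delta0 r_gt0
   (fun m t mb => two_point_lower p h beta_ge0 t mb) restoring lip decr phi_tan phi0 phi_mono.
pose L := ln (4 / eps).
have L0 : 0 <= L.
  by apply: ln_ge0; rewrite ler_pdivlMr // mul1r; lra.
have [NS HNS] := eventually_ge (S1 ^+ r).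
have [NE HNE] := eventually_ge (expR 1).
exists A, (3 + L + 4 * C1 / eps), (maxn NG (maxn NS (maxn NE 1))); split => //.
  by rewrite ltr_wpDr ?divr_ge0 ?mulr_ge0 ?(ltW C1_gt0) ?(ltW eps0) // ltr_wpDr.
move=> N S; rewrite !geq_max => /and4P[/HNG gibbsN /HNS NS1 /HNE Ne N_gt0] S0 SN.
have Ngt0 : 0 < N%:R :> R by rewrite ltr0n.
have N1 : 1 <= N%:R :> R by rewrite ler1n.
have SS1 : S1 <= S.
  rewrite leNgt; apply/negP => SS; have : S ^+ r < S1 ^+ r.
    by rewrite ltrXn2r -?lt0n // ?ltW.
  by rewrite SN ltNge NS1.
have SN2 : S <= N%:R ^+ 2.
  apply: (@le_trans _ _ N%:R); last by rewrite expr2 ler_peMr // ltW.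
  rewrite -SN -[leLHS]expr1; apply: ler_weXn2l => //; exact: le_trans SS1.
have lnN : 1 <= ln N%:R :> R by rewrite -[leLHS](expRK 1) ler_ln ?posrE ?expR_gt0.
have lnN0 : 0 <= ln N%:R :> R by apply: le_trans lnN.
set U := N%:R ^+ 2 / S; have U0 : 0 < U by rewrite divr_gt0 ?exprn_gt0.
have ph0 : 0 <= phi (4 * S) by rewrite phi0 // mulr_ge0 // ltW.
have C0 : 0 <= 4 * C1 / eps by rewrite divr_ge0 ?mulr_ge0 // ltW.
have X0 : 0 <= (1 + phi (4 * S)) * U.
  by apply: mulr_ge0 (ltW U0); rewrite addr_ge0.
have [t1 /andP[t1a t1b]] : exists n : nat, N%:R * (ln N%:R + L) <= n%:R <= N%:R * (ln N%:R + L) + 1.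
  by apply: nat_above; rewrite mulr_ge0 // addr_ge0.
have [n /andP[na nb]] : exists n : nat, 4 * C1 / eps * ((1 + phi (4 * S)) * U) <= n%:R <= 4 * C1 / eps * ((1 + phi (4 * S)) * U) + 1.
  by apply: nat_above; apply: mulr_ge0.
have tU : (n + t1)%:R <= (3 + L + 4 * C1 / eps) * (N%:R * ln N%:R + (1 + phi (4 * S)) * U).
  rewrite natrD.
  have NL : N%:R <= N%:R * ln N%:R :> R by rewrite ler_peMr.
  have Q1 := ler_wpM2l L0 NL.
  have Q2 : 0 <= (3 + L) * ((1 + phi (4 * S)) * U) by rewrite mulr_ge0 // addr_ge0.
  have Q3 : 0 <= 4 * C1 / eps * (N%:R * ln N%:R) by rewrite mulr_ge0 // mulr_ge0.
  lra.
apply: (@le_trans _ _ ((n + t1)%:R%:E)); last by rewrite lee_fin.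
apply: tmix_le; apply: worst_tv_le; first exact: ltW.
move=> x B.
set gB := \sum_(y in B) gibbs p beta h y.
set sB := \sum_(y in B) stat p beta h y.
have g1 : `|gB - sB| <= eps / 2 by apply: gibbsN.
have -> : \sum_(y in B) glauber_law p beta h x (n + t1) y - gB =
  (\sum_(y in B) glauber_law p beta h x (n + t1) y - sB) + (sB - gB) by ring.
apply: le_trans (ler_normD _ _) _; rewrite [`|sB - gB|]distrC.
have -> : eps = eps / 2 + eps / 2 by field.
apply: lerD => //; apply: mixing_bound => // y; rewrite !iterD.
pose rho : R := N%:R * (1 - N%:R^-1) ^+ t1.
have rho0 : 0 <= rho.
  by rewrite mulr_ge0 // exprn_ge0 // subr_ge0 invf_le1.
have rho_le : rho <= eps / 4.
  have E4 : eps / 4 = N%:R * expR (- (ln N%:R + L)).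
    rewrite expRN expRD !lnK ?posrE ?divr_gt0 //; field; rewrite !lt0r_neq0 //.
  rewrite E4 ler_pM2l //; apply: le_trans (expR_pow_le _ N_gt0) _.
  by rewrite ler_expR lerN2 ler_pdivlMr // mulrC.
have := LM N S (iter t1 (@step R p beta h N) (@set_ind R N B)) rho n x y N_gt0 SS1 SN SN2 rho0
  (osc_indic p beta h N_gt0 B t1) (osc_level p beta h N_gt0 B t1).
set u := `|_ - _|; move=> H.
suff : u - rho <= eps / 4.
  rewrite lerBlDr => /le_trans; apply.
  have -> : eps / 2 = eps / 4 + eps / 4 by field.
  by rewrite lerD2l.
have n0 : 0 < n%:R :> R.
  apply: lt_le_trans na; apply: mulr_gt0; first by rewrite divr_gt0 // mulr_gt0.
  by apply: mulr_gt0 U0; rewrite ltr_wpDr.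
have SU : S / N%:R ^+ 2 = U^-1 by rewrite /U invf_div.
rewrite SU in H; rewrite -(ler_pM2l (mulr_gt0 (_ : 0 < U^-1) n0)) ?invr_gt0 //.
apply: le_trans H _.
have -> : U^-1 * n%:R * (eps / 4) = n%:R * (eps / 4 / U) by ring.
apply: le_trans (ler_wpM2r _ na); last by apply: divr_ge0 (ltW U0); apply: divr_ge0 => //; exact: ltW.
by rewrite le_eqVlt; apply/orP; left; apply/eqP; field; rewrite !lt0r_neq0.
Qed.
End Upper.

(** * Lower bounds for a single well *)

Section Lower.
Variables (R : realType) (p : nat) (beta h : R).
Local Notation drift := (drift p beta h).

(** Second order Taylor bound for w |-> 1 / (1 + w) when the step is at most
    comparable with 1 + w. *)
Lemma reciprocal_expansion (w w' k : R) : 0 <= w -> 0 <= w' ->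
  1 + w <= 3 * (1 + w') -> (w' - w) ^+ 2 <= k * (1 + w) ->
  (1 + w')^-1 <= (1 + w)^-1 - (w' - w) / (1 + w) ^+ 2 + 3 * k / (1 + w) ^+ 2.
Proof.
move=> w0 w0' H1 H2; have D0 : 0 < 1 + w by rewrite ltr_wpDr.
have D0' : 0 < 1 + w' by rewrite ltr_wpDr.
rewrite -subr_ge0.
have -> : (1 + w)^-1 - (w' - w) / (1 + w) ^+ 2 + 3 * k / (1 + w) ^+ 2 - (1 + w')^-1 =
  (3 * (1 + w') * k - (w' - w) ^+ 2) / ((1 + w) ^+ 2 * (1 + w')).
  by field; rewrite !lt0r_neq0.
apply: divr_ge0; last by rewrite mulr_ge0 ?sqr_ge0 // ltW.
rewrite subr_ge0; have k0 : 0 <= k by rewrite -(pmulr_lge0 _ D0) (le_trans (sqr_ge0 _) H2).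
apply: le_trans H2 _; rewrite mulrC ler_wpM2r //.
Qed.

Section FixN.
Variables (N : nat) (S m0 C : R) (r : nat).
Hypotheses (N_gt0 : (0 < N)%N) (S_gt0 : 0 < S) (S_le : 4 * S <= N%:R ^+ 2).
Hypothesis SN : S ^+ r = N%:R.
Hypothesis drift_flat : forall m, -1 <= m <= 1 ->
  - ((m - m0) * drift m) <= C * (m - m0) ^+ (2 * r).
Let Ngt0 : 0 < N%:R :> R. Proof. by rewrite ltr0n. Qed.
Let w_ (m : R) : R := S * (m - m0) ^+ 2.
Let w0 m : 0 <= w_ m. Proof. by rewrite mulr_ge0 ?sqr_ge0 // ltW. Qed.

Let move_bound m e : e ^+ 2 = (2 / N%:R) ^+ 2 ->
  (1 + w_ m <= 3 * (1 + w_ (m + e))) /\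
  (w_ (m + e) - w_ m) ^+ 2 <= 32 * (S / N%:R ^+ 2) * (1 + w_ m).
Proof.
move=> eE; have Se : S * e ^+ 2 <= 1.
  have -> : S * e ^+ 2 = 4 * S / N%:R ^+ 2 by rewrite eE; field; apply: lt0r_neq0.
  by rewrite ler_pdivrMr ?exprn_gt0 // mul1r.
split.
  have : 0 <= S * ((m + e - m0) + e) ^+ 2 by rewrite mulr_ge0 ?sqr_ge0 // ltW.
  have : 0 <= S * (m + e - m0) ^+ 2 by rewrite mulr_ge0 ?sqr_ge0 // ltW.
  rewrite /w_; have -> : m - m0 = (m + e - m0) - e by ring.
  set t := m + e - m0; lra.
have -> : 32 * (S / N%:R ^+ 2) * (1 + w_ m) = 8 * (S * e ^+ 2) * (1 + w_ m).
  by rewrite eE; field; apply: lt0r_neq0.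
have -> : (w_ (m + e) - w_ m) ^+ 2 = (S * e ^+ 2) * (S * (2 * (m - m0) + e) ^+ 2).
  by rewrite /w_; ring.
have -> : 8 * (S * e ^+ 2) * (1 + w_ m) = (S * e ^+ 2) * (8 * (1 + w_ m)) by ring.
apply: ler_wpM2l; first by rewrite mulr_ge0 ?sqr_ge0 // ltW.
have : 0 <= S * (2 * (m - m0) - e) ^+ 2 by rewrite mulr_ge0 ?sqr_ge0 // ltW.
rewrite /w_; lra.
Qed.

(** The observable 1 / (1 + w), with w = S (m - m0)^2, measures how close the chain is to
    m0. It grows at most at the rate given by the drift towards m0, since the drift is
    bounded by a multiple of |m - m0|^(2r - 1). *)
Lemma lstep_reciprocal m : -1 <= m <= 1 ->
  lstep p beta h N (fun m => (1 + w_ m)^-1) m <=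
  (1 + w_ m)^-1 + S / N%:R ^+ 2 * ((2 * C * w_ m ^+ r + 96) / (1 + w_ m) ^+ 2).
Proof.
move=> mb.
have D0 : 0 < 1 + w_ m by rewrite ltr_wpDr.
have up_e : (2 / N%:R) ^+ 2 = (2 / N%:R) ^+ 2 :> R by [].
have dn_e : (- (2 / N%:R)) ^+ 2 = (2 / N%:R) ^+ 2 :> R by rewrite sqrrN.
have [u1 u2] := move_bound m up_e; have [d1 d2] := move_bound m dn_e.
pose k := 32 * (S / N%:R ^+ 2).
have k0 : 0 <= k by rewrite mulr_ge0 // divr_ge0 ?exprn_ge0 // ltW.
have z1 : 1 + w_ m <= 3 * (1 + w_ m) by lra.
have z2 : (w_ m - w_ m) ^+ 2 <= k * (1 + w_ m) by rewrite subrr expr0n mulr_ge0 // ltW.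
apply: le_trans (@lstep_le R p beta h N (fun m => (1 + w_ m)^-1) m _ _ _ mb (reciprocal_expansion (w0 m) (w0 _) u1 u2)
  (reciprocal_expansion (w0 m) (w0 _) d1 d2) (reciprocal_expansion (w0 m) (w0 m) z1 z2)) _.
have E := lstep_sqdist p beta h N_gt0 m0 m.
have EF : up_rate p beta h m * ((1 + w_ m)^-1 - (w_ (m + 2 / N%:R) - w_ m) / (1 + w_ m) ^+ 2 + 3 * k / (1 + w_ m) ^+ 2) +
  down_rate p beta h m * ((1 + w_ m)^-1 - (w_ (m - 2 / N%:R) - w_ m) / (1 + w_ m) ^+ 2 + 3 * k / (1 + w_ m) ^+ 2) +
  (1 - up_rate p beta h m - down_rate p beta h m) *
    ((1 + w_ m)^-1 - (w_ m - w_ m) / (1 + w_ m) ^+ 2 + 3 * k / (1 + w_ m) ^+ 2) =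
  (1 + w_ m)^-1 + (3 * k - S * (lstep p beta h N (fun m' => (m' - m0) ^+ 2) m - (m - m0) ^+ 2)) / (1 + w_ m) ^+ 2.
  by rewrite /lstep /w_; ring.
rewrite EF E lerD2l mulrA ler_wpM2r ?invr_ge0 ?sqr_ge0 //.
have /andP[m1 m2] := mb.
have ud : 0 <= up_rate p beta h m + down_rate p beta h m.
  by rewrite addr_ge0 ?up_rate_ge0 ?down_rate_ge0.
have F1 : S * (2 / N%:R) * (- ((m - m0) * drift m)) <= S * (2 / N%:R) * (C * (m - m0) ^+ (2 * r)).
  by rewrite ler_wpM2l ?drift_flat // mulr_ge0 ?divr_ge0 // ltW.
have F2 : 0 <= S * (4 / N%:R ^+ 2) * (up_rate p beta h m + down_rate p beta h m).
  by rewrite mulr_ge0 // mulr_ge0 ?divr_ge0 ?exprn_ge0 // ltW.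
have F3 : S / N%:R ^+ 2 * (2 * C * w_ m ^+ r + 96) = S * (2 / N%:R) * (C * (m - m0) ^+ (2 * r)) + 3 * k.
  rewrite /w_ exprMn SN -exprM /k; field; exact: lt0r_neq0.
rewrite F3; lra.
Qed.
End FixN.

Definition all_plus N : cube N := [ffun=> true].

Lemma mbar_all_plus N : (0 < N)%N -> mbar R (all_plus N) = 1.
Proof.
move=> N0; rewrite /mbar (eq_bigr (fun=> 1)); last by move=> i _; rewrite ffunE.
by rewrite sumr_const card_ord mulVf // pnatr_eq0 -lt0n.
Qed.

(** Gibbs concentration puts mass 7/8 on a set where w is bounded; if the chain started
    from all plus has a small mean of 1 / (1 + w), Markov's inequality shows that it has
    mass at most 1/8 there, and the distance is at least 3/4. *)
Lemma worst_tv_lower r m0 : (0 < p)%N -> 0 <= beta -> (0 < r)%N ->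
  restoring_drift p beta h r m0 ->
  exists2 c1 : R, 0 < c1 & forall N S t eps, (0 < N)%N -> 0 < S -> S ^+ r = N%:R ->
    eps < 2^-1 ->
    iter t (@step R p beta h N) (fun x => (1 + S * (mbar R x - m0) ^+ 2)^-1) (all_plus N) <= c1 ->
    eps < worst_tv p beta h N t.
Proof.
move=> p0 b0 r0 [_ [c c_gt0 restoring] _ _ _].
pose K : R := expR (4 * beta * p%:R ^+ 3) / (expR (- (4 * beta * p%:R ^+ 3)) / (2 * expR (p%:R * beta + `|h|))) * (2 / c).
have K0 : 0 < K.
  by apply: mulr_gt0; rewrite ?divr_gt0 ?mulr_gt0 ?expR_gt0.
pose B0 := 1 + 8 * K.
have B01 : 1 <= B0 by rewrite /B0; lra.
have B00 : 0 < B0 by lra.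
exists (8 * (1 + B0))^-1; first by rewrite invr_gt0; lra.
move=> N S t eps N_gt0 S0 SN eps1 small.
have Ngt0 : 0 < N%:R :> R by rewrite ltr0n.
pose w (x : cube N) := S * (mbar R x - m0) ^+ 2.
have w0 x : 0 <= w x by rewrite mulr_ge0 ?sqr_ge0 // ltW.
pose B := [set x | w x <= B0]%SET.
apply: lt_le_trans (worst_tv_ge p beta h t (all_plus N) B).
have lawB : \sum_(y in B) glauber_law p beta h (all_plus N) t y <= 8^-1.
  rewrite law_indic //.
  apply: (@le_trans _ _ (iter t (@step R p beta h N) (fun x => (1 + B0) * (1 + w x)^-1) (all_plus N))).
    apply: le_iter_step => // x; rewrite /set_ind inE; have [wx|wx] := leP (w x) B0; rewrite /=.
      by rewrite ler_pdivlMr ?mul1r ?lerD2l // ltr_wpDr.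
    apply: mulr_ge0; first by rewrite addr_ge0 // ltW.
    by rewrite invr_ge0 addr_ge0.
  have -> : iter t (@step R p beta h N) (fun x => (1 + B0) * (1 + w x)^-1) (all_plus N) =
    (1 + B0) * iter t (@step R p beta h N) (fun x => (1 + w x)^-1) (all_plus N).
    rewrite -!glauber_law_step // mulr_sumr; apply: eq_bigr => y _; ring.
  apply: le_trans (ler_wpM2l _ small) _; first by rewrite addr_ge0 // ltW.
  rewrite invfM mulrCA mulfV ?mulr1 // lt0r_neq0 //; lra.
have gibbsB : 7 / 8 <= \sum_(y in B) gibbs p beta h y.
  have s1 := sum_gibbs h p0 b0 N_gt0.
  have := gibbs_concentration p0 b0 N_gt0 c_gt0 restoring; rewrite -/K.
  rewrite (bigID (mem B)) /= in s1.
  have H1 : \sum_(x | x \notin B) gibbs p beta h x <=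
    \sum_(x : cube N) (N%:R / B0) * (gibbs p beta h x * (mbar R x - m0) ^+ (2 * r)).
    rewrite [leRHS](bigID (mem B)) /= -[leLHS]add0r; apply: lerD.
      apply: sumr_ge0 => x _; apply: mulr_ge0; first by rewrite divr_ge0 ?(ltW B00) // ltW.
      by rewrite mulr_ge0 ?(ltW (gibbs_gt0 h p0 b0 N_gt0 _)) // exprM exprn_ge0 // sqr_ge0.
    apply: ler_sum => x; rewrite inE -ltNge => wx.
    have -> : N%:R / B0 * (gibbs p beta h x * (mbar R x - m0) ^+ (2 * r)) =
      gibbs p beta h x * (w x ^+ r / B0) by rewrite /w exprMn SN -exprM; ring.
    rewrite ler_peMr ?(ltW (gibbs_gt0 h p0 b0 N_gt0 _)) // ler_pdivlMr // mul1r.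
    apply: le_trans (ltW wx) _; rewrite -[leLHS]expr1; apply: ler_weXn2l => //.
    exact: le_trans B01 (ltW wx).
  rewrite -mulr_sumr in H1 => H2.
  have H3 := ler_wpM2l (_ : 0 <= N%:R / B0) H2.
  have {}H3 := H3 (divr_ge0 (ltW Ngt0) (ltW B00)).
  have E : N%:R / B0 * (K / N%:R) = K / B0 by field; rewrite !lt0r_neq0.
  have E2 : K / B0 <= 8^-1.
    rewrite ler_pdivrMr // /B0; lra.
  rewrite E in H3; lra.
rewrite distrC; apply: lt_le_trans (ler_norm _); lra.
Qed.
End Lower.

(** * Metastability *)

Section Metastable.
Variables (R : realType) (p : nat) (beta h : R).
Hypotheses (p_gt0 : (0 < p)%N) (beta_ge0 : 0 <= beta).
Local Notation drift := (drift p beta h).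

Lemma expR_ge1 (x : R) : (1 <= expR x) = (0 <= x).
Proof. by rewrite -[X in X <= _]expR0 ler_expR. Qed.

(** Capped exponential of minus the depth inside a well, measured from the edge l in the
    direction sg; it equals 1 outside the well. *)
Definition barrier_cost (N : nat) (gam sg l m : R) : R :=
  Num.min 1 (expR (- (gam * N%:R * (sg * (m - l))))).

(** In the layer where the drift is at least kap, an up move is likelier than a down move
    by the factor 1 + kap / 2, and with this exponent the exponential is a
    supermartingale. Outside the well the cost is maximal, and beyond the layer it is
    exponentially small before and after the step. *)
Lemma lstep_barrier N gam sg l kap del m : (0 < N)%N -> 0 < gam ->
  expR (2 * gam) = 1 + kap / 2 -> sg = 1 \/ sg = -1 -> -1 <= m <= 1 ->
  (forall m, -1 <= m <= 1 -> 0 <= sg * (m - l) <= del -> kap <= sg * drift m) ->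
  lstep p beta h N (barrier_cost N gam sg l) m <=
  barrier_cost N gam sg l m + expR (2 * gam) * expR (- (gam * N%:R * del)).
Proof.
move=> N_gt0 gam0 gamE sgE mb H.
have Ngt0 : 0 < N%:R :> R by rewrite ltr0n.
have /andP[m1 m2] := mb.
have u0 := up_rate_ge0 p beta h m2; have d0 := down_rate_ge0 p beta h m1.
have s1 := rates_le1 p beta h mb.
have lsl v1 v2 v3 := @lstep_le R p beta h N (barrier_cost N gam sg l) m v1 v2 v3 mb.
have min1 x : barrier_cost N gam sg l x <= 1 by rewrite /barrier_cost ge_min lexx.
have minE x : barrier_cost N gam sg l x <= expR (- (gam * N%:R * (sg * (x - l)))).
  by rewrite /barrier_cost ge_min lexx orbT.
have a0 : 0 <= expR (2 * gam) * expR (- (gam * N%:R * del)) by rewrite mulr_ge0 ?expR_ge0.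
have gN : 0 < gam * N%:R by rewrite mulr_gt0.
have [neg|pos] := ltP (sg * (m - l)) 0.
  have -> : barrier_cost N gam sg l m = 1.
    rewrite /barrier_cost; apply/min_idPl; rewrite expR_ge1 oppr_ge0.
    by rewrite (pmulr_rle0 _ gN) ltW.
  have Q := lsl _ _ _ (min1 _) (min1 _) (min1 _); lra.
have stepE x : expR (- (gam * N%:R * (sg * (m + x * (2 / N%:R) - l)))) =
   expR (- (gam * N%:R * (sg * (m - l)))) * expR (- (2 * gam * (sg * x))).
  by rewrite -expRD; congr expR; field; apply: lt0r_neq0.
have EV : barrier_cost N gam sg l m = expR (- (gam * N%:R * (sg * (m - l)))).
  rewrite /barrier_cost; apply/min_idPr; rewrite expR_le1 oppr_le0.
  by rewrite mulr_ge0 // ltW.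
set E := expR (- (gam * N%:R * (sg * (m - l)))) in stepE EV.
have E0 : 0 < E by rewrite expR_gt0.
have g1 : 1 <= expR (2 * gam) by rewrite expR_ge1 mulr_ge0 // ltW.
have gi : 0 < expR (- (2 * gam)) by rewrite expR_gt0.
have ggi : expR (2 * gam) * expR (- (2 * gam)) = 1 by rewrite -expRD subrr expR0.
have vU : barrier_cost N gam sg l (m + 2 / N%:R) <= E * expR (- (2 * gam * sg)).
  by apply: le_trans (minE _) _; have := stepE 1; rewrite mul1r mulr1 => ->.
have vD : barrier_cost N gam sg l (m - 2 / N%:R) <= E * expR (2 * gam * sg).
  apply: le_trans (minE _) _; have := stepE (-1).
  by rewrite mulN1r mulrN1 mulrN opprK => ->.
have vM : barrier_cost N gam sg l m <= E by rewrite EV.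
have [near|far] := leP (sg * (m - l)) del.
  have HF := H m mb (introT andP (conj pos near)).
  have dE : drift m = 2 * (up_rate p beta h m - down_rate p beta h m).
    by rewrite rates_drift; field.
  apply: le_trans (lsl _ _ _ vU vD vM) _; rewrite EV.
  suff : up_rate p beta h m * (E * expR (- (2 * gam * sg))) +
    down_rate p beta h m * (E * expR (2 * gam * sg)) +
    (1 - up_rate p beta h m - down_rate p beta h m) * E <= E by lra.
  suff Q : up_rate p beta h m * (expR (- (2 * gam * sg)) - 1) +
           down_rate p beta h m * (expR (2 * gam * sg) - 1) <= 0.
    by have := ler_wpM2l (ltW E0) Q; rewrite mulr0; lra.
  move: HF; rewrite dE; set u := up_rate p beta h m in u0 s1 *.
  set d := down_rate p beta h m in d0 s1 *.
  have key (a b : R) : 0 <= a -> 0 <= b -> a + b <= 1 -> kap / 2 <= a - b ->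
      a * (expR (- (2 * gam)) - 1) + b * (expR (2 * gam) - 1) <= 0.
    move=> a_0 b_0 ab HF.
    have -> : a * (expR (- (2 * gam)) - 1) + b * (expR (2 * gam) - 1) =
      (expR (2 * gam) - 1) * (b - a * expR (- (2 * gam))).
      transitivity ((expR (2 * gam) - 1) * (b - a * expR (- (2 * gam))) +
        a * (expR (2 * gam) * expR (- (2 * gam)) - 1)); first by ring.
      by rewrite ggi subrr mulr0 addr0.
    rewrite mulr_ge0_le0 ?subr_ge0 // subr_le0.
    have bk : b * expR (2 * gam) <= a.
      rewrite gamE; have : b * (kap / 2) <= 1 * (kap / 2).
        rewrite ler_wpM2r //; last lra.
        by move: g1; rewrite gamE; lra.
      lra.
    have -> : b = b * expR (2 * gam) * expR (- (2 * gam)) by rewrite -mulrA ggi mulr1.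
    by rewrite ler_pM2r.
  case: sgE => ->.
    by rewrite !mulr1 => HF; apply: key => //; lra.
  rewrite !mulrN1 opprK => HF; rewrite addrC; apply: key => //; lra.
have le_far (x : R) : barrier_cost N gam sg l x <= E * expR (2 * gam) ->
   barrier_cost N gam sg l x <= expR (2 * gam) * expR (- (gam * N%:R * del)).
  move=> /le_trans; apply; rewrite mulrC ler_pM2l ?expR_gt0 // ler_expR lerN2.
  by rewrite ler_pM2l // ltW.
have sgb : expR (- (2 * gam * sg)) <= expR (2 * gam) /\ expR (2 * gam * sg) <= expR (2 * gam).
  by rewrite !ler_expR; case: sgE => ->; split; lra.
have ll := lsl _ _ _
  (le_far _ (le_trans vU (ler_wpM2l (ltW E0) sgb.1)))
  (le_far _ (le_trans vD (ler_wpM2l (ltW E0) sgb.2)))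
  (le_far _ (le_trans vM (_ : E <= E * expR (2 * gam)))).
apply: le_trans (ll _) _; first by rewrite ler_peMr // ltW.
have : 0 <= barrier_cost N gam sg l m by rewrite EV ltW.
lra.
Qed.

(** Two disjoint layers on which the drift points inwards; nothing is asked of the drift
    between them. *)
Definition well (l1 l2 r1 r2 : R) : Prop :=
  [/\ -1 < l1, l1 < l2, l2 < r1, r1 < r2 & r2 < 1] /\
  exists kap, [/\ 0 < kap, forall m, l1 <= m <= l2 -> kap <= drift m &
     forall m, r1 <= m <= r2 -> drift m <= - kap].

(** The grid of magnetizations meets every interval of length 2 / N. *)
Lemma config_near N (l r : R) : (0 < N)%N -> -1 < l -> r < 1 -> 2 / N%:R <= r - l ->
  exists x : cube N, l <= mbar R x <= r.
Proof.
move=> N_gt0 l1 r1 lr; have Ngt0 : 0 < N%:R :> R by rewrite ltr0n.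
have [k /andP[k1 k2]] : exists k : nat, N%:R * (1 + l) / 2 <= k%:R <= N%:R * (1 + l) / 2 + 1.
  by apply: nat_above; rewrite divr_ge0 ?mulr_ge0 // ltW //; lra.
have lr' : 2 <= (r - l) * N%:R by rewrite -ler_pdivrMr.
have kN : (k <= N)%N.
  rewrite -(ler_nat R); apply: le_trans k2 _.
  have : (1 - r) * N%:R >= 0 by rewrite mulr_ge0 // ?(ltW Ngt0) //; lra.
  lra.
pose x : cube N := [ffun i : 'I_N => (i < k)%N].
have lx : level x = k.
  rewrite /level; under eq_bigr do rewrite ffunE.
  rewrite -(big_mkord xpredT (fun i => (i < k)%N : nat)).
  rewrite (big_cat_nat (n := k)) //= [X in (X + _)%N](eq_big_nat _ _ (F2 := fun=> 1%N)); last first.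
    by move=> i /andP[_ ->].
  rewrite [X in (_ + X)%N](eq_big_nat _ _ (F2 := fun=> 0%N)); last first.
    by move=> i /andP[ki _]; rewrite ltnNge ki.
  by rewrite !sum_nat_const_nat muln1 muln0 addn0 subn0.
exists x; rewrite mbar_level // lx ler_pdivlMr // ler_pdivrMr //; apply/andP; split; lra.
Qed.

(** The sum of the two barrier costs dominates the indicator of the complement of the
    well, starts exponentially small, and increases by an exponentially small amount per
    step. *)
Lemma well_confines l1 l2 r1 r2 : well l1 l2 r1 r2 ->
  exists c K : R, exists N0 : nat, [/\ 0 < c, 0 < K & forall N, (N0 <= N)%N -> (0 < N)%N ->
    exists x0 : cube N, forall t,
      1 - K * (t%:R + 1) * expR (- (c * N%:R)) <=
      \sum_(y in [set y : cube N | (l1 < mbar R y) && (mbar R y < r2)]%SET) glauber_law p beta h x0 t y].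
Proof.
move=> [[l1b l12 lr r12 r2b] [kap [kap0 HL HR]]].
pose gam := ln (1 + kap / 2) / 2.
have k1 : 1 < 1 + kap / 2 by lra.
have gam0 : 0 < gam by rewrite divr_gt0 // ln_gt0.
have gamE : expR (2 * gam) = 1 + kap / 2.
  have -> : 2 * gam = ln (1 + kap / 2) by rewrite /gam; field.
  by rewrite lnK // posrE; lra.
pose del := Num.min (l2 - l1) (r2 - r1).
have del0 : 0 < del by rewrite lt_min !subr_gt0 l12 r12.
have delL : del <= l2 - l1 by rewrite ge_min lexx.
have delR : del <= r2 - r1 by rewrite ge_min lexx orbT.
have [N0 HN0] := eventually_ge (2 / (r1 - l2)).
have K0 : 0 < 2 * expR (2 * gam) by rewrite mulr_gt0 ?expR_gt0.
exists (gam * del), (2 * expR (2 * gam)), N0; split => //; first exact: mulr_gt0.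
move=> N NN N_gt0; have Ngt0 : 0 < N%:R :> R by rewrite ltr0n.
have [x0 /andP[x01 x02]] : exists x : cube N, l2 <= mbar R x <= r1.
  apply: config_near => //; [lra|lra|].
  have := HN0 N NN; rewrite ler_pdivrMr ?subr_gt0 // mulrC => H.
  by rewrite ler_pdivrMr.
exists x0 => t.
pose st := @step R p beta h N.
pose a : R := expR (2 * gam) * expR (- (gam * N%:R * del)).
have a0 : 0 < a by rewrite mulr_gt0 ?expR_gt0.
pose phi (y : cube N) := barrier_cost N gam 1 l1 (mbar R y) + barrier_cost N gam (-1) r2 (mbar R y).
have phiD y : st phi y <= phi y + 2 * a.
  rewrite /st /phi stepD !(step_mbar _ _ _ N_gt0).
  have mb := mbar_bound R N_gt0 y.
  have HL' : forall m, -1 <= m <= 1 -> 0 <= 1 * (m - l1) <= del -> kap <= 1 * drift m.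
    by move=> m _; rewrite !mul1r => H; apply: HL; lra.
  have HR' : forall m, -1 <= m <= 1 -> 0 <= -1 * (m - r2) <= del -> kap <= -1 * drift m.
    by move=> m _ H; have := HR m; rewrite !mulN1r lerNr; apply; lra.
  have A1 := lstep_barrier N_gt0 gam0 gamE (or_introl erefl) mb HL'.
  have A2 := lstep_barrier N_gt0 gam0 gamE (or_intror erefl) mb HR'.
  by rewrite -/a in A1 A2; lra.
have phit : iter t st phi x0 <= phi x0 + t%:R * (2 * a).
  by apply: iter_step_add => //; rewrite mulr_ge0 // ltW.
have gN : 0 < gam * N%:R by rewrite mulr_gt0.
have e1 : 1 <= expR (2 * gam) by rewrite gamE ltW.
have phi0 : phi x0 <= 2 * a.
  have le1 (z : R) : del <= z -> Num.min 1 (expR (- (gam * N%:R * z))) <= a.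
    move=> dz; rewrite ge_min; apply/orP; right.
    apply: (@le_trans _ _ (expR (- (gam * N%:R * del)))).
      by rewrite ler_expR lerN2 ler_pM2l.
    by rewrite /a ler_peMl // expR_ge0.
  have P1 := le1 (1 * (mbar R x0 - l1)); have P2 := le1 (-1 * (mbar R x0 - r2)).
  rewrite /phi /barrier_cost; have := P1 _; have := P2 _; lra.
set A := [set y | _]%SET.
have tot : \sum_(y : cube N) glauber_law p beta h x0 t y = 1.
  have -> : \sum_(y : cube N) glauber_law p beta h x0 t y = iter t st (fun=> 1) x0.
    by rewrite -glauber_law_step //; apply: eq_bigr => y _; rewrite mulr1.
  have := iter_step_bound p beta h N_gt0 t (a := 1) (b := 1) (f := fun=> 1) (fun=> introT andP (conj (lexx 1) (lexx 1))) x0.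
  by move=> /andP[b1 b2]; apply/le_anti; rewrite b1 b2.
rewrite (bigID (mem A)) /= in tot.
have out : \sum_(y | y \notin A) glauber_law p beta h x0 t y <= iter t st phi x0.
  have -> : \sum_(y | y \notin A) glauber_law p beta h x0 t y = \sum_(y in ~: A) glauber_law p beta h x0 t y.
    by apply: eq_bigl => y; rewrite finset.in_setC.
  rewrite law_indic //; apply: le_iter_step => // y.
  have b0 sg l : 0 <= barrier_cost N gam sg l (mbar R y).
    by rewrite /barrier_cost le_min ler01 expR_ge0.
  rewrite /set_ind !inE negb_and -!leNgt /phi.
  have sat sg l : sg * (mbar R y - l) <= 0 -> barrier_cost N gam sg l (mbar R y) = 1.
    move=> H; rewrite /barrier_cost; apply/min_idPl; rewrite expR_ge1 oppr_ge0.
    by rewrite (pmulr_rle0 _ gN).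
  have [y1|y1] := leP (mbar R y) l1.
    by rewrite ?y1 /= sat ?lerDl // mul1r subr_le0.
  have [y2|y2] := leP r2 (mbar R y).
    by rewrite ?y2 ?orbT [X in _ <= _ + X]sat ?lerDr // mulN1r opprB subr_le0.
  by rewrite /= addr_ge0.
have E : 2 * expR (2 * gam) * (t%:R + 1) * expR (- (gam * del * N%:R)) = 2 * a + t%:R * (2 * a).
  rewrite /a; have -> : gam * del * N%:R = gam * N%:R * del by ring.
  ring.
rewrite E; lra.
Qed.

(** One of two disjoint wells has Gibbs mass at most 1/2, while the chain started in it
    stays there with probability close to 1 for an exponential time. *)
Lemma metastable_lower l1 l2 r1 r2 l1' l2' r1' r2' eps :
  well l1 l2 r1 r2 -> well l1' l2' r1' r2' -> r2 <= l1' -> eps < 2^-1 ->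
  ge_exp_Omega (tmix p beta h eps).
Proof.
move=> W1 W2 disj eps1.
have [c [K [N0 [c0 K0 H1]]]] := well_confines W1.
have [c' [K' [N0' [c0' K0' H2]]]] := well_confines W2.
pose cc := Num.min c c'; pose KK := K + K'.
have cc0 : 0 < cc by rewrite lt_min c0 c0'.
have KK0 : 0 < KK by rewrite addr_gt0.
have ccc : cc <= c by rewrite ge_min lexx.
have ccc' : cc <= c' by rewrite ge_min lexx orbT.
exists (cc / 2); split; first by rewrite divr_gt0.
have e0 : 0 < 2^-1 - eps by lra.
have [N1 HN1] := eventually_ge (4 * KK / (2^-1 - eps) / cc + 1).
exists (maxn (maxn N0 N0') (maxn N1 1)) => // N /=.
rewrite !geq_max => /andP[/andP[n0 n0'] /andP[n1 N_gt0]].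
have Ngt0 : 0 < N%:R :> R by rewrite ltr0n.
apply: tmix_ge => t tlt.
set A1 := [set y : cube N | (l1 < mbar R y) && (mbar R y < r2)]%SET.
set A2 := [set y : cube N | (l1' < mbar R y) && (mbar R y < r2')]%SET.
have [x1 X1] := H1 N n0 N_gt0; have [x2 X2] := H2 N n0' N_gt0.
have small (K1 c1 : R) : 0 < K1 -> K1 <= KK -> cc <= c1 ->
    K1 * (t%:R + 1) * expR (- (c1 * N%:R)) < 2^-1 - eps.
  move=> K10 K1K c1c.
  have z0 : 0 <= cc / 2 * N%:R by rewrite mulr_ge0 ?divr_ge0 // ltW.
  have E1 : expR (- (c1 * N%:R)) <= expR (- (cc / 2 * N%:R)) * expR (- (cc / 2 * N%:R)).
    rewrite -expRD ler_expR; have := ler_wpM2r (ltW Ngt0) c1c; lra.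
  have t1 : t%:R + 1 <= 2 * expR (cc / 2 * N%:R).
    have := expR_ge1Dx (cc / 2 * N%:R); move: tlt; lra.
  have E2 : expR (cc / 2 * N%:R) * expR (- (cc / 2 * N%:R)) = 1 by rewrite -expRD subrr expR0.
  have Y0 : 0 < expR (- (cc / 2 * N%:R)) by rewrite expR_gt0.
  have E3 : 4 * KK * expR (- (cc / 2 * N%:R)) < 2 * (2^-1 - eps).
    have H : 4 * KK < 2 * (2^-1 - eps) * expR (cc / 2 * N%:R).
      apply: lt_le_trans (_ : 2 * (2^-1 - eps) * (1 + cc / 2 * N%:R) <= _).
        have := HN1 N n1; rewrite -lerBrDr ler_pdivrMr // ler_pdivrMr // => H.
        have := mulr_gt0 e0 cc0; lra.
      by rewrite ler_pM2l ?expR_ge1Dx // mulr_gt0.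
    have := H; rewrite -(ltr_pM2r Y0) -[X in _ < X]mulrA E2 mulr1; exact.
  apply: (@le_lt_trans _ _ (KK * (2 * expR (cc / 2 * N%:R)) * (expR (- (cc / 2 * N%:R)) * expR (- (cc / 2 * N%:R))))).
    have t0 : 0 <= t%:R + 1 :> R by rewrite addr_ge0.
    apply: (ler_pM _ (expR_ge0 _) _ E1); first by rewrite mulr_ge0 // ltW.
    exact: (ler_pM (ltW K10) t0 K1K t1).
  have -> : KK * (2 * expR (cc / 2 * N%:R)) * (expR (- (cc / 2 * N%:R)) * expR (- (cc / 2 * N%:R))) =
    2 * KK * expR (- (cc / 2 * N%:R)) * (expR (cc / 2 * N%:R) * expR (- (cc / 2 * N%:R))) by ring.
  by rewrite E2; lra.
have tot : \sum_(y in A1) gibbs p beta h y + \sum_(y in A2) gibbs p beta h y <= 1 :> R.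
  rewrite -(sum_gibbs h p_gt0 beta_ge0 N_gt0).
  rewrite [leRHS](bigID (mem A1)) /= lerD2l.
  rewrite [leRHS](bigID (mem A2)) /= ler_wpDr //.
    by apply: sumr_ge0 => y _; rewrite ltW // gibbs_gt0.
  rewrite le_eqVlt; apply/orP; left; apply/eqP; apply: eq_bigl => y.
  rewrite !inE; case: (boolP (_ < mbar R y < r2')) => H; rewrite ?andbF // andbT.
  symmetry; apply/negP => H'; move: H H' => /andP[Q1 _] /andP[_ Q2].
  by have := lt_trans (le_lt_trans disj Q1) Q2; rewrite ltxx.
have [G1|G1] := leP (\sum_(y in A1) gibbs p beta h y) (2^-1 : R).
  apply: lt_le_trans (worst_tv_ge p beta h t x1 A1).
  apply: lt_le_trans (ler_norm _).
  have := small K c K0 _ ccc; have := X1 t; rewrite -/A1 /KK lerDl (ltW K0'); lra.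
apply: lt_le_trans (worst_tv_ge p beta h t x2 A2).
apply: lt_le_trans (ler_norm _).
have := small K' c' K0' _ ccc'; have := X2 t; rewrite -/A2 /KK lerDr (ltW K0); lra.
Qed.
End Metastable.

(** * The slope of the drift *)

Section Calculus.
Local Open Scope classical_set_scope.
Variable R : realType.
Implicit Types (f df : R -> R) (a b : R).

Lemma within_continuous_is_derive f df a b :
  (forall x, a <= x <= b -> is_derive x 1 f (df x)) -> {within `[a, b], continuous f}.
Proof.
move=> D; apply: derivable_within_continuous => x.
by rewrite in_itv /= => /D [].
Qed.

Lemma mean_value f df a b : a < b ->
  (forall x, a <= x <= b -> is_derive x 1 f (df x)) ->
  exists c : R, a < c < b /\ f b - f a = df c * (b - a).
Proof.
move=> ab D; have [|c] := @MVT R f df a b ab _ (within_continuous_is_derive D).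
  by move=> x; rewrite in_itv /= => /andP[ax xb]; apply: D; rewrite !ltW.
by rewrite in_itv /= => cab E; exists c.
Qed.

End Calculus.

Section Drift.
Variables (R : realType) (p : nat) (beta h : R).
Hypotheses (hp : (3 <= p)%N) (beta_gt0 : 0 < beta).
Local Notation drift := (drift p beta h).
Local Notation fld := (field_at p beta h).

Definition field_slope (x : R) : R := p%:R * p.-1%:R * beta * x ^+ p.-2.
(** (1 - x^2) times the second derivative of H; it is a polynomial. *)
Definition curvature (x : R) : R := field_slope x * (1 - x ^+ 2) - 1.
(** The derivative of the drift, written so that it is the curvature up to a multiple of
    the drift itself. *)
Definition drift_slope (x : R) : R :=
  curvature x - (2 * x + drift x) * drift x * field_slope x.

Lemma is_derive_field (x : R) : is_derive x 1 fld (field_slope x).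
Proof.
rewrite (_ : fld = (p%:R * beta) *: (id ^+ p.-1) + cst h); last first.
  apply/funext => y.
  by rewrite /field_at -[RHS]/((p%:R * beta) * ((id ^+ p.-1) y) + h) exprfctE.
apply: is_derive_eq; rewrite /field_slope addr0 /= -[_ *: 1]/(_ * 1) mulr1.
by rewrite -[LHS]/(_ * _); ring.
Qed.

Lemma is_derive_tanh (u : R) : is_derive u 1 (@tanh R) (1 - tanh u ^+ 2).
Proof.
have d0 := tanh_den_gt0 u.
have dn : is_derive u 1 (fun u : R => expR (- u)) (- expR (- u)).
  have := @is_derive1_comp R expR -%R u _ _ (is_derive_expR (- u)) (is_deriveNid u 1).
  by move/is_derive_eq; apply; rewrite mulrN1.
have dd : is_derive u 1 (expR + (fun u : R => expR (- u))) (expR u - expR (- u)).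
  by apply: is_derive_eq.
have dv := @is_deriveV R (expR + (fun u : R => expR (- u))) u _ 1 (lt0r_neq0 d0) dd.
rewrite (_ : @tanh R = (expR - (fun u => expR (- u))) *
  (fun y => ((expR + (fun u : R => expR (- u))) y)^-1)) //.
apply: is_derive_eq.
rewrite -![_ *: _]/(_ * _) -[(expR - _) u]/(expR u - expR (- u)) -[(expR + _) u]/(expR u + expR (- u)) /tanh.
rewrite -[X in 1 - X ^+ 2]/((expR u - expR (- u)) / (expR u + expR (- u))).
by field; apply: lt0r_neq0.
Qed.

Lemma is_derive_drift (x : R) : is_derive x 1 drift (drift_slope x).
Proof.
have D := @is_derive1_comp R (@tanh R) fld x _ _ (is_derive_tanh _) (is_derive_field x).
rewrite (_ : drift = (@tanh R \o fld) - id) //.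
apply: is_derive_eq; rewrite /drift_slope /curvature /drift /cond_mean; ring.
Qed.

Lemma curvature_at0 : curvature 0 = -1.
Proof.
rewrite /curvature /field_slope expr0n.
by case: p hp => [|[|[|q]]] //= _; rewrite mulr0 mul0r sub0r.
Qed.

Let L := p%:R ^+ 2 * beta + 1.

Lemma field_slope_bound x : -1 <= x <= 1 -> `|field_slope x| <= p%:R ^+ 2 * beta.
Proof.
move=> xb; have x1 : `|x| <= 1 by rewrite ler_norml.
rewrite /field_slope !normrM !normr_nat normrX (gtr0_norm beta_gt0).
have e1 : `|x| ^+ p.-2 <= 1 by rewrite exprn_ile1.
have e0 : 0 <= `|x| ^+ p.-2 by rewrite exprn_ge0.
apply: (@le_trans _ _ (p%:R * p.-1%:R * beta * 1)).
  by rewrite ler_wpM2l // !mulr_ge0 // ltW.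
by rewrite mulr1 expr2 ler_wpM2r ?(ltW beta_gt0) // ler_wpM2l // ler_nat leq_pred.
Qed.

Lemma drift_slopeE x : drift_slope x = (1 - cond_mean p beta h x ^+ 2) * field_slope x - 1.
Proof. by rewrite /drift_slope /curvature /drift; ring. Qed.

Lemma drift_slope_bound x : -1 <= x <= 1 -> `|drift_slope x| <= L.
Proof.
move=> xb; rewrite drift_slopeE; apply: le_trans (ler_normB _ _) _.
rewrite normr1 lerD2r normrM; have := field_slope_bound xb.
have /andP[t1 t2] := tanh_bound (fld x); rewrite -/(cond_mean p beta h x) in t1 t2.
set t := cond_mean _ _ _ _ in t1 t2 *.
have : `|1 - t ^+ 2| <= 1 by rewrite ler_norml; apply/andP; split; nra.
have := normr_ge0 (1 - t ^+ 2); have := normr_ge0 (field_slope x); nra.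
Qed.

Lemma drift_bound x : -1 <= x <= 1 -> `|drift x| <= 2.
Proof.
move=> /andP[x1 x2]; have := tanh_bound (fld x); rewrite -/(cond_mean p beta h x) => /andP[t1 t2].
by rewrite ler_norml /drift; apply/andP; split; lra.
Qed.

Lemma drift_lipschitz a b : -1 <= a <= 1 -> -1 <= b <= 1 ->
  `|drift b - drift a| <= L * `|b - a|.
Proof.
wlog ab : a b / a <= b => [W a1 b1|].
  have [ab|/ltW ab] := leP a b; first exact: W.
  by rewrite distrC [`|b - a|]distrC; apply: W.
move: ab; rewrite le_eqVlt => /orP[/eqP -> _ _|ab a1 b1]; first by rewrite !subrr !normr0 mulr0.
have [c [/andP[c1 c2] ->]] := mean_value ab (fun x _ => is_derive_drift x).
rewrite normrM ler_wpM2r // drift_slope_bound //; apply/andP; split; lra.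
Qed.

End Drift.

(** * The landscape H and its local maximizers *)

Section Landscape.
Variables (R : realType) (p : nat) (beta h : R).
Hypotheses (hp : (3 <= p)%N) (beta_gt0 : 0 < beta).
Local Notation drift := (drift p beta h).
Local Notation fld := (field_at p beta h).
Local Notation H := (Hfun p beta h).
Local Notation curvature := (curvature p beta).
Local Notation slope := (field_slope p beta).

(** The derivative of H in the open interval. *)
Definition Hslope (x : R) : R := fld x - (ln (1 + x) - ln (1 - x)) / 2.

(** The drift tanh g - x and the slope g - artanh x of H have the same sign, since tanh is
    increasing. *)
Lemma drift_Hslope x : -1 < x < 1 ->
  (0 < drift x) = (0 < Hslope x) /\ (drift x < 0) = (Hslope x < 0).
Proof.
move=> /andP[x1 x2]; have d0 := tanh_den_gt0 (fld x).
have l1 : 0 < 1 - x by lra.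
have l2 : 0 < 1 + x by lra.
have E : (expR (fld x) + expR (- fld x)) * drift x =
  expR (fld x + ln (1 - x)) - expR (- fld x + ln (1 + x)).
  rewrite (expRD (fld x)) (expRD (- fld x)) !lnK ?posrE // /drift /cond_mean /tanh.
  by field; exact: lt0r_neq0.
rewrite -(pmulr_rgt0 _ d0) -(pmulr_rlt0 _ d0) E subr_gt0 subr_lt0 !ltr_expR /Hslope.
by split; apply/idP/idP; lra.
Qed.

Lemma is_derive_ln1D (x : R) : -1 < x -> is_derive x 1 (fun y => ln (1 + y)) (1 + x)^-1.
Proof.
move=> x1; have l2 : 0 < 1 + x by lra.
have D : is_derive x 1 (cst 1 + id : R -> R) 1 by apply: is_derive_eq; rewrite add0r.
have := @is_derive1_comp R (@ln R) (cst 1 + id) x _ _ (is_derive1_ln l2) D.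
by rewrite mulr1.
Qed.

Lemma is_derive_ln1B (x : R) : x < 1 -> is_derive x 1 (fun y => ln (1 - y)) (- (1 - x)^-1).
Proof.
move=> x1; have l2 : 0 < 1 - x by lra.
have D : is_derive x 1 (cst 1 - id : R -> R) (-1) by apply: is_derive_eq; rewrite sub0r.
have := @is_derive1_comp R (@ln R) (cst 1 - id) x _ _ (is_derive1_ln l2) D.
by rewrite mulrN1.
Qed.

Lemma is_derive_H (x : R) : -1 < x < 1 -> is_derive x 1 H (Hslope x).
Proof.
move=> /andP[x1 x2].
have l1 : 1 - x != 0 by rewrite lt0r_neq0 //; lra.
have l2 : 1 + x != 0 by rewrite lt0r_neq0 //; lra.
have Da := is_derive_ln1D x1; have Db := is_derive_ln1B x2.
have D1 : is_derive x 1 (cst 1 + id : R -> R) 1 by apply: is_derive_eq; rewrite add0r.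
have D2 : is_derive x 1 (cst 1 - id : R -> R) (-1) by apply: is_derive_eq; rewrite sub0r.
rewrite (_ : H = (beta *: (id ^+ p) + h *: id) -
   2^-1 *: ((cst 1 + id) * (fun y => ln (1 + y)) + (cst 1 - id) * (fun y => ln (1 - y)))); last first.
  apply/funext => y; rewrite /Hfun /entropyI.
  rewrite -[RHS]/((beta * ((id ^+ p) y) + h * y) - 2^-1 * ((1 + y) * ln (1 + y) + (1 - y) * ln (1 - y))).
  by rewrite exprfctE.
have Dg : is_derive x 1 (beta *: (id ^+ p) + h *: id : R -> R) (fld x).
  apply: (is_derive_eq (is_deriveD (is_deriveZ beta (is_deriveX p (is_derive_id x 1)))
    (is_deriveZ h (is_derive_id x 1)))).
  by rewrite -![_ *: _]/(_ * _) /field_at; ring.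
have De : is_derive x 1 ((cst 1 + id) * (fun y => ln (1 + y)) : R -> R) (ln (1 + x) + 1).
  apply: (is_derive_eq (is_deriveM D1 Da)).
  by rewrite -![_ *: _]/(_ * _) -[(cst 1 + id) x]/(1 + x); field; rewrite l2.
have De' : is_derive x 1 ((cst 1 - id) * (fun y => ln (1 - y)) : R -> R) (- ln (1 - x) - 1).
  apply: (is_derive_eq (is_deriveM D2 Db)).
  by rewrite -![_ *: _]/(_ * _) -[(cst 1 - id) x]/(1 - x); field; rewrite l1.
apply: (is_derive_eq (is_deriveB Dg (is_deriveZ 2^-1 (is_deriveD De De')))).
by rewrite -![_ *: _]/(_ * _) /Hslope; field.
Qed.

Lemma is_derive_Hslope (x : R) : -1 < x < 1 ->
  is_derive x 1 Hslope (curvature x / (1 - x ^+ 2)).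
Proof.
move=> /andP[x1 x2].
have l1 : 1 - x != 0 by rewrite lt0r_neq0 //; lra.
have l2 : 1 + x != 0 by rewrite lt0r_neq0 //; lra.
have Da := is_derive_ln1D x1; have Db := is_derive_ln1B x2.
have Df := is_derive_field p beta h x.
rewrite (_ : Hslope = fld - 2^-1 *: ((fun y => ln (1 + y)) - (fun y => ln (1 - y)))); last first.
  by apply/funext => y; rewrite /Hslope mulrC.
apply: is_derive_eq; rewrite /curvature -![_ *: _]/(_ * _).
have -> : 1 - x ^+ 2 = (1 - x) * (1 + x) by ring.
by field; rewrite l1 l2.
Qed.

Lemma derive_H x : -1 < x < 1 -> H^`()%classic x = Hslope x.
Proof. by move=> xb; rewrite derive1E; have [_ ->] := is_derive_H xb. Qed.

Lemma derive2_H x : -1 < x < 1 -> (H^`(2))%classic x = curvature x / (1 - x ^+ 2).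
Proof.
move=> xb; rewrite derive1nS derive1n1 derive1E.
have [_ <-] := is_derive_Hslope xb; apply: near_eq_derive.
near=> y; apply: derive_H.
have : y \in `]-1, 1[%R; last by rewrite in_itv.
near: y; exact: near_in_itvoo.
Unshelve. all: by end_near. Qed.

Lemma local_maximizer_ball m : local_maximizer p beta h m ->
  exists2 d, 0 < d & forall y, -1 <= y <= 1 -> `|m - y| < d -> H y <= H m.
Proof.
move=> [_ /nbhs_ballP[d /= d0 D]]; exists d => // y yb my.
by apply: D.
Qed.

Lemma energy_lipschitz a b : -1 <= a <= 1 -> -1 <= b <= 1 ->
  (H a + entropyI a) - (H b + entropyI b) <= (p%:R * beta + `|h|) * `|a - b|.
Proof.
move=> ab bb; have a1 : `|a| <= 1 by rewrite ler_norml.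
have b1 : `|b| <= 1 by rewrite ler_norml.
have -> : (H a + entropyI a) - (H b + entropyI b) = beta * (a ^+ p - b ^+ p) + h * (a - b).
  by rewrite /Hfun; ring.
apply: le_trans (ler_norm _) _; apply: le_trans (ler_normD _ _) _.
rewrite !normrM (gtr0_norm beta_gt0) mulrDl; apply: lerD => //.
rewrite [p%:R * _]mulrC -mulrA ler_pM2l //; exact: powers_lipschitz.
Qed.

(** The entropy has infinite slope at the ends of [-1, 1]. *)
Lemma entropy_edge u : 0 < u < 1 ->
  entropyI 1 - entropyI (1 - u) >= - (u * ln u / 2) :> R.
Proof.
move=> /andP[u0 u1]; rewrite /entropyI subrr mul0r addr0.
have -> : 1 - (1 - u) = u by ring.
have -> : 1 + (1 - u) = 2 - u by ring.
have -> : 1 + 1 = 2 :> R by ring.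
have l1 : ln (2 - u) <= ln 2 by rewrite ler_ln ?posrE; lra.
have l0 : 0 <= ln (2 - u) by apply: ln_ge0; lra.
have : (2 - u) * ln (2 - u) <= 2 * ln 2 by apply: ler_pM => //; lra.
lra.
Qed.

Lemma entropyN (x : R) : entropyI (- x) = entropyI x.
Proof. by rewrite /entropyI opprK addrC. Qed.

(** Near an end of the interval the gain of entropy of order u ln u beats the energy, which
    is Lipschitz. By symmetry of the entropy both ends are treated at once. *)
Lemma local_maximizer_interior m : local_maximizer p beta h m -> -1 < m < 1.
Proof.
move=> Hm; have [d d0 D] := local_maximizer_ball Hm.
case: Hm => /andP[m1 m2] _.
pose C := p%:R * beta + `|h|.
pose u := Num.min (d / 2) (Num.min 2^-1 (expR (- (2 * C + 1)))).
have u0 : 0 < u by rewrite !lt_min expR_gt0 divr_gt0 // invr_gt0 ltr0n.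
have ud : u < d by apply: le_lt_trans (_ : u <= d / 2) _; [rewrite ge_min lexx|lra].
have u1 : u < 1 by apply: le_lt_trans (_ : u <= 2^-1) _; [rewrite !ge_min lexx orbT|lra].
have lu : ln u <= - (2 * C + 1).
  rewrite -[leRHS]expRK ler_ln ?posrE ?expR_gt0 //.
  by rewrite /u !ge_min lexx !orbT.
have key s : s = 1 \/ s = -1 -> m = s -> False.
  move=> sE ms; pose y := s * (1 - u).
  have yb : -1 <= y <= 1 by rewrite /y; case: sE => ->; apply/andP; split; lra.
  have myE : m - y = s * u by rewrite ms /y; ring.
  have my : `|m - y| = u.
    by rewrite myE normrM (gtr0_norm u0); case: sE => ->; rewrite ?normrN normr1 mul1r.
  have HH : H y <= H m by apply: D => //; rewrite my.
  have mb : -1 <= m <= 1 by rewrite m1 m2.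
  have L := energy_lipschitz mb yb; rewrite my -/C in L.
  have u01 : 0 < u < 1 by rewrite u0 u1.
  have Ee := entropy_edge u01.
  have EI : entropyI m - entropyI y = entropyI 1 - entropyI (1 - u).
    by rewrite ms /y; case: sE => ->; rewrite ?mul1r // !mulN1r !entropyN.
  have ulu : u * ln u <= u * (- (2 * C + 1)) by rewrite ler_pM2l.
  by move: EI Ee L HH ulu; lra.
rewrite !lt_neqAle m1 m2 !andbT; apply/andP; split; apply/eqP => E.
  by apply: (key (-1)); [right|rewrite -E].
by apply: (key 1); [left|].
Qed.
End Landscape.

(** * Barriers around local maximizers *)

(** Picking roots one after the other to the right of the previous ones gives more roots
    than the degree allows. *)
Lemma dense_roots (R : realType) (q : {poly R}) (a b : R) : a < b ->
  (forall y1 y2, a <= y1 -> y1 < y2 -> y2 <= b -> exists z, y1 < z < y2 /\ root q z) ->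
  q = 0.
Proof.
move=> ab dense; apply/eqP; apply: contraT => q0.
have gen n : exists rs : seq R, exists c, [/\ size rs = n, uniq rs, all (root q) rs,
    a <= c < b & all (fun r => r <= c) rs].
  elim: n => [|n [rs [c [szn un rt /andP[ac cb] lec]]]].
    by exists [::], a; split; rewrite // lexx ab.
  have [z [/andP[cz zb] qz]] := dense c b ac cb (lexx b).
  exists (z :: rs), z; split => /=.
  - by rewrite szn.
  - rewrite un andbT; apply/negP => /(allP lec); rewrite leNgt cz; exact/negP.
  - by rewrite qz rt.
  - by rewrite zb (le_trans ac (ltW cz)).
  - rewrite lexx /=; apply/allP => r /(allP lec) rc; exact: le_trans rc (ltW cz).
have [rs [c [szn un rt _ _]]] := gen (size q).
by have := max_poly_roots q0 rt un; rewrite szn ltnn.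
Qed.

Section Barriers.
Variables (R : realType) (p : nat) (beta h : R).
Hypotheses (hp : (3 <= p)%N) (beta_gt0 : 0 < beta).
Local Notation drift := (drift p beta h).
Local Notation H := (Hfun p beta h).
Local Notation Hslope := (Hslope p beta h).
Local Notation curvature := (curvature p beta).
Let L := p%:R ^+ 2 * beta + 1.

Definition curv_poly : {poly R} :=
  (p%:R * p.-1%:R * beta)%:P * 'X^(p.-2) * (1 - 'X^2) - 1.

Lemma horner_curv x : curv_poly.[x] = curvature x.
Proof. by rewrite /curv_poly /curvature /field_slope !hornerE. Qed.

Lemma curv_poly_neq0 : curv_poly != 0.
Proof.
apply/eqP => E; have := horner_curv 0; rewrite E horner0 curvature_at0 // => /eqP.
by rewrite eq_sym oppr_eq0 oner_eq0.
Qed.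

(** If H were constant on an interval, Rolle's theorem applied twice would give a zero of
    the curvature polynomial in every subinterval. *)
Lemma H_not_flat (a b k : R) : -1 < a -> a < b -> b < 1 ->
  ~ (forall y, a <= y <= b -> H y = k).
Proof.
move=> a1 ab b1 flat; move: curv_poly_neq0; apply/negP; rewrite negbK; apply/eqP.
have crit y1 y2 : a <= y1 -> y1 < y2 -> y2 <= b -> exists c : R, y1 < c < y2 /\ Hslope c = 0.
  move=> ay yy yb; have [|c [cb E]] := @mean_value R H Hslope y1 y2 yy.
    by move=> x xb; apply: is_derive_H; lra.
  exists c; split => //; move: E; rewrite !flat ?subrr; [|lra|lra].
  by move=> /esym/eqP; rewrite mulf_eq0 (subr_eq0 y2) (gt_eqF yy) orbF => /eqP.
apply: (@dense_roots _ curv_poly a b ab) => y1 y2 ay yy yb.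
pose mid := (y1 + y2) / 2.
have [c1 [/andP[c11 c12] E1]] : exists c : R, y1 < c < mid /\ Hslope c = 0.
  by apply: crit; rewrite /mid; lra.
have [c2 [/andP[c21 c22] E2]] : exists c : R, mid < c < y2 /\ Hslope c = 0.
  by apply: crit; rewrite /mid; lra.
have cc : c1 < c2 by apply: lt_trans c12 c21.
have [|z [/andP[z1 z2] E]] := @mean_value R Hslope (fun x => curvature x / (1 - x ^+ 2)) c1 c2 cc.
  by move=> x xb; apply: is_derive_Hslope; lra.
exists z; split; first by rewrite (lt_trans c11 z1) (lt_trans z2 c22).
have zn : 1 - z ^+ 2 != 0.
  rewrite (_ : 1 - z ^+ 2 = (1 - z) * (1 + z)); last by ring.
  by rewrite mulf_neq0 // lt0r_neq0 //; lra.
move: E; rewrite E1 E2 subrr => /esym/eqP.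
rewrite mulf_eq0 (subr_eq0 c2) (gt_eqF cc) orbF mulf_eq0 invr_eq0 (negPf zn) orbF => /eqP Ez.
by apply/rootP; rewrite horner_curv.
Qed.

(** If the drift were nonpositive just left of a local maximizer, H would be nonincreasing
    there, hence constant by maximality. *)
Lemma barrier_left m d : local_maximizer p beta h m -> 0 < d ->
  exists a, [/\ -1 < a, m - d < a, a < m & 0 < drift a].
Proof.
move=> Hm d0; have /andP[m1 m2] := local_maximizer_interior beta_gt0 Hm.
have [e e0 D] := local_maximizer_ball Hm.
pose r := Num.min d (Num.min e (m + 1)).
have r0 : 0 < r by rewrite !lt_min d0 e0 /=; lra.
have rd : r <= d by rewrite ge_min lexx.
have re : r <= e by rewrite !ge_min lexx orbT.
have rm : r <= m + 1 by rewrite !ge_min lexx !orbT.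
apply: contrapT => no.
have Hle y : m - r < y -> y < m -> H y = H m.
  move=> y1 y2; apply/eqP; rewrite eq_le; apply/andP; split.
    by apply: D; [apply/andP; split; lra|rewrite ltr_norml; apply/andP; split; lra].
  have [|c [/andP[c1 c2] E]] := @mean_value R H Hslope y m y2.
    by move=> x xb; apply: is_derive_H; lra.
  have cb : -1 < c < 1 by apply/andP; split; lra.
  have [S1 _] := drift_Hslope p beta h cb.
  have c0 : Hslope c <= 0.
    rewrite leNgt -S1; apply/negP => cd; apply: no; exists c; split => //; lra.
  rewrite -subr_le0 E mulr_le0_ge0 //; lra.
apply: (@H_not_flat (m - r / 2) (m - r / 4) (H m)); [lra|lra|lra|].
by move=> y yb; apply: Hle; lra.
Qed.

Lemma barrier_right m d : local_maximizer p beta h m -> 0 < d ->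
  exists b, [/\ b < 1, m < b, b < m + d & drift b < 0].
Proof.
move=> Hm d0; have /andP[m1 m2] := local_maximizer_interior beta_gt0 Hm.
have [e e0 D] := local_maximizer_ball Hm.
pose r := Num.min d (Num.min e (1 - m)).
have r0 : 0 < r by rewrite !lt_min d0 e0 /=; lra.
have rd : r <= d by rewrite ge_min lexx.
have re : r <= e by rewrite !ge_min lexx orbT.
have rm : r <= 1 - m by rewrite !ge_min lexx !orbT.
apply: contrapT => no.
have Hle y : m < y -> y < m + r -> H y = H m.
  move=> y1 y2; apply/eqP; rewrite eq_le; apply/andP; split.
    by apply: D; [apply/andP; split; lra|rewrite ltr_norml; apply/andP; split; lra].
  have [|c [/andP[c1 c2] E]] := @mean_value R H Hslope m y y1.
    by move=> x xb; apply: is_derive_H; lra.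
  have cb : -1 < c < 1 by apply/andP; split; lra.
  have [_ S1] := drift_Hslope p beta h cb.
  have c0 : 0 <= Hslope c.
    rewrite leNgt -S1; apply/negP => cd; apply: no; exists c; split => //; lra.
  rewrite -subr_ge0 E mulr_ge0 //; lra.
apply: (@H_not_flat (m + r / 4) (m + r / 2) (H m)); [lra|lra|lra|].
by move=> y yb; apply: Hle; lra.
Qed.

Let L_gt0 : 0 < L.
Proof. by rewrite ltr_wpDl // mulr_ge0 ?exprn_ge0 // ltW. Qed.

(** The drift takes positive values arbitrarily close on the left and negative values
    arbitrarily close on the right. *)
Lemma drift_at_maximizer m : local_maximizer p beta h m -> drift m = 0.
Proof.
move=> Hm; have /andP[m1 m2] := local_maximizer_interior beta_gt0 Hm.
have mb : -1 <= m <= 1 by rewrite !ltW.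
apply/eqP; rewrite eq_le; apply/andP; split; rewrite leNgt; apply/negP => dm.
  have d0 : 0 < drift m / L by rewrite divr_gt0.
  have [b [b1 b2 b3 bd]] := barrier_right Hm d0.
  have bb : -1 <= b <= 1 by apply/andP; split; lra.
  have := drift_lipschitz p h beta_gt0 mb bb; rewrite -/L ler_norml => /andP[X _].
  have bm : `|b - m| < drift m / L by rewrite ger0_norm; lra.
  have : L * `|b - m| < drift m by rewrite mulrC -ltr_pdivlMr.
  lra.
have d0 : 0 < - drift m / L by rewrite divr_gt0 // oppr_gt0.
have [a [a1 a2 a3 ad]] := barrier_left Hm d0.
have ab : -1 <= a <= 1 by apply/andP; split; lra.
have := drift_lipschitz p h beta_gt0 mb ab; rewrite -/L ler_norml => /andP[_ X].
have am : `|a - m| < - drift m / L by rewrite ltr0_norm; lra.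
have : L * `|a - m| < - drift m by rewrite mulrC -ltr_pdivlMr.
lra.
Qed.

(** A sign of the drift at one point extends to a small layer by the Lipschitz bound. *)
Lemma maximizer_well m d : local_maximizer p beta h m -> 0 < d ->
  exists l1 l2 r1 r2, [/\ well p beta h l1 l2 r1 r2, m - d < l1 & r2 < m + d].
Proof.
move=> Hm d0; have /andP[m1 m2] := local_maximizer_interior beta_gt0 Hm.
have [a [a1 a2 a3 ad]] := barrier_left Hm d0.
have [b [b1 b2 b3 bd]] := barrier_right Hm d0.
have ab : -1 <= a <= 1 by apply/andP; split; lra.
have bb : -1 <= b <= 1 by apply/andP; split; lra.
pose u := Num.min (drift a / (2 * L)) ((m - a) / 2).
pose v := Num.min (- drift b / (2 * L)) ((b - m) / 2).
have L2 : 0 < 2 * L by rewrite mulr_gt0.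
have u0 : 0 < u by rewrite lt_min divr_gt0 //=; lra.
have v0 : 0 < v by rewrite lt_min divr_gt0 ?oppr_gt0 //=; lra.
have u1 : u * (2 * L) <= drift a by rewrite -ler_pdivlMr // ge_min lexx.
have v1 : v * (2 * L) <= - drift b by rewrite -ler_pdivlMr // ge_min lexx.
have u2 : u <= (m - a) / 2 by rewrite ge_min lexx orbT.
have v2 : v <= (b - m) / 2 by rewrite ge_min lexx orbT.
exists a, (a + u), (b - v), b; split => //; split; first by split; lra.
pose kap := Num.min (drift a / 2) (- drift b / 2).
have k1 : kap <= drift a / 2 by rewrite ge_min lexx.
have k2 : kap <= - drift b / 2 by rewrite ge_min lexx orbT.
exists kap; split.
- by rewrite lt_min; apply/andP; split; lra.
- move=> x /andP[x1 x2]; have xb : -1 <= x <= 1 by apply/andP; split; lra.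
  have := drift_lipschitz p h beta_gt0 ab xb; rewrite -/L ler_norml => /andP[X _].
  have xa : L * `|x - a| <= L * u by rewrite ler_pM2l // ger0_norm; lra.
  lra.
- move=> x /andP[x1 x2]; have xb : -1 <= x <= 1 by apply/andP; split; lra.
  have := drift_lipschitz p h beta_gt0 bb xb; rewrite -/L ler_norml => /andP[_ X].
  have xa : L * `|x - b| <= L * v by rewrite ler_pM2l // ler0_norm; lra.
  lra.
Qed.

Lemma critical_lower eps : critical_points p (beta, h) -> eps < 2^-1 ->
  ge_exp_Omega (tmix p beta h eps).
Proof.
move=> [_ [m1 [m2 [/= m12 H1 H2]]]] eps1.
wlog lt12 : m1 m2 m12 H1 H2 / m1 < m2 => [W|].
  move: (m12); rewrite neq_lt => /orP[lt12|lt21]; first exact: (W m1 m2).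
  by apply: (W m2 m1) => //; rewrite eq_sym.
have d0 : 0 < (m2 - m1) / 2 by lra.
have [l1 [l2 [r1 [r2 [W1 _ A]]]]] := maximizer_well H1 d0.
have [l1' [l2' [r1' [r2' [W2 B _]]]]] := maximizer_well H2 d0.
apply: (metastable_lower (ltnW (ltnW hp)) (ltW beta_gt0) W1 W2) => //; lra.
Qed.

(** Compactness glues the local behaviour of the drift near m0 with its sign elsewhere: away
    from m0 the drift is bounded away from zero, and (m - m0)^(2r) is bounded. *)
Lemma restoring_from_local r m0 kap delta C : -1 < m0 < 1 -> 0 < kap -> 0 < delta -> 0 <= C ->
  (0 < r)%N ->
  (forall x, -1 <= x -> x < m0 -> 0 < drift x) ->
  (forall x, m0 < x -> x <= 1 -> drift x < 0) ->
  (forall x, -1 <= x <= 1 -> `|x - m0| <= delta ->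
     (x - m0) * drift x <= - kap * (x - m0) ^+ (2 * r)) ->
  (forall x, -1 <= x <= 1 -> - ((x - m0) * drift x) <= C * (x - m0) ^+ (2 * r)) ->
  (forall a b, -1 <= a <= 1 -> -1 <= b <= 1 ->
     `|a - m0| <= delta -> `|b - m0| <= delta -> a <= b -> drift b <= drift a) ->
  restoring_drift p beta h r m0.
Proof.
move=> /andP[m1 m2] kap0 delta0 C0 r0 left right near flat decr.
have cont a b := within_continuous_is_derive (a := a) (b := b)
  (fun x _ => is_derive_drift p beta h x).
have [kl kl0 HL] : exists2 k, 0 < k & forall x, -1 <= x -> x <= m0 - delta -> k <= drift x.
  have [ed|ed] := leP (-1) (m0 - delta); last by exists 1 => // x x1 x2; lra.
  have [c] := EVT_min ed (cont _ _).
  rewrite in_itv /= => /andP[c1 c2] cmin; exists (drift c); first by apply: left => //; lra.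
  by move=> x x1 x2; apply: cmin; rewrite in_itv /= x1 x2.
have [kr kr0 HR] : exists2 k, 0 < k & forall x, m0 + delta <= x -> x <= 1 -> drift x <= - k.
  have [ed|ed] := leP (m0 + delta) 1; last by exists 1 => // x x1 x2; lra.
  have [c] := EVT_max ed (cont _ _).
  rewrite in_itv /= => /andP[c1 c2] cmax; exists (- drift c).
    by rewrite oppr_gt0; apply: right => //; lra.
  by move=> x x1 x2; rewrite opprK; apply: cmax; rewrite in_itv /= x1 x2.
split.
- by rewrite m1 m2.
- pose k := Num.min kl kr; have k0 : 0 < k by rewrite lt_min kl0 kr0.
  have kkl : k <= kl by rewrite ge_min lexx.
  have kkr : k <= kr by rewrite ge_min lexx orbT.
  pose c := Num.min kap (k * delta / 4 ^+ r).
  have D0 : 0 < 4 ^+ r :> R by rewrite exprn_gt0.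
  have ck : c <= kap by rewrite ge_min lexx.
  have cd : c * 4 ^+ r <= k * delta by rewrite -ler_pdivlMr // ge_min lexx orbT.
  have c0 : 0 < c by rewrite lt_min kap0 divr_gt0 // mulr_gt0.
  exists c => // x xb; have /andP[x1 x2] := xb.
  have ev : 0 <= (x - m0) ^+ (2 * r) by rewrite exprM exprn_ge0 // sqr_ge0.
  have [xn|xf] := leP `|x - m0| delta.
    apply: le_trans (near x xb xn) _; rewrite !mulNr lerN2; exact: ler_wpM2r.
  have e4 : (x - m0) ^+ (2 * r) <= 4 ^+ r.
    rewrite exprM; apply: lerXn2r; rewrite ?nnegrE ?sqr_ge0 //.
    have d1 : 0 <= 2 - (x - m0) by lra.
    have d2 : 0 <= 2 + (x - m0) by lra.
    have := mulr_ge0 d1 d2; lra.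
  have ce : c * (x - m0) ^+ (2 * r) <= c * 4 ^+ r by rewrite ler_pM2l.
  suff : (x - m0) * drift x <= - (k * delta) by rewrite mulNr; lra.
  move: xf; rewrite ltr_normr => /orP[xf|xf].
    have := HR x (_ : m0 + delta <= x) x2; have Q : m0 + delta <= x by lra.
    move=> /(_ Q) dx.
    have xm : delta <= x - m0 by rewrite lerBrDl.
    have kx : k <= - drift x by rewrite lerNr (le_trans dx) // lerN2.
    have q1 := ler_pM (ltW delta0) (ltW k0) xm kx.
    by rewrite mulrN in q1; lra.
  have Q : x <= m0 - delta by lra.
  have dx := HL x x1 Q.
  have xm : delta <= m0 - x by rewrite lerBrDr -lerBrDl.
  have q1 := ler_pM (ltW delta0) (ltW k0) xm (le_trans kkl dx).
  lra.
- by exists C.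
- exists L; first exact: ltW.
  move=> a b ab bb leab; apply: le_trans (ler_norm _) _.
  apply: le_trans (drift_lipschitz p h beta_gt0 ab bb) _.
  by rewrite ger0_norm // subr_ge0.
- by exists delta.
Qed.

End Barriers.

(** * Regular points *)

Lemma poly_lipschitz (R : realType) (q : {poly R}) :
  exists2 C, 0 <= C & (forall x, -1 <= x <= 1 -> `|q.[x]| <= C) /\
    forall x y, -1 <= x <= 1 -> -1 <= y <= 1 -> `|q.[x] - q.[y]| <= C * `|x - y|.
Proof.
elim/poly_ind: q => [|q c [C C0 [B Lp]]].
  by exists 0 => //; split=> *; rewrite !horner0 ?subrr ?normr0 // mul0r.
exists (2 * C + `|c|); first by rewrite addr_ge0 ?mulr_ge0.
have c0 := normr_ge0 c.
split=> [x xb|x y xb yb]; rewrite !hornerE.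
  have x1 : `|x| <= 1 by rewrite ler_norml.
  apply: le_trans (ler_normD _ _) _; rewrite normrM.
  have := B x xb; have := normr_ge0 q.[x]; have := normr_ge0 x; nra.
have y1 : `|y| <= 1 by rewrite ler_norml.
have -> : q.[x] * x + c - (q.[y] * y + c) = q.[x] * (x - y) + (q.[x] - q.[y]) * y by ring.
apply: le_trans (ler_normD _ _) _; rewrite !normrM.
have A1 : `|q.[x]| * `|x - y| <= C * `|x - y| by rewrite ler_wpM2r ?B.
have A2 : `|q.[x] - q.[y]| * `|y| <= C * `|x - y| * 1.
  by apply: ler_pM => //; exact: Lp.
have A3 : 0 <= `|c| * `|x - y| by rewrite mulr_ge0.
lra.
Qed.

Section LocalDrift.
Variables (R : realType) (p : nat) (beta h : R).
Hypotheses (hp : (3 <= p)%N) (beta_gt0 : 0 < beta).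
Local Notation drift := (drift p beta h).
Local Notation H := (Hfun p beta h).
Local Notation Hslope := (Hslope p beta h).
Local Notation curv := (curvature p beta).
Local Notation Fd := (drift_slope p beta h).
Let L := p%:R ^+ 2 * beta + 1.
Let B := 4 * (p%:R ^+ 2 * beta).
Let L_gt0 : 0 < L.
Proof. by rewrite ltr_wpDl // mulr_ge0 ?exprn_ge0 // ltW. Qed.
Let B_ge0 : 0 <= B.
Proof. by rewrite mulr_ge0 // mulr_ge0 ?exprn_ge0 // ltW. Qed.

Lemma drift_slope_curvature x : -1 <= x <= 1 -> `|Fd x - curv x| <= B * `|drift x|.
Proof.
move=> xb; rewrite /drift_slope addrAC subrr sub0r normrN normrM [X in X * _]normrM.
have fs := field_slope_bound p beta_gt0 xb; have db := drift_bound p beta h xb.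
have -> : B * `|drift x| = 4 * `|drift x| * (p%:R ^+ 2 * beta) by rewrite /B; ring.
apply: (ler_pM _ (normr_ge0 _) _ fs); first by rewrite mulr_ge0.
apply: ler_wpM2r => //; apply: le_trans (ler_normD _ _) _.
have x1 : `|x| <= 1 by rewrite ler_norml.
by rewrite normrM normr_nat; lra.
Qed.

Lemma drift_mean a b : a < b -> exists c : R, a < c < b /\ drift b - drift a = Fd c * (b - a).
Proof. by move=> ab; exact: (mean_value ab (fun x _ => is_derive_drift p beta h x)). Qed.

(** The mean value theorem gains one power of the distance; applied repeatedly together with
    drift_slope_curvature it gives the order of vanishing of the drift. *)
Lemma drift_bootstrap m k C : -1 <= m <= 1 -> drift m = 0 -> 0 <= C ->
  (forall x, -1 <= x <= 1 -> `|Fd x| <= C * `|x - m| ^+ k) ->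
  forall x, -1 <= x <= 1 -> `|drift x| <= C * `|x - m| ^+ k.+1.
Proof.
move=> mb dm C0 HF x xb; rewrite exprSr mulrA.
have aux c : -1 <= c <= 1 -> `|c - m| <= `|x - m| -> `|Fd c| <= C * `|x - m| ^+ k.
  move=> cb cx; apply: le_trans (HF c cb) _; apply: ler_wpM2l => //.
  by apply: lerXn2r; rewrite ?nnegrE.
have /andP[m1 m2] := mb; have /andP[x1 x2] := xb.
have [xm|mx|->] := ltgtP x m; last by rewrite dm subrr normr0 mulr0.
- have [c [/andP[c1 c2] E]] := drift_mean xm.
  have -> : `|drift x| = `|Fd c| * `|x - m|.
    by rewrite -normrN [`|x - m|]distrC -normrM -E dm sub0r.
  apply: ler_wpM2r => //; apply: aux; first by apply/andP; split; lra.
  by rewrite !ler0_norm; lra.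
- have [c [/andP[c1 c2] E]] := drift_mean mx.
  have -> : `|drift x| = `|Fd c| * `|x - m| by rewrite -normrM -E dm subr0.
  apply: ler_wpM2r => //; apply: aux; first by apply/andP; split; lra.
  by rewrite !ger0_norm; lra.
Qed.

Lemma drift_ends : 0 < drift (-1) /\ drift 1 < 0.
Proof.
have /andP[a _] := tanh_bound (field_at p beta h (-1)).
have /andP[_ b] := tanh_bound (field_at p beta h 1).
by rewrite /drift /cond_mean; split; lra.
Qed.

(** The drift is positive at -1 and negative at 1, so a unique zero is a change of sign. *)
Lemma drift_sign m : -1 < m < 1 ->
  (forall x, -1 < x < 1 -> drift x = 0 -> x = m) ->
  (forall x, -1 <= x -> x < m -> 0 < drift x) /\
  (forall x, m < x -> x <= 1 -> drift x < 0).
Proof.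
move=> /andP[m1 m2] uniq; have [e1 e2] := drift_ends.
have cont a b := within_continuous_is_derive (a := a) (b := b)
  (fun x _ => is_derive_drift p beta h x).
split=> x xl xr; rewrite ltNge; apply/negP => dx.
  have v : Num.min (drift (-1)) (drift x) <= 0 <= Num.max (drift (-1)) (drift x).
    by rewrite ge_min dx orbT le_max (ltW e1).
  have [c] := IVT xl (cont _ _) v.
  rewrite in_itv /= => /andP[c1 c2] dc.
  have c1' : -1 < c.
    by rewrite lt_neqAle c1 andbT; apply/eqP => E; move: e1; rewrite E dc ltxx.
  have cb : -1 < c < 1 by rewrite c1' /=; lra.
  by have := uniq c cb dc; lra.
have v : Num.min (drift x) (drift 1) <= 0 <= Num.max (drift x) (drift 1).
  by rewrite ge_min (ltW e2) orbT le_max dx.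
have [c] := IVT xr (cont _ _) v.
rewrite in_itv /= => /andP[c1 c2] dc.
have c2' : c < 1.
  by rewrite lt_neqAle c2 andbT; apply/eqP => E; move: e2; rewrite -E dc ltxx.
have cb : -1 < c < 1 by rewrite c2' andbT; lra.
by have := uniq c cb dc; lra.
Qed.

Lemma drift0_Hslope x : -1 < x < 1 -> (drift x = 0) <-> (Hslope x = 0).
Proof.
move=> xb; have [A1 A2] := drift_Hslope p beta h xb; split => E.
  apply/eqP; rewrite eq_le !leNgt -A1 -A2 E ltxx //.
by apply/eqP; rewrite eq_le !leNgt A1 A2 E ltxx.
Qed.

(** At a regular point the slope of the drift at m is the curvature, which is negative, and
    remains so in a neighbourhood. *)
Lemma regular_restoring m : -1 < m < 1 -> local_maximizer p beta h m ->
  (H^`(2))%classic m < 0 ->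
  (forall m', stationary_point p beta h m' -> m' = m) ->
  restoring_drift p beta h 1 m.
Proof.
move=> mb Hm H2 uniq; have /andP[m1 m2] := mb.
have mb' : -1 <= m <= 1 by rewrite !ltW.
have dm := drift_at_maximizer hp beta_gt0 Hm.
have [sl sr] : (forall x, -1 <= x -> x < m -> 0 < drift x) /\
  (forall x, m < x -> x <= 1 -> drift x < 0).
  apply: drift_sign => // x xb /(drift0_Hslope xb) dx; apply: uniq; split => //.
  by rewrite derive_H.
have mm : 0 < 1 - m ^+ 2.
  have -> : 1 - m ^+ 2 = (1 - m) * (1 + m) by ring.
  by rewrite mulr_gt0 //; lra.
have c0 : curv m < 0.
  by move: H2; rewrite derive2_H // ltr_pdivrMr // mul0r.
pose kap := - curv m / 2; have kap0 : 0 < kap by rewrite /kap; lra.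
have [C C0 [_ CL]] := poly_lipschitz (curv_poly p beta).
pose T := C + B * L + 1.
have BL0 : 0 <= B * L by rewrite mulr_ge0 // ltW.
have T0 : 0 < T by rewrite /T; lra.
pose delta := kap / T; have delta0 : 0 < delta by rewrite divr_gt0.
have Lip x : -1 <= x <= 1 -> `|drift x| <= L * `|x - m|.
  by move=> xb; have := drift_lipschitz p h beta_gt0 mb' xb; rewrite dm subr0.
have near x : -1 <= x <= 1 -> `|x - m| <= delta -> Fd x <= - kap.
  move=> xb xd; have := drift_slope_curvature xb; have := CL x m xb mb'.
  rewrite !horner_curv !ler_norml => /andP[_ X1] /andP[_ X2].
  have X3 : B * `|drift x| <= B * (L * `|x - m|) by rewrite ler_wpM2l ?Lip.
  have X4 : T * `|x - m| <= kap by rewrite mulrC -ler_pdivlMr.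
  have X5 := normr_ge0 (x - m).
  have X6 : curv m = - (2 * kap) by rewrite /kap; field.
  move: X4; rewrite /T; lra.
apply: (@restoring_from_local R p beta h beta_gt0 1 m kap delta L) => //; first exact: ltW.
- move=> x xb xd; rewrite muln1; have /andP[x1 x2] := xb.
  have [xm|mx|->] := ltgtP x m; last by rewrite subrr expr0n mul0r mulr0.
  + have [c [/andP[c1 c2] E]] := drift_mean xm.
    have Fc : Fd c <= - kap.
      apply: near; first by apply/andP; split; lra.
      by apply: le_trans xd; rewrite !ler0_norm; lra.
    have -> : drift x = Fd c * (x - m) by move: E; rewrite dm; lra.
    have := ler_wpM2r (sqr_ge0 (x - m)) Fc; lra.
  + have [c [/andP[c1 c2] E]] := drift_mean mx.
    have Fc : Fd c <= - kap.
      apply: near; first by apply/andP; split; lra.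
      by apply: le_trans xd; rewrite !ger0_norm; lra.
    have -> : drift x = Fd c * (x - m) by move: E; rewrite dm; lra.
    have := ler_wpM2r (sqr_ge0 (x - m)) Fc; lra.
- move=> x xb; apply: le_trans (ler_norm _) _; rewrite normrN normrM muln1.
  rewrite -real_normK ?num_real // expr2 mulrA mulrC; apply: ler_wpM2r => //.
  exact: Lip.
move=> a b ab bb ad bd; rewrite le_eqVlt => /orP[/eqP -> //|lab].
have [c [/andP[c1 c2] E]] := drift_mean lab.
have Fc : Fd c <= - kap.
  apply: near; first by apply/andP; split; lra.
  move: ad bd; rewrite !ler_norml => /andP[? ?] /andP[? ?]; apply/andP; split; lra.
rewrite -subr_le0 E mulr_le0_ge0 //; lra.
Qed.
End LocalDrift.

(** * The curvature at special points *)

Section TwoTermPoly.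
Variables (R : comNzRingType) (K x : R) (n : nat).
Let q : {poly R} := K%:P * ('X^n - 'X^(n.+2)) - 1%:P.

Lemma expr_pred_mul k : (x ^+ k.-1 *+ k) * x = k%:R * x ^+ k.
Proof.
by case: k => [|k]; rewrite ?mulr0n ?mul0r //= mulrnAl -exprSr mulr_natl.
Qed.

(** Multiplying by powers of x avoids the truncated exponents of the derivatives. *)
Lemma two_term_deriv : q^`().[x] * x = K * (n%:R * x ^+ n - n.+2%:R * x ^+ n.+2).
Proof.
rewrite /q derivB derivC subr0 deriv_mulC derivB !derivXn hornerM hornerC hornerD hornerN.
rewrite !hornerMn !hornerXn -mulrA mulrBl expr_pred_mul; congr (_ * (_ - _)).
exact: expr_pred_mul n.+2.
Qed.

Lemma two_term_deriv2 : q^`()^`().[x] * x ^+ 2 =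
  K * (n%:R * (n%:R - 1) * x ^+ n - n.+2%:R * n.+1%:R * x ^+ n.+2).
Proof.
rewrite /q derivB derivC subr0 deriv_mulC derivB !derivXn deriv_mulC derivB !derivMn !derivXn.
rewrite hornerM hornerC hornerD hornerN !hornerMn !hornerXn -(mulrA K); congr (_ * _).
rewrite [LHS]mulrBl; congr (_ - _).
  rewrite -[(_ *+ n.-1) *+ n]mulr_natl -!mulrA expr2 [_ * (x * x)]mulrA expr_pred_mul.
  case: n => [|k]; first by rewrite !mul0r.
  by rewrite /= -natr1 exprSr; ring.
rewrite [n.+2.-1]/= [n.+2.-2]/= -[_ *+ n.+2]mulr_natl -[_ *+ n.+1]mulr_natl -!mulrA; congr (_ * (_ * _)).
by rewrite -exprD addn2.
Qed.
End TwoTermPoly.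

Section Special.
Variables (R : realType) (p : nat) (beta h : R).
Hypotheses (hp : (3 <= p)%N) (beta_gt0 : 0 < beta).
Local Notation drift := (drift p beta h).
Local Notation H := (Hfun p beta h).
Local Notation Hslope := (Hslope p beta h).
Local Notation curv := (curvature p beta).
Local Notation Fd := (drift_slope p beta h).
Local Notation q := (curv_poly p beta).
Let L := p%:R ^+ 2 * beta + 1.
Let B := 4 * (p%:R ^+ 2 * beta).
Let L_gt0 : 0 < L.
Proof. by rewrite ltr_wpDl // mulr_ge0 ?exprn_ge0 // ltW. Qed.
Let B_ge0 : 0 <= B.
Proof. by rewrite mulr_ge0 // mulr_ge0 ?exprn_ge0 // ltW. Qed.

Section AtMaximizer.
Variable m : R.
Hypothesis Hm : local_maximizer p beta h m.
Hypothesis curv0 : curv m = 0.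

Let mi : -1 < m < 1 := local_maximizer_interior beta_gt0 Hm.
Let mb : -1 <= m <= 1. Proof. by case/andP: mi => ? ?; rewrite !ltW. Qed.
Let dm : drift m = 0 := drift_at_maximizer hp beta_gt0 Hm.
Let rootm : root q m. Proof. by apply/rootP; rewrite horner_curv. Qed.

Let Lip x : -1 <= x <= 1 -> `|drift x| <= L * `|x - m|.
Proof. by move=> xb; have := drift_lipschitz p h beta_gt0 mb xb; rewrite dm subr0. Qed.

Lemma drift_quadratic : exists2 C, 0 <= C & forall x, -1 <= x <= 1 ->
  `|drift x| <= C * `|x - m| ^+ 2.
Proof.
have [C C0 [_ CL]] := poly_lipschitz q.
exists (C + B * L); first by rewrite addr_ge0 // mulr_ge0 // ltW.
apply: (@drift_bootstrap R p beta h m 1) => //; first by rewrite addr_ge0 // mulr_ge0 // ltW.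
move=> x xb; rewrite expr1; have X1 := drift_slope_curvature p h beta_gt0 xb.
have X2 := CL x m xb mb; rewrite !horner_curv curv0 subr0 in X2.
have X3 : B * `|drift x| <= B * (L * `|x - m|) by rewrite ler_wpM2l ?Lip.
have -> : Fd x = (Fd x - curv x) + curv x by ring.
apply: le_trans (ler_normD _ _) _; rewrite -/B in X1; lra.
Qed.

(** The curvature has a double root at a degenerate maximizer. If m were a simple root, the
    slope of the drift would be positive on one side of m, because the drift itself is of
    second order; the drift would then point away from m on that side. *)
Lemma double_root : exists q2 : {poly R}, q = q2 * ('X - m%:P) ^+ 2.
Proof.
have [q1 qE] := factor_theorem _ _ rootm.
suff q1m : q1.[m] = 0.
  have [q2 q1E] := factor_theorem _ _ (introT rootP q1m).
  by exists q2; rewrite qE q1E expr2 mulrA.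
have curvE x : curv x = (x - m) * q1.[x].
  by rewrite -horner_curv qE !hornerE mulrC.
have [C C0 quad] := drift_quadratic.
have [C1 C10 [_ CL]] := poly_lipschitz q1.
have BC0 : 0 <= B * C by rewrite mulr_ge0.
have /andP[m1 m2] := mi.
apply/eqP; rewrite eq_le; apply/andP; split; rewrite leNgt; apply/negP => q10.
all: pose T := C1 + B * C + 1; have T0 : 0 < T by rewrite /T; lra.
  pose d := q1.[m] / T; have d0 : 0 < d by rewrite divr_gt0.
  have [b [b1 b2 b3 bd]] := barrier_right hp beta_gt0 Hm d0.
  have [c [/andP[c1 c2] E]] := drift_mean p beta h b2.
  have cb : -1 <= c <= 1 by apply/andP; split; lra.
  have := drift_slope_curvature p h beta_gt0 cb; rewrite -/B ler_norml => /andP[X1 _].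
  have := CL c m cb mb; rewrite ler_norml => /andP[X2 _].
  have X3 : B * `|drift c| <= B * (C * `|c - m| ^+ 2) by rewrite ler_wpM2l ?quad.
  have u0 : 0 < c - m by rewrite subr_gt0.
  rewrite (gtr0_norm u0) in X2 X3.
  have X4 : (C1 + B * C + 1) * (c - m) < q1.[m].
    by rewrite -/T mulrC -ltr_pdivlMr // -/d; lra.
  have X5 : 0 < Fd c.
    have E2 : 0 < (c - m) * (q1.[c] - B * C * (c - m)) by rewrite mulr_gt0 //; lra.
    have := curvE c; lra.
  have bm : 0 < b - m by rewrite subr_gt0.
  by have := mulr_gt0 X5 bm; rewrite -E dm; lra.
pose d := - q1.[m] / T; have d0 : 0 < d by rewrite divr_gt0 // oppr_gt0.
have [a [a1 a2 a3 ad]] := barrier_left hp beta_gt0 Hm d0.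
have [c [/andP[c1 c2] E]] := drift_mean p beta h a3.
have cb : -1 <= c <= 1 by apply/andP; split; lra.
have := drift_slope_curvature p h beta_gt0 cb; rewrite -/B ler_norml => /andP[X1 _].
have := CL c m cb mb; rewrite ler_norml => /andP[_ X2].
have X3 : B * `|drift c| <= B * (C * `|c - m| ^+ 2) by rewrite ler_wpM2l ?quad.
have u0 : 0 < m - c by rewrite subr_gt0.
rewrite distrC (gtr0_norm u0) in X2 X3.
have X4 : (C1 + B * C + 1) * (m - c) < - q1.[m].
  by rewrite -/T mulrC -ltr_pdivlMr // -/d; lra.
have X5 : 0 < Fd c.
  have E2 : 0 < (m - c) * (- q1.[c] - B * C * (m - c)) by rewrite mulr_gt0 //; lra.
  have := curvE c; lra.
have am : 0 < m - a by rewrite subr_gt0.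
by have := mulr_gt0 X5 am; rewrite -E dm; lra.
Qed.

Let n := p.-2.
Let K := p%:R * p.-1%:R * beta.
Let n_gt0 : (0 < n)%N. Proof. by rewrite /n; case: p hp => [|[|[|k]]]. Qed.
Let K_gt0 : 0 < K.
Proof.
by rewrite !mulr_gt0 // ltr0n; case: p hp => [|[|[|k]]].
Qed.
Let Kmn : K * m ^+ n * (1 - m ^+ 2) = 1.
Proof. by move: curv0 => /eqP; rewrite subr_eq0 => /eqP. Qed.
Let mm : 0 < 1 - m ^+ 2.
Proof.
case/andP: mi => m1 m2; have -> : 1 - m ^+ 2 = (1 - m) * (1 + m) by ring.
by rewrite mulr_gt0 //; lra.
Qed.
Let Kmn_gt0 : 0 < K * m ^+ n.
Proof. by rewrite -(pmulr_lgt0 _ mm) Kmn. Qed.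
Let m_neq0 : m != 0.
Proof. by apply/eqP => m0; move: Kmn_gt0; rewrite m0 expr0n gtn_eqF // mulr0 ltxx. Qed.

(** With n = p - 2 the curvature is K (x^n - x^(n+2)) - 1. Its vanishing derivative gives
    m^2 = n / (n + 2), and then m^2 q''(m) = - 2 n K m^n < 0, so that the root is exactly
    double and the drift vanishes exactly to third order. *)
Lemma special_location : (n%:R + 2) * m ^+ 2 = n%:R /\
  forall q2 : {poly R}, q = q2 * ('X - m%:P) ^+ 2 -> q2.[m] < 0.
Proof.
have qE : q = K%:P * ('X^n - 'X^(n.+2)) - 1%:P.
  have -> : 'X^(n.+2) = 'X^n * 'X^2 :> {poly R} by rewrite -exprD addn2.
  by rewrite /curv_poly -/n -/K polyC1; ring.
have n2E : n.+2%:R = n%:R + 2 :> R by rewrite -addn2 natrD.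
have xn2 : m ^+ n.+2 = m ^+ n * m ^+ 2 by rewrite -exprD addn2.
have d1m : q^`().[m] * m = K * m ^+ n * (n%:R - (n%:R + 2) * m ^+ 2).
  by rewrite qE two_term_deriv n2E xn2; ring.
have d2m : q^`()^`().[m] * m ^+ 2 = K * m ^+ n * (n%:R * (n%:R - 1) - (n%:R + 1) * ((n%:R + 2) * m ^+ 2)).
  by rewrite qE two_term_deriv2 n2E xn2 -natr1; ring.
have gen q2 : q = q2 * ('X - m%:P) ^+ 2 -> q^`().[m] = 0 /\ q^`()^`().[m] = 2 * q2.[m].
  move=> ->; rewrite expr2 mulrA; set D := q2 * ('X - m%:P).
  have DE : (D * ('X - m%:P))^`() = D^`() * ('X - m%:P) + D.
    by rewrite derivM derivXsubC mulr1.
  have D0 : D.[m] = 0 by rewrite /D !hornerE subrr mulr0.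
  have D1 : D^`().[m] = q2.[m].
    by rewrite /D derivM derivXsubC mulr1 !hornerE subrr mulr0 add0r.
  split; first by rewrite DE hornerD hornerM D0 hornerXsubC subrr mulr0 addr0.
  rewrite DE derivD derivM derivXsubC mulr1 !hornerD hornerM hornerXsubC subrr mulr0 add0r D1.
  ring.
have loc : (n%:R + 2) * m ^+ 2 = n%:R.
  have [q2 /gen [E _]] := double_root.
  move: d1m; rewrite E mul0r => /esym/eqP; rewrite mulf_eq0 (gt_eqF Kmn_gt0) /=.
  by rewrite subr_eq0 => /eqP.
split=> // q2 /gen [_ E]; move: d2m; rewrite E loc => d2m.
have m2 : 0 < m ^+ 2 by rewrite exprn_even_gt0.
have nn : 0 < n%:R :> R by rewrite ltr0n.
have := mulr_gt0 Kmn_gt0 nn.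
have -> : K * m ^+ n * n%:R = - (q2.[m] * m ^+ 2).
  by apply: (@mulfI _ 2) => //; move: d2m; lra.
by rewrite oppr_gt0 pmulr_llt0.
Qed.

(** By the weighted inequality of arithmetic and geometric means, |x|^n (1 - x^2) is maximal
    where x^2 = n / (n + 2), that is at x = m up to sign, where the curvature vanishes. So H is
    concave. *)
Lemma curvature_le0 x : -1 < x < 1 -> curv x <= 0.
Proof.
move=> /andP[x1 x2]; have [loc _] := special_location.
have nn : 0 < n%:R :> R by rewrite ltr0n.
have m2 : 0 < m ^+ 2 by rewrite exprn_even_gt0.
pose a := x ^+ 2 / m ^+ 2; pose b := (1 - x ^+ 2) / (1 - m ^+ 2).
have xx : 0 <= 1 - x ^+ 2.
  have -> : 1 - x ^+ 2 = (1 - x) * (1 + x) by ring.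
  by rewrite mulr_ge0 //; lra.
have a0 : 0 <= a by rewrite divr_ge0 ?sqr_ge0.
have b0 : 0 <= b by rewrite divr_ge0 // ltW.
have ea : a ^+ n <= expR (a - 1) ^+ n.
  apply: lerXn2r; rewrite ?nnegrE ?expR_ge0 //; have := expR_ge1Dx (a - 1); lra.
have eb : b ^+ 2 <= expR (b - 1) ^+ 2.
  apply: lerXn2r; rewrite ?nnegrE ?expR_ge0 //; have := expR_ge1Dx (b - 1); lra.
have nz : n%:R + 2 != 0 :> R by rewrite lt0r_neq0 // addr_gt0.
have m2E : m ^+ 2 = n%:R / (n%:R + 2) by apply: (canRL (mulfK nz)); rewrite mulrC loc.
have ab : a ^+ n * b ^+ 2 <= 1.
  apply: le_trans (ler_pM _ _ ea eb) _; rewrite ?exprn_ge0 //.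
  rewrite -!expRM_natl -expRD (_ : _ + _ = 0) ?expR0 //.
  rewrite /a /b m2E; field.
  have -> : n%:R + 2 - n%:R = 2 :> R by ring.
  by rewrite nz pnatr_eq0 (lt0r_neq0 nn).
rewrite /curvature /field_slope -/n -/K subr_le0.
suff : (K * x ^+ n * (1 - x ^+ 2)) ^+ 2 <= 1.
  set y := K * _ * _ => y2; rewrite leNgt; apply/negP => y1.
  have : y * 1 < y * y by rewrite ltr_pM2l // (lt_trans ltr01).
  by rewrite mulr1 -expr2 ltNge (le_trans y2) // ltW.
have -> : (K * x ^+ n * (1 - x ^+ 2)) ^+ 2 = a ^+ n * b ^+ 2 * (K * m ^+ n * (1 - m ^+ 2)) ^+ 2.
  have sw (z : R) : (z ^+ 2) ^+ n = (z ^+ n) ^+ 2 by rewrite -!exprM mulnC.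
  have M0 : m ^+ n != 0 by rewrite expf_neq0.
  have m20 : 1 - m ^+ 2 != 0 by rewrite lt0r_neq0.
  rewrite /a /b !expr_div_n !sw; move: M0; move: (m ^+ n) (x ^+ n) => M X M0.
  by field; rewrite M0 m20.
by rewrite Kmn expr1n mulr1.
Qed.

End AtMaximizer.
End Special.

(** * The drift at special points *)

Section SpecialDrift.
Variables (R : realType) (p : nat) (beta h : R).
Hypotheses (hp : (3 <= p)%N) (beta_gt0 : 0 < beta).
Local Notation drift := (drift p beta h).
Local Notation H := (Hfun p beta h).
Local Notation Hslope := (Hslope p beta h).
Local Notation curv := (curvature p beta).
Local Notation Fd := (drift_slope p beta h).
Let B := 4 * (p%:R ^+ 2 * beta).
Let B_ge0 : 0 <= B.
Proof. by rewrite mulr_ge0 // mulr_ge0 ?exprn_ge0 // ltW. Qed.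

Section Slope.
Variables (m kap delta : R).
Hypotheses (mi : -1 < m < 1) (dm : drift m = 0) (kap0 : 0 < kap) (delta0 : 0 < delta).
Hypothesis slope : forall x, -1 <= x <= 1 -> `|x - m| <= delta ->
  Fd x <= - kap * (x - m) ^+ 2.

Lemma slope_decr a b : -1 <= a <= 1 -> -1 <= b <= 1 ->
  `|a - m| <= delta -> `|b - m| <= delta -> a <= b -> drift b <= drift a.
Proof.
move=> ab bb ad bd; rewrite le_eqVlt => /orP[/eqP -> //|lab].
have [c [/andP[c1 c2] E]] := drift_mean p beta h lab.
have cb : -1 <= c <= 1 by apply/andP; split; lra.
have cd : `|c - m| <= delta.
  move: ad bd; rewrite !ler_norml => /andP[? ?] /andP[? ?]; apply/andP; split; lra.
have := slope cb cd; have := mulr_ge0 (ltW kap0) (sqr_ge0 (c - m)) => P1 P2.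
by rewrite -subr_le0 E mulr_le0_ge0 //; lra.
Qed.

(** On the outer half of the segment from m to x the slope is at most a fixed fraction of
    - kap (x - m)^2, and on the inner half the drift does not change sign. *)
Lemma slope_restoring x : -1 <= x <= 1 -> `|x - m| <= delta ->
  (x - m) * drift x <= - (kap / 8) * (x - m) ^+ 4.
Proof.
have /andP[m1 m2] := mi; have dm' := dm; have kap0' := kap0; have delta0' := delta0.
have mb : -1 <= m <= 1 by rewrite !ltW.
have decr := slope_decr.
move=> xb xd; pose y := (x + m) / 2; have /andP[x1 x2] := xb.
have ym : y - m = (x - m) / 2 by rewrite /y; field.
have yb : -1 <= y <= 1 by rewrite /y; apply/andP; split; lra.
have yd : `|y - m| <= delta.
  by apply: le_trans xd; rewrite ym normrM (gtr0_norm (_ : 0 < 2^-1)) //; have := normr_ge0 (x - m); lra.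
have md : `|m - m| <= delta by rewrite subrr normr0 ltW.
have [xm|mx|->] := ltgtP x m; last by rewrite subrr mul0r expr0n mulr0.
- have xy : x < y by rewrite /y; lra.
  have [c [/andP[c1 c2] E]] := drift_mean p beta h xy.
  have dy : 0 <= drift y by rewrite -dm; apply: decr => //; rewrite /y; lra.
  have cm : y < m by rewrite /y; lra.
  have Fc : Fd c <= - kap * (c - m) ^+ 2.
    apply: slope; first by apply/andP; split; lra.
    by apply: le_trans xd; rewrite !ler0_norm; lra.
  have c4 : (x - m) ^+ 2 / 4 <= (c - m) ^+ 2.
    have -> : (x - m) ^+ 2 / 4 = (m - y) ^+ 2 by rewrite /y; field.
    rewrite -[leRHS]sqrrN opprB; apply: lerXn2r; rewrite ?nnegrE; lra.
  have Fc' : Fd c <= - kap * ((x - m) ^+ 2 / 4).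
    by apply: le_trans Fc _; rewrite !mulNr lerN2 ler_pM2l.
  have yx : y - x = (m - x) / 2 by rewrite /y; field.
  have dx : kap / 8 * (m - x) ^+ 3 <= drift x.
    have : Fd c * (y - x) <= - kap * ((x - m) ^+ 2 / 4) * (y - x).
      by apply: ler_wpM2r => //; lra.
    rewrite -E yx; lra.
  have mx0 : 0 <= m - x by lra.
  have := ler_wpM2l mx0 dx; lra.
- have xy : y < x by rewrite /y; lra.
  have [c [/andP[c1 c2] E]] := drift_mean p beta h xy.
  have dy : drift y <= 0 by rewrite -dm; apply: decr => //; rewrite /y; lra.
  have cm : m < y by rewrite /y; lra.
  have Fc : Fd c <= - kap * (c - m) ^+ 2.
    apply: slope; first by apply/andP; split; lra.
    by apply: le_trans xd; rewrite !ger0_norm; lra.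
  have c4 : (x - m) ^+ 2 / 4 <= (c - m) ^+ 2.
    have -> : (x - m) ^+ 2 / 4 = (y - m) ^+ 2 by rewrite ym; field.
    apply: lerXn2r; rewrite ?nnegrE; lra.
  have Fc' : Fd c <= - kap * ((x - m) ^+ 2 / 4).
    by apply: le_trans Fc _; rewrite !mulNr lerN2 ler_pM2l.
  have yx : x - y = (x - m) / 2 by rewrite /y; field.
  have dx : drift x <= - (kap / 8 * (x - m) ^+ 3).
    have : Fd c * (x - y) <= - kap * ((x - m) ^+ 2 / 4) * (x - y).
      by apply: ler_wpM2r => //; lra.
    rewrite -E yx; lra.
  have mx0 : 0 <= x - m by lra.
  have := ler_wpM2l mx0 dx; lra.
Qed.
End Slope.

Section Sign.
Variables (m kap delta : R).
Hypotheses (mi : -1 < m < 1) (kap0 : 0 < kap) (delta0 : 0 < delta).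
Hypotheses (dl : -1 < m - delta) (dr : m + delta < 1).
Hypothesis local : forall x, -1 <= x <= 1 -> `|x - m| <= delta ->
  (x - m) * drift x <= - kap * (x - m) ^+ 4.
Hypothesis concave : forall x, -1 < x < 1 -> curv x <= 0.

(** The slope of H is nonincreasing when H is concave, so the sign that the drift takes near m
    persists up to the ends. *)
Lemma concave_sign : (forall x, -1 <= x -> x < m -> 0 < drift x) /\
  (forall x, m < x -> x <= 1 -> drift x < 0).
Proof.
have /andP[m1 m2] := mi; have delta0' := delta0; have dl' := dl; have dr' := dr.
have Hmono a b : -1 < a -> a < b -> b < 1 -> Hslope b <= Hslope a.
  move=> a1 ab b1.
  have [|c [/andP[c1 c2] E]] := @mean_value R Hslope (fun x => curv x / (1 - x ^+ 2)) a b ab.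
    by move=> x xb; apply: is_derive_Hslope; lra.
  have cb : -1 < c < 1 by apply/andP; split; lra.
  have cc : 0 < 1 - c ^+ 2.
    have -> : 1 - c ^+ 2 = (1 - c) * (1 + c) by ring.
    by rewrite mulr_gt0 //; lra.
  rewrite -subr_le0 E mulr_le0_ge0 //; last lra.
  by rewrite pmulr_lle0 ?invr_gt0 // concave.
have [e1 e2] := drift_ends p beta h.
have rnear x : m < x -> x <= m + delta -> drift x < 0.
  move=> xm xd; have u0 : 0 < x - m by lra.
  have xb : -1 <= x <= 1 by apply/andP; split; lra.
  have xd' : `|x - m| <= delta by rewrite gtr0_norm; lra.
  have k4 : 0 < kap * (x - m) ^+ 4 by rewrite mulr_gt0 ?exprn_gt0.
  have Q := local xb xd'.
  by rewrite -(pmulr_rlt0 _ u0); lra.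
have lnear x : x < m -> m - delta <= x -> 0 < drift x.
  move=> xm xd; have u0 : x - m < 0 by lra.
  have xb : -1 <= x <= 1 by apply/andP; split; lra.
  have xd' : `|x - m| <= delta by rewrite ltr0_norm; lra.
  have k4 : 0 < kap * (x - m) ^+ 4.
    by rewrite mulr_gt0 // exprn_even_gt0 //= lt_eqF.
  have Q := local xb xd'.
  by rewrite -(nmulr_rlt0 _ u0); lra.
have right x : m < x -> x <= 1 -> drift x < 0.
  move=> xm x1; have [xn|xf] := leP x (m + delta); first exact: rnear.
  move: x1; rewrite le_eqVlt => /orP[/eqP -> //|x1].
  have xi : -1 < x < 1 by apply/andP; split; lra.
  have di : -1 < m + delta < 1 by apply/andP; split; lra.
  have [_ ->] := drift_Hslope p beta h xi.
  have d1 : -1 < m + delta by case/andP: di.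
  apply: le_lt_trans (Hmono _ _ d1 xf x1) _.
  by have [_ <-] := drift_Hslope p beta h di; apply: rnear => //; lra.
have left x : -1 <= x -> x < m -> 0 < drift x.
  move=> x1 xm; have [xn|xf] := leP (m - delta) x; first exact: lnear.
  move: x1; rewrite le_eqVlt => /orP[/eqP <- //|x1].
  have xi : -1 < x < 1 by apply/andP; split; lra.
  have di : -1 < m - delta < 1 by apply/andP; split; lra.
  have [-> _] := drift_Hslope p beta h xi.
  have d1 : m - delta < 1 by case/andP: di.
  apply: lt_le_trans (Hmono _ _ x1 xf d1).
  by have [<- _] := drift_Hslope p beta h di; apply: lnear => //; lra.
by split.
Qed.
End Sign.

(** Bootstrapping gives a drift of order (x - m)^3; the term of drift_slope_curvature is then
    negligible against the curvature, which is negative of order (x - m)^2. *)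
Lemma special_restoring m : local_maximizer p beta h m ->
  (H^`(2))%classic m = 0 -> restoring_drift p beta h 2 m.
Proof.
move=> Hm H2; have mi := local_maximizer_interior beta_gt0 Hm.
have /andP[m1 m2] := mi.
have mb : -1 <= m <= 1 by rewrite !ltW.
have dm := drift_at_maximizer hp beta_gt0 Hm.
have mm : 0 < 1 - m ^+ 2.
  have -> : 1 - m ^+ 2 = (1 - m) * (1 + m) by ring.
  by rewrite mulr_gt0 //; lra.
have curv0 : curv m = 0.
  move: H2; rewrite derive2_H // => /eqP; rewrite mulf_eq0 invr_eq0 (gt_eqF mm) orbF.
  by move/eqP.
have [q2 qE] := double_root hp beta_gt0 Hm curv0.
have [_ /(_ q2 qE) q2m] := special_location hp beta_gt0 Hm curv0.
have [C C0 quad] := drift_quadratic hp beta_gt0 Hm curv0.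
have [C2 C20 [B2 CL]] := poly_lipschitz q2.
have curvE x : curv x = q2.[x] * (x - m) ^+ 2.
  by rewrite -horner_curv qE !hornerE.
have BC0 : 0 <= B * C by rewrite mulr_ge0.
pose C3 := C2 + B * C; have C30 : 0 <= C3 by rewrite addr_ge0.
have nsq (x : R) : `|x - m| ^+ 2 = (x - m) ^+ 2 by rewrite real_normK ?num_real.
have cubic x : -1 <= x <= 1 -> `|drift x| <= C3 * `|x - m| ^+ 3.
  apply: (drift_bootstrap mb dm C30) => {}x xb.
  have X1 := drift_slope_curvature p h beta_gt0 xb; rewrite -/B in X1.
  have X2 : `|curv x| <= C2 * `|x - m| ^+ 2.
    by rewrite curvE normrM normrX ler_wpM2r ?exprn_ge0 ?B2.
  have X3 : B * `|drift x| <= B * (C * `|x - m| ^+ 2) by rewrite ler_wpM2l ?quad.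
  have -> : Fd x = (Fd x - curv x) + curv x by ring.
  by apply: le_trans (ler_normD _ _) _; rewrite /C3; lra.
pose kap := - q2.[m] / 2; have kap0 : 0 < kap by rewrite /kap; lra.
pose T := C2 + B * C3 + 1.
have BC30 : 0 <= B * C3 by rewrite mulr_ge0.
have T0 : 0 < T by rewrite /T; lra.
pose delta := Num.min (kap / T) (Num.min ((1 - m) / 2) ((1 + m) / 2)).
have delta0 : 0 < delta by rewrite !lt_min divr_gt0 //=; lra.
have dT : delta <= kap / T by rewrite ge_min lexx.
have dr : delta <= (1 - m) / 2 by rewrite !ge_min lexx orbT.
have dl : delta <= (1 + m) / 2 by rewrite !ge_min lexx !orbT.
have slope x : -1 <= x <= 1 -> `|x - m| <= delta -> Fd x <= - kap * (x - m) ^+ 2.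
  move=> xb xd; have := drift_slope_curvature p h beta_gt0 xb; rewrite -/B.
  have := CL x m xb mb; rewrite !ler_norml => /andP[_ X1] /andP[_ X2].
  have X3 : B * `|drift x| <= B * (C3 * `|x - m| ^+ 3) by rewrite ler_wpM2l ?cubic.
  rewrite exprSr nsq in X3.
  have X4 : T * `|x - m| <= kap by rewrite mulrC -ler_pdivlMr // (le_trans xd).
  have sq0 := sqr_ge0 (x - m).
  have a0 := normr_ge0 (x - m).
  have X6 : q2.[m] = - (2 * kap) by rewrite /kap; field.
  have X7 : (q2.[x] + B * C3 * `|x - m|) * (x - m) ^+ 2 <= - kap * (x - m) ^+ 2.
    by apply: ler_wpM2r => //; move: X4; rewrite /T; lra.
  by rewrite curvE in X2; lra.
have mi' : -1 < m < 1 by rewrite m1.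
have half := slope_restoring mi' dm kap0 delta0 slope.
have k8 : 0 < kap / 8 by rewrite divr_gt0.
have dl1 : -1 < m - delta by lra.
have dr1 : m + delta < 1 by lra.
have [left right] := concave_sign mi' k8 delta0 dl1 dr1 half (curvature_le0 hp beta_gt0 Hm curv0).
apply: (@restoring_from_local R p beta h beta_gt0 2 m (kap / 8) delta C3) => //; last first.
  by move=> a b ab bb ad bd leab; apply: (slope_decr kap0 slope ab bb ad bd leab).
move=> x xb; apply: le_trans (ler_norm _) _; rewrite normrN normrM.
have -> : (x - m) ^+ (2 * 2) = `|x - m| * `|x - m| ^+ 3.
  by rewrite -exprS [LHS]exprM -nsq -exprM.
by rewrite mulrCA; apply: ler_wpM2l => //; exact: cubic.
Qed.
End SpecialDrift.

(** * Orders of the mixing time *)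

Section Asymptotics.
Variables (R : realType) (p : nat) (beta h : R).
Hypotheses (p_gt0 : (0 < p)%N) (beta_ge0 : 0 <= beta).

Lemma reciprocal_step r m0 C N S : (0 < N)%N -> 0 < S -> 4 * S <= N%:R ^+ 2 -> S ^+ r = N%:R ->
  (forall m, -1 <= m <= 1 -> - ((m - m0) * drift p beta h m) <= C * (m - m0) ^+ (2 * r)) ->
  forall x : cube N, @step R p beta h N (fun y => (1 + S * (mbar R y - m0) ^+ 2)^-1) x <=
    (1 + S * (mbar R x - m0) ^+ 2)^-1 + S / N%:R ^+ 2 *
     ((2 * C * (S * (mbar R x - m0) ^+ 2) ^+ r + 96) / (1 + S * (mbar R x - m0) ^+ 2) ^+ 2).
Proof.
move=> N_gt0 S0 SN SrN flat x.
rewrite (step_mbar _ _ _ N_gt0 (fun m => (1 + S * (m - m0) ^+ 2)^-1)).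
by apply: (lstep_reciprocal N_gt0 S0 SN SrN flat); exact: mbar_bound.
Qed.

(** Here S = N. For the lower bound, 1 / (1 + w) grows at most by the factor 1 + D / N per
    step, so up to time N log N / (2 D) by at most sqrt N, while it starts at order 1 / N. *)
Lemma regular_theta m0 eps : restoring_drift p beta h 1 m0 -> 0 < eps -> eps < 2^-1 ->
  is_Theta (tmix p beta h eps) (fun N => N%:R * ln (N%:R : R)).
Proof.
move=> rd eps0 eps1.
have [A [CU [NU [A1 CU0 upper]]]] := tmix_upper p_gt0 beta_ge0 rd (isT : (1 == 1)%N || (1 == 2)%N) eps0 eps1.
have [c1 c10 lower] := worst_tv_lower p_gt0 beta_ge0 (isT : (0 < 1)%N) rd.
case: rd => /andP[m1 m2] _ [C C0 flat] _ _.
pose D := 2 * C + 96; have D0 : 0 < D by rewrite /D; lra.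
pose g := (1 - m0) ^+ 2; have g0 : 0 < g by rewrite exprn_gt0 // subr_gt0.
have cg0 : 0 < c1 * g by exact: mulr_gt0.
have lA : 0 <= ln (A + 4).
  by rewrite ln_ge0 //; lra.
have [N1 HN1] := eventually_ge (expR 1 : R).
have [N2 HN2] := eventually_ge ((1 / (c1 * g)) ^+ 2).
exists (2 * D)^-1, (CU * (3 + ln (A + 4))); split.
- by rewrite invr_gt0 mulr_gt0.
- by rewrite mulr_gt0 //; lra.
exists (maxn (maxn NU 4) (maxn N1 N2)) => // N /=.
rewrite !geq_max => /andP[/andP[nu n4] /andP[/HN1 n1 /HN2 n2]].
have N_gt0 : (0 < N)%N by apply: leq_trans n4.
have Ngt0 : 0 < N%:R :> R by rewrite ltr0n.
have N4 : 4 <= N%:R :> R by rewrite (ler_nat R 4).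
have lnN : 1 <= ln N%:R :> R by rewrite -[leLHS](expRK 1) ler_ln ?posrE ?expR_gt0.
apply/andP; split.
  apply: tmix_ge => t tlt.
  apply: (lower N N%:R t eps N_gt0 Ngt0 (expr1 _) eps1).
  have S4 : 4 * N%:R <= N%:R ^+ 2 :> R by rewrite expr2 ler_wpM2r // ltW.
  have st := reciprocal_step N_gt0 Ngt0 S4 (expr1 N%:R) flat.
  set chi := fun y : cube N => (1 + N%:R * (mbar R y - m0) ^+ 2)^-1 in st *.
  have st' (x : cube N) : @step R p beta h N chi x <= (1 + D / N%:R) * chi x.
    apply: le_trans (st x) _; rewrite /chi expr1; set w := N%:R * _.
    have w0 : 0 <= w by rewrite mulr_ge0 ?sqr_ge0 // ltW.
    have d0 : 0 < 1 + w by rewrite ltr_wpDr.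
    have -> : (1 + D / N%:R) * (1 + w)^-1 =
      (1 + w)^-1 + N%:R / N%:R ^+ 2 * (D * (1 + w) / (1 + w) ^+ 2).
      by field; rewrite !lt0r_neq0.
    rewrite lerD2l; apply: ler_wpM2l; first by rewrite divr_ge0 ?exprn_ge0 // ltW.
    rewrite ler_pM2r ?invr_gt0 ?exprn_gt0 // /D.
    by have := mulr_ge0 C0 w0; lra.
  have a0 : 0 <= 1 + D / N%:R by rewrite addr_ge0 // divr_ge0 // ltW.
  apply: le_trans (iter_step_scale N_gt0 t a0 st' (all_plus N)) _.
  rewrite /chi mbar_all_plus // -/g.
  pose E : R := expR (ln N%:R / 2); have E0 : 0 < E by rewrite expR_gt0.
  have E2 : E ^+ 2 = N%:R.
    by rewrite expr2 -expRD -splitr lnK.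
  have pw : (1 + D / N%:R) ^+ t <= E.
    apply: (@le_trans _ _ (expR (D / N%:R) ^+ t)).
      by apply: lerXn2r; rewrite ?nnegrE ?expR_ge0 ?expR_ge1Dx.
    rewrite -expRM_natl ler_expR.
    have -> : ln N%:R / 2 = ((2 * D)^-1 * (N%:R * ln N%:R)) * (D / N%:R).
      by field; rewrite !lt0r_neq0.
    by apply: ler_wpM2r; [rewrite divr_ge0 // ltW|exact: ltW].
  have Eg : 1 / (c1 * g) <= E.
    rewrite -(@ler_pXn2r _ 2) ?nnegrE ?(ltW E0) ?E2 //.
    by rewrite divr_ge0 // mulr_ge0 // ltW.
  apply: (@le_trans _ _ (E * (N%:R * g)^-1)).
    apply: ler_pM => //; first by rewrite exprn_ge0.
      by rewrite invr_ge0 addr_ge0 // mulr_ge0 // ltW.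
    have Ng : 0 < N%:R * g by rewrite mulr_gt0.
    by rewrite lef_pV2 ?posrE // ?lerDr // addr_gt0.
  rewrite -E2 ler_pdivrMr; last by rewrite pmulr_lgt0 // exprn_gt0.
  rewrite (ler_pdivrMr _ _ cg0) in Eg.
  by have := ler_wpM2l (ltW E0) Eg; lra.
have U := upper N N%:R nu Ngt0 (expr1 _); apply: (le_trans U).
rewrite lee_fin -mulrA ler_pM2l // /concave_scale eqxx.
have lnA : ln (A + 4 * N%:R) <= ln (A + 4) + ln N%:R.
  rewrite -lnM ?posrE //; last lra.
  rewrite ler_ln ?posrE ?mulr_gt0 //; [|lra|lra].
  have : A * 1 <= A * N%:R by rewrite ler_wpM2l ?ler1n //; lra.
  lra.
have -> : N%:R ^+ 2 / N%:R = N%:R :> R by field; apply: lt0r_neq0.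
have X1 : ln (A + 4 * N%:R) * N%:R <= (ln (A + 4) + ln N%:R) * N%:R by rewrite ler_pM2r.
have X2 : N%:R * 1 <= N%:R * ln N%:R :> R by rewrite ler_pM2l.
have X3 := ler_wpM2l lA X2.
lra.
Qed.

Lemma powR_three_halves (x : R) : 0 < x -> x `^ (3 / 2) = x * Num.sqrt x.
Proof.
move=> x0; have -> : 3 / 2 = 1 + 2^-1 :> R by field.
by rewrite powRD ?powRr1 ?powR12_sqrt ?ltW //; apply/implyP => _; apply: lt0r_neq0.
Qed.

(** Here S = sqrt N and the time unit N^2 / S is N^(3/2). For the lower bound, the mean of
    1 / (1 + w) increases by at most D / N^(3/2) per step and starts at order 1 / sqrt N. *)
Lemma special_theta m0 eps : restoring_drift p beta h 2 m0 -> 0 < eps -> eps < 2^-1 ->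
  is_Theta (tmix p beta h eps) (fun N => (N%:R : R) `^ (3 / 2)).
Proof.
move=> rd eps0 eps1.
have [A [CU [NU [A1 CU0 upper]]]] := tmix_upper p_gt0 beta_ge0 rd (isT : (2 == 1)%N || (2 == 2)%N) eps0 eps1.
have [c1 c10 lower] := worst_tv_lower p_gt0 beta_ge0 (isT : (0 < 2)%N) rd.
case: rd => /andP[m1 m2] _ [C C0 flat] _ _.
pose D := 2 * C + 96; have D0 : 0 < D by rewrite /D; lra.
pose g := (1 - m0) ^+ 2; have g0 : 0 < g by rewrite exprn_gt0 // subr_gt0.
have cg0 : 0 < c1 * g by exact: mulr_gt0.
have [N2 HN2] := eventually_ge ((2 / (c1 * g)) ^+ 2).
exists (c1 / (2 * D)), (CU * 4); split.
- by rewrite divr_gt0 // mulr_gt0.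
- by rewrite mulr_gt0.
exists (maxn (maxn NU 4) N2) => // N /=.
rewrite !geq_max => /andP[/andP[nu n4] /HN2 n2].
have N_gt0 : (0 < N)%N by apply: leq_trans n4.
have Ngt0 : 0 < N%:R :> R by rewrite ltr0n.
have N4 : 4 <= N%:R :> R by rewrite (ler_nat R 4).
rewrite powR_three_halves //; set S := Num.sqrt N%:R.
have S0 : 0 < S by rewrite sqrtr_gt0.
have S2 : S ^+ 2 = N%:R by rewrite sqr_sqrtr // ltW.
have S1 : 1 <= S.
  by rewrite -(@ler_pXn2r _ 2) ?nnegrE ?(ltW S0) // expr1n S2; lra.
have SN : S <= N%:R by rewrite -S2 expr2 ler_peMr // ltW.
have S4 : 4 * S <= N%:R ^+ 2 by rewrite expr2 ler_pM // ltW.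
have NS : N%:R ^+ 2 / S = N%:R * S by rewrite -S2; field; apply: lt0r_neq0.
have NS0 : 0 < N%:R * S by rewrite mulr_gt0.
apply/andP; split.
  apply: tmix_ge => t tlt.
  apply: (lower N S t eps N_gt0 S0 S2 eps1).
  have st := reciprocal_step N_gt0 S0 S4 S2 flat.
  set chi := fun y : cube N => (1 + S * (mbar R y - m0) ^+ 2)^-1 in st *.
  have SNi : S / N%:R ^+ 2 = (N%:R * S)^-1 by rewrite -S2; field; apply: lt0r_neq0.
  have a0 : 0 <= D / (N%:R * S) by rewrite divr_ge0 // ltW.
  have st' (x : cube N) : @step R p beta h N chi x <= chi x + D / (N%:R * S).
    apply: le_trans (st x) _; rewrite /chi SNi lerD2l mulrC ler_pM2r ?invr_gt0 //.
    set w := S * _; have w0 : 0 <= w by rewrite mulr_ge0 ?sqr_ge0 // ltW.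
    have d0 : 0 < 1 + w by rewrite ltr_wpDr.
    rewrite ler_pdivrMr ?exprn_gt0 // /D.
    have := mulr_ge0 C0 w0; have := sqr_ge0 w; lra.
  apply: le_trans (iter_step_add N_gt0 t a0 st' (all_plus N)) _.
  rewrite /chi mbar_all_plus // -/g.
  have H1 : t%:R * (D / (N%:R * S)) <= c1 / 2.
    have -> : c1 / 2 = (c1 / (2 * D) * (N%:R * S)) * (D / (N%:R * S)).
      by field; rewrite !lt0r_neq0.
    by apply: ler_wpM2r => //; exact: ltW.
  have H2 : (1 + S * g)^-1 <= c1 / 2.
    have Sg : 2 / (c1 * g) <= S.
      rewrite -(@ler_pXn2r _ 2) ?nnegrE ?(ltW S0) ?S2 //.
      by rewrite divr_ge0 // mulr_ge0 // ltW.
    rewrite (ler_pdivrMr _ _ cg0) in Sg.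
    have d0 : 0 < 1 + S * g by rewrite addr_gt0 // mulr_gt0.
    rewrite -[leLHS]mul1r ler_pdivrMr //; lra.
  lra.
have U := upper N S nu S0 S2; apply: (le_trans U).
rewrite lee_fin NS -mulrA ler_pM2l // /concave_scale /=.
have lnS : ln N%:R <= 2 * S.
  rewrite -S2 expr2 lnM ?posrE //.
  have := ln_sublinear S0; lra.
have X1 : N%:R * ln N%:R <= N%:R * (2 * S) by rewrite ler_pM2l.
have A0 : 0 < A by lra.
have Ai : A^-1 <= 1 by rewrite invf_le1.
have Bi : 0 <= (A + 4 * S)^-1 by rewrite invr_ge0 addr_ge0 ?mulr_ge0 // ltW.
have X2 : (1 + (A^-1 - (A + 4 * S)^-1)) * (N%:R * S) <= 2 * (N%:R * S).
  by rewrite ler_pM2r //; lra.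
lra.
Qed.
End Asymptotics.

Local Open Scope classical_set_scope.

Theorem theorem2p1 (R : realType) (p : nat) (hp : (3 <= p)%N)
  (beta h : R) (hTheta : param_space (beta, h))
  (eps : R) (heps0 : 0 < eps) (heps1 : eps < 2^-1) :
  [/\ regular_points p (beta, h) ->
        is_Theta (tmix p beta h eps) (fun N => N%:R * ln (N%:R : R)),
      critical_points p (beta, h) ->
        ge_exp_Omega (tmix p beta h eps) &
      special_points p (beta, h) ->
        is_Theta (tmix p beta h eps) (fun N => (N%:R : R) `^ (3 / 2))].
Proof.
have beta_gt0 : 0 < beta := hTheta.
have p_gt0 : (0 < p)%N by apply: leq_trans hp.
split.
- move=> [_ [m [/= mi Hm H2 uniq]]].
  exact: (regular_theta p_gt0 (ltW beta_gt0)
    (regular_restoring hp beta_gt0 mi Hm H2 uniq) heps0 heps1).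
- by move=> crit; exact: critical_lower hp beta_gt0 eps crit heps1.
- move=> [_ [m [/= mi Hm _ H2]]].
  exact: (special_theta p_gt0 (ltW beta_gt0)
    (special_restoring hp beta_gt0 Hm H2) heps0 heps1).
Qed.
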